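(* Let $D\ge 2$ be an integer and let $\gamma,\nu$ be real numbers with $0<\nu\ll\gamma\ll 1$. Then there exists a threshold $n_0=n_0(D,\gamma,\nu)$ such that the following holds. If $n\ge n_0$, $G$ is a $\gamma$-non-extremal graph on $n$ vertices with minimum degree $\delta(G)\ge (1/2-\nu)n$, and $T$ is a tree on $n$ vertices with maximum degree $\Delta(T)\le D$, then $T$ is a subgraph of $G$ (i.e. $G$ contains a copy of $T$).
   Context: All graphs are simple. For a graph $G=(V,E)$ on $n$ vertices and $0<\gamma<1/4$, $G$ is called $\gamma$-non-extremal if for every pair of (not necessarily disjoint) subsets $A,B\subseteq V$ with $|A|=|B|=\lfloor n/2\rfloor$ we have $e(A,B)>\gamma n^2$, where $e(A,B)$ is the number of edges with one endpoint in $A$ and the other in $B$; otherwise $G$ is $\gamma$-extremal. The notation $\alpha\ll\beta$ means that $\alpha$ is sufficiently small compared to $\beta$ (concretely, $\alpha\le\beta^c$ for a suitable positive integer constant $c$); so the hypothesis means $\gamma$ is a sufficiently small positive constant and $\nu$ is sufficiently small with respect to $\gamma$. *)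

(* Defs.v *)
From HB Require Import structures.
From mathcomp Require Import all_boot all_order all_algebra.
From mathcomp Require Import reals.

Set Implicit Arguments.
Unset Strict Implicit.
Unset Printing Implicit Defensive.

Import Order.TTheory GRing.Theory Num.Theory.

Record sgraph := SGraph {
  vertex :> finType;
  adj : rel vertex;
  adj_sym : symmetric adj;
  adj_irr : irreflexive adj }.

Definition degree (G : sgraph) (x : G) : nat := #|[set y | adj x y]|.

Definition max_degree (G : sgraph) : nat := \max_(x : G) degree x.

(* The neutral element #|G| exceeds every degree, so it only matters for the
   empty graph, whose minimum degree is then 0. *)
Definition min_degree (G : sgraph) : nat := \big[minn/#|G|]_(x : G) degree x.

(* Edges are unordered pairs: an edge with both endpoints in A :&: B is
   counted once. *)
Definition edges_between (G : sgraph) (A B : {set G}) : {set {set G}} :=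
  [set [set x; y] | x in A, y in B & adj x y].

Definition non_extremal (R : realType) (gamma : R) (G : sgraph) : Prop :=
  forall A B : {set G}, #|A| = #|G|./2 -> #|B| = #|G|./2 ->
    (gamma * #|G|%:R ^+ 2 < #|edges_between A B|%:R)%R.

Definition connected (G : sgraph) : Prop :=
  0 < #|G| /\ forall x y : G, connect (@adj G) x y.

(* [ucycle] also accepts the empty sequence and the two-vertex sequence that
   runs along one edge and back; graph cycles are those of length at least 3. *)
Definition acyclic (G : sgraph) : Prop :=
  forall p : seq G, ucycle (@adj G) p -> size p < 3.

Definition tree (G : sgraph) : Prop := connected G /\ acyclic G.

Definition contains_copy (G H : sgraph) : Prop :=
  exists f : H -> G, injective f /\ forall x y : H, adj x y -> adj (f x) (f y).

(* Main.v *)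
Require Import Defs.
From mathcomp Require Import all_boot all_order all_algebra.
From mathcomp Require Import reals.
From mathcomp Require Import zify lra.

(* The theorem is reduced to counting statements about a graph satisfying
   [rich]: all degrees are at least n/2 - a and any two sets of about n/2
   vertices span at least 400 a n ordered edges, where a is a small constant
   fraction of n.  The embedding avoids the regularity lemma and uses three
   structures in G.

   - Tiles: almost all vertices are covered by disjoint copies of K_{q,q}, q a
     large constant.  Given a covering by much larger tiles (A_i, B_i) that
     misses a linear set L, if L sees both sides of many tiles, or itself, then
     the pigeonhole principle (a linear set against a set of constant size)
     yields bicliques that cover more.  Otherwise L sees only the sides A_i, so
     richness makes the union of the B_i dense; exchanging pieces of B_i with
     pieces of L makes a set that sees other B_j available, and L sees A_j.

   - Stars: for polynomially many requests (P, Q) with |P|, |Q| about n/2 there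
     are linearly few disjoint stars such that each request has linearly many of
     them with centre in P and leaves in Q.

   - Absorbers: a tree vertex w placed at the centre of a star, with all its
     tree neighbours on the leaves, can be moved to any vertex x adjacent to
     all the leaves, which frees its place.  Requests (N(y), N(x)) guarantee
     such a w for every unused x and every y waiting for a neighbour.

   Root the tree at a subtree of small linear size hanging on one edge.  This
   subtree is embedded greedily so that it uses the absorbers.  The rest is cut
   into pieces of bounded depth; the root of a piece and its children go to a
   reserved star that links the parent of the root to a tile, and the deeper
   levels go alternately to the two sides of the tile.  The last vertices are
   attached one at a time by absorption. *)

Set Implicit Arguments.
Unset Strict Implicit.
Unset Printing Implicit Defensive.

(** * Tilings by complete bipartite graphs *)

(** A minimum degree slightly below n/2 allows two almost disjoint cliques or an almost bipartite
    graph, where two neighbourhoods may span no edge at all. Richness excludes this: a neighbourhood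
    has about n/2 vertices, so of any two, equal or not, one contains linearly many vertices with
    linearly many neighbours in the other. This is why every request asks for sets of about n/2
    vertices.

    Uncovered vertices, reserved stars and the unusable ends of tiles waste a positive fraction of
    G, and the absorbers pay for it. Each request has at least n / bA of them, so the total waste
    must stay below about n / (2 bA). This dictates the order of the constants: bA, then the share 1
    / bR of connecting stars, then the depth h = 4 bR of pieces, so that there are fewer pieces than
    stars per request, then the size t' of the sets that connections aim at, and last the tile size
    q. The number of connection requests is a power of n whose exponent depends on t', hence on bR;
    so the star selection must give a share that does not depend on this exponent. *)

Definition edg (G : sgraph) (A B : seq G) : nat := \sum_(x <- A) count (adj x) B.

(* [lia] treats syntactically different spellings of the same canonical structure
   as different terms; abstracting with [move:], which works up to conversion,
   identifies them. *)
Ltac gen_atoms :=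
  repeat (let n := fresh "n" in move: (count _ _) => n);
  repeat (let n := fresh "n" in move: (size _) => n);
  repeat (let n := fresh "n" in move: (edg _ _) => n);
  repeat (let n := fresh "n" in move: (bigop.body _ _ _) => n);
  repeat (let n := fresh "n" in move: (card.body _) => n).

Ltac glia := gen_atoms; intros; lia.

Lemma count_sum (T : Type) (a : pred T) (s : seq T) : count a s = \sum_(x <- s) a x.
Proof. by rewrite -sum1_count big_mkcond /=; apply: eq_bigr => x _; case: (a x). Qed.

Lemma edg_sym (G : sgraph) (A B : seq G) : edg A B = edg B A.
Proof.
rewrite /edg (eq_bigr (fun x => \sum_(y <- B) adj x y)); last by move=> x _; exact: count_sum.
rewrite exchange_big /=; apply: eq_bigr => y _; rewrite count_sum.
by apply: eq_bigr => x _; rewrite adj_sym.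
Qed.

Lemma edg_catl (G : sgraph) (A A' B : seq G) : edg (A ++ A') B = edg A B + edg A' B.
Proof. by rewrite /edg big_cat. Qed.

Lemma edg_catr (G : sgraph) (A B B' : seq G) : edg A (B ++ B') = edg A B + edg A B'.
Proof. by rewrite ![edg A _]edg_sym edg_catl. Qed.

Lemma edg_flattenr (G : sgraph) (A : seq G) (Bs : seq (seq G)) :
  edg A (flatten Bs) = \sum_(B <- Bs) edg A B.
Proof.
elim: Bs => [|B Bs IH] /=; last by rewrite edg_catr IH big_cons.
by rewrite big_nil /edg big1.
Qed.

Lemma edg_perml (G : sgraph) (A A' B : seq G) : perm_eq A A' -> edg A B = edg A' B.
Proof. by move=> h; rewrite /edg (perm_big _ h). Qed.

Lemma edg_permr (G : sgraph) (A B B' : seq G) : perm_eq B B' -> edg A B = edg A B'.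
Proof. by move=> h; rewrite ![edg A _]edg_sym (edg_perml _ h). Qed.

Lemma edg_le (G : sgraph) (A B : seq G) : edg A B <= size A * size B.
Proof.
rewrite /edg; elim: A => [|x A IH]; first by rewrite big_nil.
by rewrite big_cons /= mulSn leq_add // count_size.
Qed.

(** * Bicliques between a linear set and sets of constant size *)

Lemma pigeonhole (A : Type) (F : finType) (f : A -> F) (s : seq A) q :
  0 < q -> q * #|F| <= size s -> 0 < size s -> exists m, q <= count (fun z => f z == m) s.
Proof.
move=> q0 hs s0.
case: (boolP [exists m, q <= count (fun z => f z == m) s]) => [/existsP //|].
rewrite negb_exists => /forallP h.
have e : size s = \sum_(m : F) count (fun z => f z == m) s.
  under eq_bigr do rewrite count_sum.
  rewrite exchange_big /= -sum1_size; apply: eq_bigr => z _.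
  rewrite (bigD1 (f z)) //= eqxx big1 ?addn0 // => m.
  by rewrite eq_sym => /negbTE ->.
have : \sum_(m : F) count (fun z => f z == m) s <= \sum_(m : F) q.-1.
  by apply: leq_sum => m _; have := h m; lia.
rewrite -e sum_nat_const; move: hs s0; move: (#|F|) => c; nia.
Qed.

Lemma split_count (T : eqType) (a : pred T) (s : seq T) q : q <= count a s ->
  exists s1 s2, [/\ perm_eq s (s1 ++ s2), size s1 = q & all a s1].
Proof.
move=> h; exists (take q (filter a s)), (drop q (filter a s) ++ filter (predC a) s); split.
- by rewrite catA cat_take_drop perm_sym perm_filterC.
- by rewrite size_takel // size_filter.
- by apply/allP => x /mem_take; rewrite mem_filter => /andP[].
Qed.

(** The argument of Kovari, Sos and Turan: by averaging, at least sg / 2 vertices of [P] have q or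
    more neighbours in [X]; their traces on [X] take at most 2^(kq) values, so q of them share a
    trace. [sg] bounds the average degree from [X] into [P] from below, and 2N <= k sg ensures that
    fewer than q neighbours per vertex of [P] account for at most half of the edges. *)
Lemma extract_biclique (G : sgraph) (P X : seq G) q k sg N : 0 < q -> 0 < k -> size X = k * q ->
  size P <= N -> 2 * N <= k * sg -> 2 * q * 2 ^ (k * q) <= sg ->
  sg * (k * q) <= edg P X ->
  exists x x' l P', [/\ perm_eq X (x ++ x'), perm_eq P (l ++ P'), size x = q, size l = q
    & allrel (@adj G) x l].
Proof.
move=> q0 k0 sX sP hN hs he.
pose b (z : G) := q <= count (adj z) X.
have h1 : edg P X <= count b P * (k * q) + size P * q.
  rewrite /edg; elim: (P) => [|z P' IH]; first by rewrite big_nil.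
  rewrite big_cons /= [b z]/b; case: (leqP q _) => hz.
    have := count_size (adj z) X; rewrite sX; nia.
  by rewrite add0n mulSn; lia.
have h2 : q * 2 ^ (k * q) <= count b P.
  have : sg * k <= count b P * k + size P by nia.
  nia.
have [m hm] : exists m : (size X).-tuple bool,
    q <= count (fun z => map_tuple (adj z) (in_tuple X) == m) (filter b P).
  apply: pigeonhole => //; rewrite ?card_tuple ?card_bool ?size_filter ?sX //.
  by apply: leq_trans h2; rewrite muln_gt0 q0 expn_gt0.
move: hm; rewrite count_filter => hm.
have [l [P' [hP sl al]]] := split_count hm.
have [z0 hz0] : exists z0, z0 \in l by case: (l) sl q0 => [|z l' _ _]; [move=> <-|exists z; rewrite inE eqxx].
have := allP al _ hz0 => /= /andP[/eqP ez bz].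
have [x [x' [hX sx ax]]] := split_count bz.
exists x, x', l, P'; split=> //.
apply/allrelP => y z hy hz; rewrite adj_sym.
have /= /andP[/eqP ez' _] := allP al _ hz.
have hyX : y \in X by rewrite (perm_mem hX) mem_cat hy.
have := congr1 val (etrans ez' (esym ez)) => /= /eq_in_map -> //.
by have := allP ax _ hy.
Qed.

Lemma edg_sub (G : sgraph) (P l P' X : seq G) : perm_eq P (l ++ P') ->
  edg P X <= edg P' X + size l * size X.
Proof. by move=> /edg_perml ->; rewrite edg_catl addnC leq_add2l edg_le. Qed.

(** Greedy extraction. Each earlier biclique removes q vertices from the pool [P], hence at most q
    |X i| edges, which is what the summand [size s * q] provides for. *)
Lemma extract_bicliques (G : sgraph) (I : Type) (X : I -> seq G) (s : seq I) (P : seq G) q k sg N :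
  0 < q -> 0 < k -> size P <= N -> 2 * N <= k * sg -> 2 * q * 2 ^ (k * q) <= sg ->
  all (fun i => (size (X i) == k * q) && ((sg + size s * q) * (k * q) <= edg P (X i))) s ->
  exists (s' : seq (I * (seq G * seq G * seq G))) P',
   [/\ map fst s' = s, perm_eq P (flatten (map (fun t => t.2.2) s') ++ P') &
     all (fun t => [&& perm_eq (X t.1) (t.2.1.1 ++ t.2.1.2), size t.2.1.1 == q,
        size t.2.2 == q & allrel (@adj G) t.2.1.1 t.2.2]) s'].
Proof.
move=> q0 k0 + hN hs; elim: s P => [|i s IH] P sP.
  by move=> _; exists [::], P; split.
rewrite /= => /andP[/andP[/eqP sX hX] hall].
have he : sg * (k * q) <= edg P (X i) by apply: leq_trans hX; rewrite leq_mul2r leq_addr orbT.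
have [x [x' [l [P1 [hx hl sx sl al]]]]] := extract_biclique q0 k0 sX sP hN hs he.
have sP1 : size P1 <= N.
  by apply: leq_trans sP; rewrite (perm_size hl) size_cat leq_addl.
have [|s' [P' [h1 h2 h3]]] := IH P1 sP1.
  apply: sub_all hall => i' /andP[/eqP s1 s2]; rewrite s1 eqxx /=.
  have := edg_sub (X i') hl; rewrite sl s1; move: s2; nia.
exists ((i, (x, x', l)) :: s'), P'; split=> /=; first by rewrite h1.
  by rewrite (perm_trans hl) // -catA perm_cat2l.
by rewrite hx sx sl !eqxx al.
Qed.

(* The paper's parameters enter through [a] alone: a is about n / (1000 g) with g
   about 1 / gamma, and nu n <= a. *)
Definition rich (G : sgraph) (a : nat) : Prop :=
  (forall x : G, #|G| <= 2 * count (adj x) (enum G) + 2 * a) /\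
  (forall A B : seq G, uniq A -> uniq B -> #|G| <= 2 * size A + 20 * a ->
     #|G| <= 2 * size B + 20 * a -> 400 * a * #|G| <= edg A B).

(** * Tilings and local exchanges in tiles *)

Definition flat (T : Type) (ts : seq (seq T * seq T)) : seq T :=
  flatten [seq p.1 ++ p.2 | p <- ts].

Definition tile (G : sgraph) (q : nat) (p : seq G * seq G) : bool :=
  [&& size p.1 == q, size p.2 == q & allrel (@adj G) p.1 p.2].

Definition tiling (G : sgraph) (q : nat) (V0 : seq G) (ts : seq (seq G * seq G))
    (L : seq G) : bool :=
  all (tile q) ts && perm_eq (flat ts ++ L) V0.

Lemma count_flat (T : Type) (b : pred T) (ts : seq (seq T * seq T)) :
  count b (flat ts) = \sum_(p <- ts) (count b p.1 + count b p.2).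
Proof.
rewrite /flat count_flatten -map_comp sumnE big_map.
by apply: eq_bigr => p _; rewrite /= count_cat.
Qed.

Lemma count_flatten_map (I T : Type) (b : pred T) (f : I -> seq T) (s : seq I) :
  count b (flatten (map f s)) = \sum_(i <- s) count b (f i).
Proof. by rewrite count_flatten -map_comp sumnE big_map. Qed.

Lemma size_flatten_map (I T : Type) (f : I -> seq T) (s : seq I) q :
  all (fun i => size (f i) == q) s -> size (flatten (map f s)) = size s * q.
Proof.
elim: s => //= i s IH /andP[/eqP h /IH]; rewrite size_cat h => ->.
by rewrite mulSn.
Qed.

Lemma chunks (T : Type) (s : seq T) m q : size s = m * q ->
  exists Xs : seq (seq T), [/\ flatten Xs = s, size Xs = m & all (fun X => size X == q) Xs].
Proof.
elim: m s => [|m IH] s.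
  by rewrite mul0n => /size0nil ->; exists [::].
rewrite mulSn => h.
have [|Xs [h1 h2 h3]] := IH (drop q s); first by rewrite size_drop h; lia.
exists (take q s :: Xs); split=> /=; first by rewrite h1 cat_take_drop.
  by rewrite h2.
by rewrite h3 size_takel ?eqxx // h; lia.
Qed.

Lemma good_chunk (T : eqType) (f : T -> nat) (s : seq T) k q c : 0 < k ->
  size s = k * q -> k * q * c <= \sum_(x <- s) f x ->
  exists y y', [/\ perm_eq s (y ++ y'), size y = q & q * c <= \sum_(x <- y) f x].
Proof.
elim: k s => // k IH s _ h hs.
case: (leqP (q * c) (\sum_(x <- take q s) f x)) => ht.
  exists (take q s), (drop q s); split; rewrite ?cat_take_drop ?size_takel //.
  by rewrite h; lia.
have e : \sum_(x <- s) f x = \sum_(x <- take q s) f x + \sum_(x <- drop q s) f x.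
  by rewrite -big_cat cat_take_drop.
have k0 : 0 < k.
  case: (k) h hs => // h hs; move: hs ht.
  by rewrite take_oversize ?mul1n; lia.
have [||y [y' [h1 h2 h3]]] := IH (drop q s) k0.
- by rewrite size_drop h; lia.
- by move: hs ht; rewrite e; lia.
exists y, (y' ++ take q s); split=> //.
apply/permP => b; rewrite -(cat_take_drop q s) catA !count_cat.
by move: (permP h1 b); rewrite cat_take_drop !count_cat; lia.
Qed.

Lemma all_choice (I J : Type) (a : pred I) (b : I -> J -> bool) (s : seq I) :
  (forall i, a i -> exists j, b i j) -> all a s ->
  exists s' : seq (I * J), map fst s' = s /\ all (fun t => b t.1 t.2) s'.
Proof.
move=> h; elim: s => [|i s IH] /=; first by exists [::].
move=> /andP[/h [j hj] /IH [s' [h1 h2]]]; exists ((i, j) :: s') => /=.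
by rewrite h1 h2 hj.
Qed.

Lemma sum_threshold (I : Type) (s : seq I) (f : I -> nat) U th :
  all (fun i => f i <= U) s ->
  \sum_(i <- s) f i <= count (fun i => th <= f i) s * U + size s * th.
Proof.
elim: s => [|i s IH] /=; first by rewrite big_nil.
move=> /andP[h /IH {}IH]; rewrite big_cons.
by case: (leqP th (f i)) => hi; rewrite ?add0n ?add1n !mulSn; lia.
Qed.

Lemma chop_tile (G : sgraph) j q (p : seq G * seq G) : tile (j * q) p ->
  exists ts', all (tile q) ts' /\ perm_eq (flat ts') (p.1 ++ p.2).
Proof.
case: p => A B; elim: j A B => [|j IH] A B /and3P[/= /eqP hA /eqP hB h].
  by exists [::]; move: hA hB; rewrite mul0n => /size0nil -> /size0nil ->.
rewrite mulSn in hA hB.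
have [|ts [h1 h2]] := IH (drop q A) (drop q B).
  rewrite /tile /= !size_drop hA hB addKn eqxx /=.
  by apply/allrelP => x y /mem_drop hx /mem_drop hy; apply: (allrelP h).
exists ((take q A, take q B) :: ts); split=> /=.
  rewrite h1 andbT /tile /= !size_takel ?eqxx ?hA ?hB ?leq_addr //=.
  by apply/allrelP => x y /mem_take hx /mem_take hy; apply: (allrelP h).
apply/permP => b; rewrite -{2}(cat_take_drop q A) -{2}(cat_take_drop q B).
have /permP/(_ b) := h2; rewrite /flat /= !count_cat => ->; clear; lia.
Qed.

Lemma chop (G : sgraph) j q (ts : seq (seq G * seq G)) : all (tile (j * q)) ts ->
  exists ts', all (tile q) ts' /\ perm_eq (flat ts') (flat ts).
Proof.
elim: ts => [|p ts IH] /=; first by exists [::].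
move=> /andP[/chop_tile [t1 [h1 h2]] /IH [t2 [h3 h4]]].
exists (t1 ++ t2); rewrite all_cat h1 h3; split=> //.
by rewrite /flat map_cat flatten_cat /= perm_cat.
Qed.

(** One trade per tile (A, B): a piece x of A forms the new tile (x, l) with outside vertices l, and
    a piece y of B becomes free. The rest of A and B is again balanced, of size (k - 1) q. The
    number of covered vertices does not change; the point is to free vertices that other tiles may
    see. *)
Lemma swap_tiles (G : sgraph) k q (s : seq ((seq G * seq G * (seq G * seq G)) * (seq G * seq G * seq G))) :
  0 < k ->
  all (fun t => [&& tile (k * q) t.1.1, perm_eq t.1.1.2 (t.1.2.1 ++ t.1.2.2), size t.1.2.1 == q,
    perm_eq t.1.1.1 (t.2.1.1 ++ t.2.1.2), size t.2.1.1 == q,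
        size t.2.2 == q & allrel (@adj G) t.2.1.1 t.2.2]) s ->
  exists ts', all (tile q) ts' /\
    perm_eq (flat ts' ++ flatten [seq t.1.2.1 | t <- s])
            (flat [seq t.1.1 | t <- s] ++ flatten [seq t.2.2 | t <- s]).
Proof.
move=> k0; elim: s => [|[[[A B] [y y']] [[x x'] l]] s IH] /=; first by exists [::].
move=> /andP[/and5P[/and3P[/= /eqP sA /eqP sB h] pB /eqP sy pA /and3P[/eqP sx sl al]] /IH [t2 [h3 h4]]].
have [|t1 [h1 h2]] := @chop_tile G k.-1 q (x', y').
  move: sA sB; rewrite (perm_size pA) (perm_size pB) !size_cat sx sy => sA sB.
  apply/and3P; split=> /=; try by apply/eqP; move: sA sB; case: (k) k0 => // k' _; rewrite mulSn /=; clear; lia.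
  apply/allrelP => u v hu hv; apply: (allrelP h).
    by rewrite (perm_mem pA) mem_cat hu orbT.
  by rewrite (perm_mem pB) mem_cat hv orbT.
exists ((x, l) :: t1 ++ t2); split.
  by rewrite /= all_cat h1 h3 /tile /= sx sl eqxx al.
apply/permP => b; move: (permP h2 b) (permP h4 b) (permP pA b) (permP pB b).
rewrite /flat /= map_cat flatten_cat !count_cat /=; clear; lia.
Qed.

(** Both sides give up q vertices, x to the outside partner l and y to the outside partner m. Using
    both sides keeps the rest balanced, and every tile gains 2q covered vertices. *)
Lemma augment_tiles (G : sgraph) k q
   (s : seq ((seq G * seq G * (seq G * seq G * seq G)) * (seq G * seq G * seq G))) :
  0 < k ->
  all (fun t => [&& perm_eq t.1.1.1 (t.1.2.1.1 ++ t.1.2.1.2), size t.1.2.1.1 == q,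
        size t.1.2.2 == q & allrel (@adj G) t.1.2.1.1 t.1.2.2]) s ->
  all (fun t => [&& tile (k * q) t.1.1, perm_eq t.1.1.2 (t.2.1.1 ++ t.2.1.2), size t.2.1.1 == q,
        size t.2.2 == q & allrel (@adj G) t.2.1.1 t.2.2]) s ->
  exists ts', all (tile q) ts' /\
    perm_eq (flat ts')
      (flat [seq t.1.1 | t <- s] ++ flatten [seq t.1.2.2 | t <- s] ++ flatten [seq t.2.2 | t <- s]).
Proof.
move=> k0; elim: s => [|[[[A B] [[x x'] l]] [[y y'] m]] s IH] /=; first by exists [::].
move=> /andP[/and4P[pA /eqP sx sl al] H1].
move=> /andP[/and5P[/and3P[/= /eqP sA /eqP sB h] pB /eqP sy sm am] H2].
have [t2 [h3 h4]] := IH H1 H2.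
have [|t1 [h1 h2]] := @chop_tile G k.-1 q (x', y').
  move: sA sB; rewrite (perm_size pA) (perm_size pB) !size_cat sx sy => sA sB.
  apply/and3P; split=> /=; try by apply/eqP; move: sA sB; case: (k) k0 => // k' _; rewrite mulSn /=; clear; lia.
  apply/allrelP => u v hu hv; apply: (allrelP h).
    by rewrite (perm_mem pA) mem_cat hu orbT.
  by rewrite (perm_mem pB) mem_cat hv orbT.
exists ((x, l) :: (y, m) :: t1 ++ t2); split.
  by rewrite /= all_cat h1 h3 /tile /= sx sl sy sm !eqxx al am.
apply/permP => b; move: (permP h2 b) (permP h4 b) (permP pA b) (permP pB b).
rewrite /flat /= map_cat flatten_cat !count_cat /=; clear; lia.
Qed.

(** * Three ways to enlarge a tiling *)

Lemma flat_cat (T : Type) (s t : seq (seq T * seq T)) : flat (s ++ t) = flat s ++ flat t.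
Proof. by rewrite /flat map_cat flatten_cat. Qed.

Lemma size_flat (G : sgraph) q (ts : seq (seq G * seq G)) :
  all (tile q) ts -> size (flat ts) = 2 * q * size ts.
Proof.
move=> h; rewrite /flat (@size_flatten_map _ _ _ _ (2 * q)) 1?mulnC //.
apply: sub_all h => p /and3P[/eqP h1 /eqP h2 _].
by rewrite size_cat h1 h2; apply/eqP; lia.
Qed.

Lemma uniq_size (T : finType) (s : seq T) : uniq s -> size s <= #|T|.
Proof. by move=> /card_uniqP <-; apply: max_card. Qed.

Lemma sum_lb (I : Type) (s : seq I) (f : I -> nat) c :
  all (fun i => c <= f i) s -> size s * c <= \sum_(i <- s) f i.
Proof.
elim: s => [|i s IH] /=; first by rewrite big_nil.
by move=> /andP[h /IH {}IH]; rewrite big_cons mulSn leq_add.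
Qed.

(** If [edg L L] is at least 16 a |L|, then at least 8a vertices of [L] have degree 8a or more
    inside [L]. Chunks of M k q such vertices are paired with bicliques into the rest of [L];
    removing the chunks costs each degree at most [sg <= a]. *)
Lemma gain_from_dense_leftover (G : sgraph) a q k sg M V0 (ts : seq (seq G * seq G)) L :
  0 < q -> 0 < k -> 2 * #|G| <= k * sg -> 2 * q * 2 ^ (k * q) <= sg ->
  M * (k * q) <= sg -> sg <= a -> uniq V0 -> 0 < size L ->
  tiling (k * q) V0 ts L -> 16 * a * size L <= edg L L ->
  exists ts' L', tiling q V0 ts' L' /\ size L' + 2 * q * M <= size L.
Proof.
move=> q0 k0 hN hs hM ha uV L0 /andP[hts hperm] hL.
have uL : uniq L by move: uV; rewrite -(perm_uniq hperm) cat_uniq => /and3P[].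
pose b x := 8 * a <= count (adj x) L.
have hb : 8 * a <= count b L.
  have h : all (fun x => count (adj x) L <= size L) L by apply/allP => x _; apply: count_size.
  have := sum_threshold (8 * a) h; rewrite -/(edg L L) -/b; clear -hL L0; nia.
have hMc : M * (k * q) <= count b L by apply: leq_trans hb; clear -hM ha; lia.
have [H [L1 [pL sH bH]]] := split_count hMc.
have [Xs [fX sX aX]] := chunks sH.
have sL1 : size L1 <= #|G|.
  apply: leq_trans (uniq_size uL); rewrite (perm_size pL) size_cat; exact: leq_addl.
have hpool : all (fun X => (size X == k * q) && ((sg + size Xs * q) * (k * q) <= edg L1 X)) Xs.
  apply/allP => X hX; rewrite (allP aX _ hX) edg_sym /edg /=.
  have sXe := eqP (allP aX _ hX).
  rewrite sX -{1}sXe mulnC; apply: sum_lb; apply/allP => x hx.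
  have /(allP bH) : x \in H by rewrite -fX; apply/flattenP; exists X.
  rewrite /b (permP pL) count_cat; have := count_size (adj x) H; rewrite sH.
  have : M * q <= M * (k * q) by rewrite leq_mul2l leq_pmull ?orbT.
  by clear -hM ha; glia.
have [s' [P' [h1 h2 h3]]] := extract_bicliques q0 k0 sL1 hN hs hpool.
have [ts2 [h4 h5]] := chop hts.
exists ([seq (t.2.1.1, t.2.2) | t <- s'] ++ ts2), (P' ++ flatten [seq t.2.1.2 | t <- s']).
have at1 : all (tile q) [seq (t.2.1.1, t.2.2) | t <- s'].
  by rewrite all_map; apply: sub_all h3 => t /and4P[_ /= h h' h'']; apply/and3P.
have ss' : size s' = M by rewrite -sX -h1 size_map.
have ptot : perm_eq (flat ([seq (t.2.1.1, t.2.2) | t <- s'] ++ ts2) ++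
     P' ++ flatten [seq t.2.1.2 | t <- s']) (flat ts ++ L).
  apply/permP => z; move: (permP h5 z) (permP h2 z) (permP pL z).
  rewrite flat_cat !count_cat (count_flat z [seq _ | _ <- _]) big_map.
  move: (count z (flat ts)) (count z (flat ts2)) => u v.
  rewrite -fX -h1 !count_flatten_map /=.
  have -> : \sum_(i <- s') count z i.1 = \sum_(i <- s') (count z i.2.1.1 + count z i.2.1.2).
    rewrite !big_seq; apply: eq_bigr => t /(allP h3) /and4P[/permP/(_ z)].
    by rewrite count_cat.
  rewrite !big_split /=; clear; glia.
split.
  by rewrite /tiling all_cat at1 h4 /= (perm_trans ptot).
move: (perm_size ptot); rewrite flat_cat !size_cat.
rewrite (perm_size h5) (size_flat at1) size_map ss'; clear; glia.
Qed.

(** The pool [Q] for the second sides may differ from the pool that served the first sides; the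
    swapping argument depends on this freedom. *)
Lemma augment_second_side (G : sgraph) k q sg N (s : seq (seq G * seq G * (seq G * seq G * seq G)))
    (Q : seq G) :
  0 < q -> 0 < k -> size Q <= N -> 2 * N <= k * sg -> 2 * q * 2 ^ (k * q) <= sg ->
  all (fun t => [&& perm_eq t.1.1 (t.2.1.1 ++ t.2.1.2), size t.2.1.1 == q,
        size t.2.2 == q & allrel (@adj G) t.2.1.1 t.2.2]) s ->
  all (fun t => tile (k * q) t.1 && ((sg + size s * q) * (k * q) <= edg Q t.1.2)) s ->
  exists ts' Q', [/\ all (tile q) ts',
    perm_eq (flat ts' ++ Q') (flat [seq t.1 | t <- s] ++ flatten [seq t.2.2 | t <- s] ++ Q) &
    size Q' + q * size s = size Q].
Proof.
move=> q0 k0 sQ hN hs h1 h2.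
have [|s' [Q' [e1 e2 e3]]] := @extract_bicliques G _ (fun t => t.1.2) s Q q k sg N q0 k0 sQ hN hs.
  by apply: sub_all h2 => t /andP[/and3P[_ -> _] ->].
have [||ts' [e4 e5]] := @augment_tiles G k q s' k0.
- by move: h1; rewrite -e1 all_map.
- have h2' : all (fun t => tile (k * q) t.1) s by apply: sub_all h2 => t /andP[].
  move: h2'; rewrite -e1 all_map => h2'; apply/allP => t ht.
  by have /= -> := allP h2' _ ht; apply: (allP e3 _ ht).
have f1 (f : seq G * seq G * (seq G * seq G * seq G) -> seq G) :
    [seq f t | t <- s] = [seq f t.1 | t <- s'] by rewrite -e1 -map_comp.
exists ts', Q'; split=> //.
  apply/permP => b; move: (permP e5 b) (permP e2 b).
  rewrite -e1 -!map_comp !count_cat; clear; glia.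
rewrite (perm_size e2) size_cat (@size_flatten_map _ _ _ _ q); last first.
  by apply: sub_all e3 => t /and4P[].
by rewrite -e1 size_map; clear; glia.
Qed.

Lemma size_sel (G : sgraph) (I : Type) (f : I -> seq G * seq G * seq G) (X : I -> seq G) q (s : seq I) :
   all (fun t => [&& perm_eq (X t) ((f t).1.1 ++ (f t).1.2), size (f t).1.1 == q,
        size (f t).2 == q & allrel (@adj G) (f t).1.1 (f t).2]) s ->
  size (flatten [seq (f t).2 | t <- s]) = size s * q.
Proof. by move=> h; apply: size_flatten_map; apply: sub_all h => t /and4P[]. Qed.

Lemma gain_from_two_sided_tiles (G : sgraph) k q sg V0 (js os : seq (seq G * seq G)) L :
  0 < q -> 0 < k -> size L <= #|G| -> 2 * #|G| <= k * sg -> 2 * q * 2 ^ (k * q) <= sg ->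
  size js * q <= sg ->
  tiling (k * q) V0 (js ++ os) L ->
  all (fun p => (4 * sg * (k * q) <= edg L p.1) && (4 * sg * (k * q) <= edg L p.2)) js ->
  exists ts' L', tiling q V0 ts' L' /\ size L' + 2 * q * size js <= size L.
Proof.
move=> q0 k0 sL hN hs hM /andP[]; rewrite all_cat => /andP[hjs hos] hperm hL.
have sT p : p \in js -> (size p.1 = k * q) * (size p.2 = k * q).
  by move=> /(allP hjs) /and3P[/eqP -> /eqP ->].
have [|s' [P' [e1 e2 e3]]] := @extract_bicliques G _ (fun p => p.1) js L q k sg #|G| q0 k0 sL hN hs.
  apply/allP => p hp; rewrite (sT _ hp) eqxx /=.
  have /andP[+ _] := allP hL _ hp; apply: leq_trans; rewrite leq_mul2r; apply/orP; right.
  by move: hM; clear; glia.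
have ss : size s' = size js by rewrite -e1 size_map.
have sl := size_sel e3; rewrite ss in sl.
have sP' : size P' <= #|G|.
  by apply: leq_trans sL; rewrite (perm_size e2) size_cat leq_addl.
have [|ts1 [Q' [e4 e5 e6]]] := @augment_second_side G k q sg #|G| s' P' q0 k0 sP' hN hs e3.
  apply/allP => t ht; have htj : t.1 \in js by rewrite -e1 map_f.
  rewrite (allP hjs _ htj) ss /=.
  have /andP[_ h4] := allP hL _ htj.
  have := edg_sub t.1.2 e2; rewrite sl (sT _ htj).
  have : size js * q * (k * q) <= sg * (k * q) by rewrite leq_mul2r hM orbT.
  move: h4; clear; move: (k * q) (size js * q) => T u; gen_atoms; nia.
have [ts2 [e7 e8]] := chop hos.
exists (ts1 ++ ts2), Q'; split.
  rewrite /tiling all_cat e4 e7 /=; apply: perm_trans hperm.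
  apply/permP => b; move: (permP e5 b) (permP e2 b) (permP e8 b).
  rewrite e1 !flat_cat !count_cat; clear; glia.
move: (perm_size e2) e6; rewrite size_cat sl ss; clear; glia.
Qed.

(** The piece freed from a second side is a chunk of at least average degree to [Bg], so the set [P]
    of all freed vertices inherits the density that the whole second sides have towards [Bg]. *)
Lemma swap_step (G : sgraph) k q sg N c (js : seq (seq G * seq G)) (L Bg : seq G) :
  0 < q -> 0 < k -> size L <= N -> 2 * N <= k * sg -> 2 * q * 2 ^ (k * q) <= sg ->
  all (tile (k * q)) js ->
  all (fun p => ((sg + size js * q) * (k * q) <= edg L p.1) && (k * q * c <= edg p.2 Bg)) js ->
  exists ts1 Ls Lr P, [/\ all (tile q) ts1, perm_eq L (Ls ++ Lr), size Ls = size js * q &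
    [/\ perm_eq (flat ts1 ++ Lr ++ P) (flat js ++ L), size P = size js * q & size P * c <= edg P Bg]].
Proof.
move=> q0 k0 sL hN hs hjs hj.
have hch : forall p : seq G * seq G, tile (k * q) p && (k * q * c <= edg p.2 Bg) ->
   exists yy : seq G * seq G, [&& perm_eq p.2 (yy.1 ++ yy.2), size yy.1 == q & q * c <= edg yy.1 Bg].
  move=> p /andP[/and3P[_ /eqP h1 _] h2].
  have [y [y' [h3 h4 h5]]] := good_chunk k0 h1 h2.
  by exists (y, y'); apply/and3P; split=> //; apply/eqP.
have [|r [r1 r2]] := all_choice hch (s := js).
  by apply/allP => p hp; rewrite (allP hjs _ hp); case/andP: (allP hj _ hp).
have sr : size r = size js by rewrite -r1 size_map.
have [|s' [Lr [e1 e2 e3]]] := @extract_bicliques G _ (fun t => t.1.1) r L q k sg N q0 k0 sL hN hs.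
  apply/allP => t ht; have htj : t.1 \in js by rewrite -r1 map_f.
  have /and3P[-> _ _] := allP hjs _ htj.
  by rewrite sr; case/andP: (allP hj _ htj).
have ss : size s' = size js by rewrite -sr -e1 size_map.
have [|ts1 [e4 e5]] := @swap_tiles G k q s' k0.
  apply/allP => t ht; have htr : t.1 \in r by rewrite -e1 map_f.
  have htj : t.1.1 \in js by rewrite -r1 map_f.
  have /and3P[-> -> _] := allP r2 _ htr.
  by rewrite (allP hjs _ htj) /=; apply: (allP e3 _ ht).
have er : [seq t.1.1 | t <- s'] = js by rewrite -r1 -e1 -map_comp.
have er2 : [seq t.1.2.1 | t <- s'] = [seq t.2.1 | t <- r] by rewrite -e1 -map_comp.
have sy : all (fun t => size t.2.1 == q) r by apply: sub_all r2 => t /and3P[].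
exists ts1, (flatten [seq t.2.2 | t <- s']), Lr, (flatten [seq t.2.1 | t <- r]).
have sP : size (flatten [seq t.2.1 | t <- r]) = size js * q.
  by rewrite (size_flatten_map sy) sr.
split=> //; first by rewrite (size_sel e3) ss.
split=> //.
  apply/permP => b; move: (permP e5 b) (permP e2 b); rewrite er er2 !count_cat.
  by clear; glia.
rewrite sP edg_sym edg_flattenr big_map -sr -mulnA; apply: sum_lb.
by apply: sub_all r2 => t /and3P[_ _]; rewrite edg_sym.
Qed.

Lemma sum_threshold2 (I : Type) (s : seq I) (f : I -> nat) U th :
  all (fun i => f i <= U) s ->
  \sum_(i <- s) f i <= count (fun i => th <= f i) s * U + count (fun i => f i < th) s * th.
Proof.
elim: s => [|i s IH] /=; first by rewrite big_nil.
move=> /andP[h /IH {}IH]; rewrite big_cons.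
by case: (leqP th (f i)) => hi; rewrite ?add0n ?add1n !mulSn; lia.
Qed.

Lemma count_enum_sub (G : sgraph) (V0 : seq G) (b : pred G) d : uniq V0 ->
  #|G| <= size V0 + d -> count b (enum G) <= count b V0 + d.
Proof.
move=> uV hV; pose W := [seq x <- enum G | x \notin V0].
have hp : perm_eq (enum G) (V0 ++ W).
  apply: uniq_perm; rewrite ?enum_uniq //.
    rewrite cat_uniq uV filter_uniq ?enum_uniq // andbT /=.
    by apply/hasPn => x; rewrite mem_filter => /andP[].
  move=> x; have hx : x \in enum G by rewrite mem_enum.
  apply/idP/idP => _; last exact: hx.
  rewrite mem_cat; case: (boolP (x \in V0)) => //= hx0.
  by rewrite mem_filter hx0; exact: hx.
move: (perm_size hp) hV; rewrite (permP hp) count_cat size_cat -cardE.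
have := count_size b W; clear; glia.
Qed.

(** Naming first the side that [L] sees better leaves a single quantity for the case distinction,
    the edges from [L] to second sides. *)
Lemma orient (G : sgraph) T V0 (ts : seq (seq G * seq G)) L : tiling T V0 ts L ->
  exists ts', tiling T V0 ts' L /\ all (fun p => edg L p.2 <= edg L p.1) ts'.
Proof.
pose f (p : seq G * seq G) := if edg L p.2 <= edg L p.1 then p else (p.2, p.1).
move=> /andP[h1 h2]; exists (map f ts); split.
  apply/andP; split.
    rewrite all_map; apply: sub_all h1 => p h; rewrite /= /f; case: ifP => // _.
    case/and3P: h => h3 h4 h5; rewrite /tile /= h3 h4 /=.
    by apply/allrelP => x y hx hy; rewrite adj_sym; apply: (allrelP h5).
  apply: perm_trans h2; rewrite perm_cat2r; apply/permP => b.
  rewrite !count_flat big_map; apply: eq_bigr => p _.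
  by rewrite /f; case: ifP => // _; rewrite addnC.
rewrite all_map; apply/allP => p _ /=; rewrite /f.
by case: (leqP (edg L p.2) (edg L p.1)) => //= /ltnW.
Qed.

Lemma edg_sum2 (G : sgraph) L (ts : seq (seq G * seq G)) :
  edg L (flat ts) = \sum_(p <- ts) edg L p.1 + \sum_(p <- ts) edg L p.2.
Proof.
rewrite /flat edg_flattenr big_map -big_split /=.
by apply: eq_bigr => p _; rewrite edg_catr.
Qed.

Lemma ltn_mulP a b c : 0 < c -> a * c <= b * c -> a <= b.
Proof. by move=> c0; rewrite leq_pmul2r. Qed.

(** The degrees give [L] at least |L| (n/2 - a) edges, of which a |L| may leave [V0], 16 a |L| stay
    in [L] and 16 a |L| go to second sides. So first sides receive |L| (n/2 - 34 a), although they
    have at most n/2 vertices together. A tile below half density wastes |L| T / 2 of this, so such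
    tiles have at most 68 a vertices on their first sides. *)
Lemma few_unsaturated_tiles (G : sgraph) a T V0 (ts : seq (seq G * seq G)) L :
  rich G a -> uniq V0 -> #|G| <= size V0 + a -> tiling T V0 ts L -> 0 < size L ->
  edg L L <= 16 * a * size L -> \sum_(p <- ts) edg L p.2 <= 16 * a * size L ->
  count (fun p => 2 * edg L p.1 < size L * T) ts * T <= 68 * a.
Proof.
move=> [deg _] uV hV /andP[hts hperm] L0 hLL hLB.
have sV := uniq_size uV.
have h1 : size L * #|G| <= 2 * edg L (enum G) + 2 * a * size L.
  rewrite /edg; elim: (L) => [|x L' IH]; first by rewrite mul0n.
  rewrite big_cons /= mulSn mulnDr mulnS; move: (deg x) IH; clear; glia.
have h2 : edg L (enum G) <= edg L V0 + a * size L.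
  rewrite /edg; elim: (L) => [|x L' IH]; first by rewrite !big_nil.
  rewrite !big_cons /= mulnS; have := count_enum_sub (adj x) uV hV.
  move: IH; clear; glia.
have h3 : edg L V0 = \sum_(p <- ts) edg L p.1 + \sum_(p <- ts) edg L p.2 + edg L L.
  by rewrite -(edg_permr L hperm) edg_catr edg_sum2.
have h4 : all (fun p => 2 * edg L p.1 <= 2 * size L * T) ts.
  apply/allP => p /(allP hts) /and3P[/eqP h _ _].
  by rewrite -mulnA leq_mul2l /= -h edg_le.
have := sum_threshold2 (size L * T) h4; rewrite -big_distrr /=.
have h5 : 2 * T * size ts <= #|G|.
  apply: leq_trans sV; rewrite -(perm_size hperm) size_cat (size_flat hts); exact: leq_addr.
have h6 : count (fun p => size L * T <= 2 * edg L p.1) ts + count (fun p => 2 * edg L p.1 < size L * T) ts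
   = size ts.
  rewrite -(count_predC (fun p => size L * T <= 2 * edg L p.1)); congr (_ + _).
  by apply: eq_count => p /=; rewrite ltnNge.
move=> h7; apply: (@ltn_mulP _ _ (size L)) => //.
move: h1 h2 h3 h5 h6 h7 hLL hLB; clear.
move: (edg L (enum G)) (edg L V0) (edg L L) (\sum_(p <- ts) edg L p.1) (\sum_(p <- ts) edg L p.2) => u v w s1 s2.
move: (count (fun p => 2 * edg L p.1 < size L * T) ts) (count _ _) => y x.
move: (size ts) (size L) => N l h1 h2 h3 h5 h6 h7 hLL hLB.
have : l * (2 * T * (x + y)) <= l * #|G| by rewrite h6 leq_mul2l h5 orbT.
move: h1 h2 h3 h7 hLL hLB; clear; move: #|G| => n; nia.
Qed.

(** The second sides together with [L] make up about half of the vertices, so richness yields 400 a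
    n ordered pairs. The three blocks that involve [L] cost at most 16 a n each, and 400 - 48 =
    352. *)
Lemma far_sides_dense (G : sgraph) a T V0 (ts : seq (seq G * seq G)) L :
  rich G a -> uniq V0 -> #|G| <= size V0 + a -> tiling T V0 ts L ->
  edg L L <= 16 * a * size L -> \sum_(p <- ts) edg L p.2 <= 16 * a * size L ->
  352 * a * #|G| <= edg (flatten [seq p.2 | p <- ts]) (flatten [seq p.2 | p <- ts]).
Proof.
move=> [_ dense] uV hV /andP[hts hperm] hLL hLB.
pose B := flatten [seq p.2 | p <- ts]; rewrite -/B.
have hLB' : edg L B <= 16 * a * size L by rewrite edg_flattenr big_map.
have sB : size B = size ts * T.
  by apply: size_flatten_map; apply: sub_all hts => p /and3P[].
have hp : perm_eq ((B ++ L) ++ flatten [seq p.1 | p <- ts]) V0.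
  apply: perm_trans hperm; apply/permP => b; rewrite !count_cat count_flat !count_flatten_map.
  rewrite big_split /=; clear; glia.
have uBL : uniq (B ++ L) by move: uV; rewrite -(perm_uniq hp) cat_uniq => /and3P[].
have sz : #|G| <= 2 * size (B ++ L) + 20 * a.
  move: hV; rewrite -(perm_size hperm) !size_cat (size_flat hts) sB.
  clear; glia.
have := dense _ _ uBL uBL sz sz.
rewrite edg_catl !edg_catr [edg B L]edg_sym.
have sL : size L <= #|G|.
  by apply: leq_trans (uniq_size uBL); rewrite size_cat leq_addl.
move: sL hLL hLB'; clear; move: (edg _ _) (edg _ _) (edg _ _) (size L) #|G| => x y z l n; nia.
Qed.

(** The second sides of the discarded tiles have at most 68 a vertices and meet at most 2 * 68 a n
    pairs; 352 - 136 = 216. *)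
Lemma saturated_far_sides_dense (G : sgraph) a T (n : nat) (ts : seq (seq G * seq G)) (b : pred (seq G * seq G)) :
  all (tile T) ts -> 2 * T * size ts <= n ->
  count (predC b) ts * T <= 68 * a ->
  352 * a * n <= edg (flatten [seq p.2 | p <- ts]) (flatten [seq p.2 | p <- ts]) ->
  216 * a * n <= edg (flatten [seq p.2 | p <- filter b ts]) (flatten [seq p.2 | p <- filter b ts]).
Proof.
move=> hts hN hb hB; set Bg := flatten _.
pose Bb := flatten [seq p.2 | p <- filter (predC b) ts].
have hp : perm_eq (flatten [seq p.2 | p <- ts]) (Bb ++ Bg).
  apply/permP => z; rewrite count_cat !count_flatten_map.
  rewrite (bigID b) /= addnC; congr (_ + _); rewrite big_filter //.
have sBb : size Bb = count (predC b) ts * T.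
  rewrite (@size_flatten_map _ _ _ _ T) ?size_filter //.
  apply/allP => p; rewrite mem_filter => /andP[_ /(allP hts) /and3P[]] //.
have sB : size (Bb ++ Bg) = size ts * T.
  rewrite -(perm_size hp) (@size_flatten_map _ _ _ _ T) //.
  by apply: sub_all hts => p /and3P[].
move: hB; rewrite (edg_perml _ hp) (edg_permr _ hp) edg_catl [edg Bg _]edg_catr [edg Bg Bb]edg_sym.
have hn : size Bb + size Bg <= n.
  by rewrite -size_cat sB; apply: leq_trans hN; rewrite -mulnA [size ts * T]mulnC leq_pmull.
have hu : size Bb * n <= 68 * a * n by rewrite leq_mul2r sBb hb orbT.
have h1 : edg Bb Bg <= size Bb * n.
  apply: leq_trans (edg_le _ _) _; rewrite leq_mul2l (leq_trans _ hn) ?orbT //; exact: leq_addl.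
have h2 : edg Bb (Bb ++ Bg) <= size Bb * n.
  by apply: leq_trans (edg_le _ _) _; rewrite leq_mul2l size_cat hn orbT.
move: hu h1 h2; clear; move: (size Bb * n) => u; glia.
Qed.

(** Swapping in M c tiles is neutral in number but yields a free set [P] of M c q vertices that sees
    [Bg]. Then M further tiles gain 2q vertices each, their first sides paired with the rest of [L]
    and their second sides with [P]; hence the net gain 2 q M. *)
Lemma gain_by_swapping (G : sgraph) a c q k sg M V0 (ts : seq (seq G * seq G)) L :
  0 < q -> 0 < k -> 0 < M -> 2 * #|G| <= k * sg -> 2 * q * 2 ^ (k * q) <= sg ->
  2 * c <= k -> 2 * 2 ^ (k * q) <= M -> #|G| <= c * a -> sg <= a -> 8 * sg <= size L ->
  c * M * (k * q) <= sg -> 0 < c -> 0 < a ->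
  rich G a -> uniq V0 -> #|G| <= size V0 + a -> tiling (k * q) V0 ts L ->
  edg L L <= 16 * a * size L -> \sum_(p <- ts) edg L p.2 <= 16 * a * size L ->
  exists ts' L', tiling q V0 ts' L' /\ size L' + 2 * q * M <= size L.
Proof.
move=> q0 k0 M0 hN hs hck hM2 hca hsa hsL hcM c0 a0 hr uV hV hti hLL hLB.
have T0 : 0 < k * q by rewrite muln_gt0 k0 q0.
have sg0 : 0 < sg by apply: leq_trans hs; rewrite !muln_gt0 q0 expn_gt0.
have L0 : 0 < size L by apply: leq_trans hsL; rewrite muln_gt0.
have hbad := few_unsaturated_tiles hr uV hV hti L0 hLL hLB.
have hBB := far_sides_dense hr uV hV hti hLL hLB.
case/andP: (hti) => hts hperm.
have sV := uniq_size uV.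
have hNT : 2 * (k * q) * size ts <= #|G|.
  apply: leq_trans sV; rewrite -(perm_size hperm) size_cat (size_flat hts); exact: leq_addr.
have sL : size L <= #|G|.
  by apply: leq_trans sV; rewrite -(perm_size hperm) size_cat leq_addl.
set good := fun p : seq G * seq G => size L * (k * q) <= 2 * edg L p.1.
have hbad' : count (predC good) ts * (k * q) <= 68 * a.
  by apply: leq_trans hbad; rewrite leq_mul2r; apply/orP; right;
     apply: sub_count => p /=; rewrite /good ltnNge.
have := saturated_far_sides_dense hts hNT hbad' hBB.
set gs := filter good ts; set Bg := flatten _ => hBg.
have hgs : all (tile (k * q)) gs.
  by apply/allP => p; rewrite mem_filter => /andP[_]; apply: (allP hts).
have sgs : 2 * (k * q) * size gs <= #|G|.
  by apply: leq_trans hNT; rewrite leq_mul2l size_filter count_size orbT.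
have sBg : size Bg <= #|G|.
  rewrite (@size_flatten_map _ _ _ _ (k * q)).
    by apply: leq_trans sgs; rewrite -mulnA mulnC -mulnA leq_pmull.
  by apply: sub_all hgs => p /and3P[].
(* By 2T |gs| <= n, tiles below the threshold carry at most 50 a n of the 216 a n pairs. A tile
   carries at most T n pairs, so the remainder needs at least M c tiles. *)
have hricht : M * c <= count (fun p => 100 * a * (k * q) <= edg p.2 Bg) gs.
  have hU : all (fun p => edg p.2 Bg <= k * q * #|G|) gs.
    apply/allP => p /(allP hgs) /and3P[_ /eqP h _].
    by apply: leq_trans (edg_le _ _) _; rewrite h leq_mul2l sBg orbT.
  have := sum_threshold (100 * a * (k * q)) hU.
  have -> : \sum_(p <- gs) edg p.2 Bg = edg Bg Bg.
    rewrite [in X in _ = edg _ X]/Bg edg_flattenr big_map.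
    by apply: eq_bigr => p _; rewrite edg_sym.
  have n0 : 0 < #|G| by apply: leq_trans sL.
  move=> hst; apply: (@ltn_mulP _ _ (k * q * #|G|)); first by rewrite muln_gt0 T0.
  have x1 : size gs * (100 * a * (k * q)) <= 50 * a * #|G|.
    have := leq_mul (leqnn (50 * a)) sgs; clear; gen_atoms; nia.
  have x2 : M * c * (k * q) * #|G| <= a * #|G|.
    by rewrite leq_mul2r [M * c]mulnC (leq_trans hcM hsa) orbT.
  have -> : M * c * (k * q * #|G|) = M * c * (k * q) * #|G| by rewrite mulnA.
  move: hst hBg x1 x2; clear; glia.
have [Is [rest [pI sI aI]]] := split_count hricht.
have hIt : all (tile (k * q)) Is.
  by apply/allP => p hp; apply: (allP hgs); rewrite (perm_mem pI) mem_cat hp.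
have hRt : all (tile (k * q)) rest.
  by apply/allP => p hp; apply: (allP hgs); rewrite (perm_mem pI) mem_cat hp orbT.
have hgood p : p \in gs -> size L * (k * q) <= 2 * edg L p.1.
  by rewrite mem_filter => /andP[].
have hMq : M * c * q <= sg.
  by apply: leq_trans hcM; rewrite [c * M]mulnC leq_mul2l leq_pmull ?orbT.
have [|ts1 [Ls [Lr [P [e1 e2 e3 [e4 e5 e6]]]]]] :=
   @swap_step G k q sg #|G| (100 * a) Is L Bg q0 k0 sL hN hs hIt.
  apply/allP => p hp; rewrite [k * q * (100 * a)]mulnC (allP aI _ hp) andbT.
  have : p \in gs by rewrite (perm_mem pI) mem_cat hp.
  move=> /hgood; rewrite sI => hg.
  have x1 : (sg + M * c * q) * (k * q) <= (2 * sg) * (k * q).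
    by rewrite leq_mul2r mul2n -addnn leq_add2l hMq orbT.
  have x2 : 8 * sg * (k * q) <= size L * (k * q) by rewrite leq_mul2r hsL orbT.
  move: x1 x2 hg; clear; glia.
rewrite sI in e3 e5.
(* The threshold 2 M q T is the share 2 / c of the maximum |P| T. Since n <= c a, the tiles below it
   carry at most a |P| of the 100 a |P| pairs, and the swapped tiles [Is] carry at most as many
   again. *)
have hsees : M <= count (fun p => 2 * (M * q) * (k * q) <= edg P p.2) rest.
  have hU : all (fun p => edg P p.2 <= size P * (k * q)) rest.
    by apply/allP => p /(allP hRt) /and3P[_ /eqP <- _]; exact: edg_le.
  have P0 : 0 < size P by rewrite e5 !muln_gt0 M0 c0 q0.
  have hst := sum_threshold (2 * (M * q) * (k * q)) hU.
  have x1 : edg P Bg = \sum_(p <- Is) edg P p.2 + \sum_(p <- rest) edg P p.2.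
    by rewrite edg_flattenr big_map (perm_big _ pI) big_cat.
  have x2 : \sum_(p <- Is) edg P p.2 <= a * size P.
    rewrite -(big_map snd predT) -edg_flattenr; apply: leq_trans (edg_le _ _) _.
    rewrite mulnC leq_mul2r (@size_flatten_map _ _ _ _ (k * q)) ?sI.
      by rewrite [M * c]mulnC (leq_trans hcM hsa) orbT.
    by apply: sub_all hIt => p /and3P[].
  have x3 : size rest * (2 * (M * q) * (k * q)) <= a * size P.
    have y1 : 2 * (k * q) * size rest <= c * a.
      apply: leq_trans hca; apply: leq_trans sgs; rewrite leq_mul2l (perm_size pI) size_cat.
      by rewrite leq_addl orbT.
    have := leq_mul y1 (leqnn (M * q)); rewrite e5; clear; gen_atoms; nia.
  apply: (@ltn_mulP _ _ (size P * (k * q))); first by rewrite muln_gt0 P0.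
  have x4 : M * (k * q) * size P <= a * size P.
    rewrite leq_mul2r; apply/orP; right; apply: leq_trans hsa; apply: leq_trans hcM.
    by rewrite leq_mul2r [c * M]mulnC leq_pmulr ?orbT.
  have -> : M * (size P * (k * q)) = M * (k * q) * size P by rewrite mulnA mulnAC.
  move: hst x1 x2 x3 x4 e6; clear; glia.
have [Js [os [pJ sJ aJ]]] := split_count hsees.
have hJt : all (tile (k * q)) Js.
  by apply/allP => p hp; apply: (allP hRt); rewrite (perm_mem pJ) mem_cat hp.
have hot : all (tile (k * q)) os.
  by apply/allP => p hp; apply: (allP hRt); rewrite (perm_mem pJ) mem_cat hp orbT.
have sLr : size Lr <= #|G|.
  by apply: leq_trans sL; rewrite (perm_size e2) size_cat leq_addl.
have [|s' [P' [f1 f2 f3]]] := @extract_bicliques G _ (fun p => p.1) Js Lr q k sg #|G| q0 k0 sLr hN hs.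
  apply/allP => p hp; have /and3P[-> _ _] := allP hJt _ hp; rewrite sJ /=.
  have hpg : p \in gs by rewrite (perm_mem pI) mem_cat (perm_mem pJ) mem_cat hp orbT.
  have := edg_sub p.1 e2; have := hgood _ hpg.
  have /and3P[/eqP -> _ _] := allP hJt _ hp; rewrite e3.
  have x1 : M * c * q * (k * q) <= sg * (k * q) by rewrite leq_mul2r hMq orbT.
  have x2 : 8 * sg * (k * q) <= size L * (k * q) by rewrite leq_mul2r hsL orbT.
  have x3 : M * q * (k * q) <= sg * (k * q).
    rewrite leq_mul2r; apply/orP; right; apply: leq_trans hMq.
    by rewrite leq_mul2r leq_pmulr ?orbT.
  by move: x1 x2 x3; clear; move: (edg _ _) (edg _ _) => u v; rewrite mulnDl; glia.
have ss : size s' = M by rewrite -sJ -f1 size_map.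
have sl := size_sel f3; rewrite ss in sl.
(* The pool is now only [P], with M c q vertices, so the extraction runs with M q in the role of
   [sg]. Its two size conditions become 2c <= k and 2 * 2^(kq) <= M. *)
have [|||ts2 [Q' [g1 g2 g3]]] := @augment_second_side G k q (M * q) (size P) s' P q0 k0 (leqnn _) _ _ f3 _.
- rewrite e5; have := leq_mul hck (leqnn (M * q)); clear; gen_atoms; nia.
- by rewrite mulnAC leq_mul2r; apply/orP; right.
- apply/allP => t ht; have htj : t.1 \in Js by rewrite -f1 map_f.
  rewrite (allP hJt _ htj) ss /=; have := allP aJ _ htj.
  by rewrite mul2n addnn.
have [ts3 [i1 i2]] : exists ts', all (tile q) ts' /\ perm_eq (flat ts') (flat (os ++ filter (predC good) ts)).
  apply: (@chop G k); rewrite all_cat hot /=.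
  by apply/allP => p; rewrite mem_filter => /andP[_]; apply: (allP hts).
exists (ts1 ++ ts2 ++ ts3), (P' ++ Q'); split.
  rewrite /tiling !all_cat e1 g1 i1 /=; apply: perm_trans hperm.
  apply/permP => b; move: (permP e4 b) (permP e2 b) (permP f2 b) (permP g2 b) (permP i2 b).
  have : count b (flat ts) = count b (flat gs) + count b (flat (filter (predC good) ts)).
    by rewrite !count_flat (bigID good) /= !big_filter.
  have -> : count b (flat gs) = count b (flat Is) + (count b (flat Js) + count b (flat os)).
    have h := perm_trans pI (perm_cat (perm_refl Is) pJ).
    by rewrite !count_flat (perm_big _ h) !big_cat.
  rewrite f1 !flat_cat !count_cat; clear; glia.
move: (perm_size f2) (perm_size e2) g3; rewrite !size_cat sl ss e3 e5; clear; glia.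
Qed.

Lemma rich_le (G : sgraph) a : rich G a -> 0 < #|G| -> 400 * a <= #|G|.
Proof.
move=> hr n0.
have sE : size (enum G) = #|G| by rewrite cardE.
have hE : #|G| <= 2 * size (enum G) + 20 * a by rewrite sE; clear; lia.
have := leq_trans (hr.2 _ _ (enum_uniq G) (enum_uniq G) hE hE) (edg_le _ _).
by rewrite sE leq_pmul2r.
Qed.

(** The values of [k] and [sg] are tied by 2n <= 2 c a <= k sg, where rounding costs a factor 2; and
    8 e sg <= a <= n <= e |L| gives 8 sg <= |L|. The cases: [L] is dense inside, or it sees many
    second sides after orientation, or neither. *)
Lemma tiling_step (G : sgraph) a c e q k sg M V0 (ts : seq (seq G * seq G)) L :
  0 < c -> 0 < e -> 0 < q -> k = 32 * e * c -> sg = a %/ (8 * e) -> M = sg %/ (c * (k * q)) ->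
  2 * 2 ^ (k * q) <= M -> rich G a -> #|G| <= c * a ->
  uniq V0 -> #|G| <= size V0 + a -> tiling (k * q) V0 ts L -> 0 < size L -> #|G| <= e * size L ->
  exists ts' L', tiling q V0 ts' L' /\ size L' + 2 * q * M <= size L.
Proof.
move=> c0 e0 q0 hk hsg hM hM2 hr hca uV hV hti L0 hL.
have k0 : 0 < k by rewrite hk !muln_gt0 e0 c0.
have T0 : 0 < k * q by rewrite muln_gt0 k0 q0.
have M0 : 0 < M by apply: leq_trans hM2; rewrite muln_gt0 expn_gt0.
have h1 : M * (c * (k * q)) <= sg by rewrite hM leq_trunc_div.
have h2 : 8 * e * sg <= a by rewrite hsg mulnC leq_trunc_div.
have hcM : c * M * (k * q) <= sg by move: h1; rewrite mulnA [M * c]mulnC.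
have hMT : M * (k * q) <= sg.
  by apply: leq_trans h1; rewrite leq_mul2l leq_pmull ?orbT.
have hqM : q * M <= sg by apply: leq_trans hMT; rewrite mulnC leq_mul2l leq_pmull ?orbT.
have hs2 : 2 * q * 2 ^ (k * q) <= sg.
  by apply: leq_trans hqM; rewrite [2 * q]mulnC -mulnA leq_mul2l hM2 orbT.
have sg0 : 0 < sg by apply: leq_trans hs2; rewrite !muln_gt0 q0 expn_gt0.
have hsa : sg <= a by apply: leq_trans h2; rewrite leq_pmull // muln_gt0 e0.
have a0 : 0 < a by apply: leq_trans hsa.
have h3 : a < (sg + 1) * (8 * e) by rewrite hsg addn1 ltn_ceil // muln_gt0 e0.
have hN : 2 * #|G| <= k * sg.
  have h4 : a <= 16 * e * sg by move: h3 sg0 e0; clear; nia.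
  have := leq_mul (leqnn (2 * c)) h4; move: hca; rewrite hk; clear; gen_atoms; nia.
have hck : 2 * c <= k by rewrite hk; move: e0; clear; nia.
case/andP: (hti) => hts hperm.
have sV := uniq_size uV.
have sL : size L <= #|G|.
  by apply: leq_trans sV; rewrite -(perm_size hperm) size_cat leq_addl.
have n0 : 0 < #|G| by apply: leq_trans sL.
have han : a <= #|G| by apply: leq_trans (rich_le hr n0); rewrite leq_pmull.
have h8 : 8 * sg <= size L.
  apply: (@ltn_mulP _ _ e) => //; move: (leq_trans h2 (leq_trans han hL)).
  by clear; rewrite mulnAC [e * _]mulnC.
case: (leqP (16 * a * size L) (edg L L)) => hLL.
  exact: (@gain_from_dense_leftover G a q k sg M V0 ts L).
have [ts' [hti' hor]] := orient hti.
case: (leqP (16 * a * size L) (\sum_(p <- ts') edg L p.2)) => hLB; last first.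
  by apply: (@gain_by_swapping G a c q k sg M V0 ts' L) => //; exact: ltnW.
case/andP: (hti') => hts' hperm'.
have hNT : 2 * (k * q) * size ts' <= #|G|.
  apply: leq_trans sV; rewrite -(perm_size hperm') size_cat (size_flat hts'); exact: leq_addr.
have hcnt : M <= count (fun p => 4 * sg * (k * q) <= edg L p.2) ts'.
  have hU : all (fun p => edg L p.2 <= size L * (k * q)) ts'.
    by apply/allP => p /(allP hts') /and3P[_ /eqP <- _]; exact: edg_le.
  have := sum_threshold (4 * sg * (k * q)) hU.
  move=> hst; apply: (@ltn_mulP _ _ (k * q * size L)); first by rewrite muln_gt0 T0.
  have x1 : size ts' * (4 * sg * (k * q)) <= a * size L.
    have := leq_mul (leqnn (2 * sg)) (leq_trans hNT hL).
    have := leq_mul h2 (leqnn (size L)); clear; gen_atoms; nia.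
  have x2 : M * (k * q) * size L <= a * size L by rewrite leq_mul2r (leq_trans hMT hsa) orbT.
  by move: hst hLB x1 x2; clear; rewrite !mulnA; glia.
have [js [os [pJ sJ aJ]]] := split_count hcnt.
rewrite -sJ; apply: (@gain_from_two_sided_tiles G k q sg V0 js os L) => //.
- by rewrite sJ mulnC.
- apply/andP; split; first by apply/allP => p; rewrite -(perm_mem pJ); apply: (allP hts').
  apply: perm_trans hperm'; rewrite perm_cat2r; apply/permP => b.
  by rewrite !count_flat (perm_big _ pJ).
- apply/allP => p hp; rewrite (allP aJ _ hp) andbT; apply: leq_trans (allP aJ _ hp) _.
  by apply: (allP hor); rewrite (perm_mem pJ) mem_cat hp.
Qed.

(* Each round replaces the tile size k q by q and gains a fixed fraction of the
   vertices, so the number of rounds does not depend on n. *)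
Lemma tiling_iter c e : 0 < c -> 0 < e -> forall j q, 0 < q -> exists n0, forall (G : sgraph) a V0,
  n0 <= #|G| -> rich G a -> #|G| <= c * a -> uniq V0 -> #|G| <= size V0 + a ->
  exists (ts : seq (seq G * seq G)) L, tiling q V0 ts L /\
    ((e * size L <= #|G|) \/ (512 * e ^ 2 * c ^ 3 * size L + j * #|G| <= 512 * e ^ 2 * c ^ 3 * #|G|)).
Proof.
move=> c0 e0; elim=> [|j IH] q q0.
  exists 0 => G a V0 _ _ _ uV _; exists [::], V0; split; first by rewrite /tiling /= perm_refl.
  by right; rewrite addn0 leq_mul2l uniq_size // orbT.
pose k := 32 * e * c; have k0 : 0 < k by rewrite !muln_gt0 e0 c0.
have [|n0 hn0] := IH (k * q); first by rewrite muln_gt0 k0.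
exists (n0 + c * (8 * e) * (c * (k * q)) * (2 * 2 ^ (k * q))) => G a V0 hn hr hca uV hV.
have [|ts [L [hti hL]]] := hn0 G a V0 _ hr hca uV hV.
  exact: leq_trans (leq_addr _ _) hn.
case: (leqP (e * size L) #|G|) => heL.
  case/andP: hti => /chop [ts' [h1 h2]] h3; exists ts', L; split; last by left.
  by rewrite /tiling h1; apply: perm_trans h3; rewrite perm_cat2r.
case: hL => [hL|hL]; first by move: heL; rewrite ltnNge hL.
pose sg := a %/ (8 * e); pose M := sg %/ (c * (k * q)).
have d1 : 0 < c * (k * q) by rewrite muln_gt0 c0 muln_gt0 k0 q0.
have d2 : 0 < 8 * e by rewrite muln_gt0 e0.
have hM : 2 * 2 ^ (k * q) <= M.
  rewrite /M (leq_divRL _ _ d1) /sg (leq_divRL _ _ d2).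
  apply: (@ltn_mulP _ _ c) => //; rewrite [a * c]mulnC; apply: leq_trans hca.
  apply: leq_trans (leq_trans (leq_addl _ _) hn).
  clear; move: (expn _ _) => u. lia.
have [|ts' [L' [h1 h2]]] := tiling_step c0 e0 q0 erefl erefl erefl hM hr hca uV hV hti _ (ltnW heL).
  by move: heL; rewrite lt0n; case: (size L) => //; rewrite muln0.
exists ts', L'; split=> //; right.
have M0 : 0 < M by apply: leq_trans hM; rewrite muln_gt0 expn_gt0.
(* The bounds n <= c a, a <= 16 e sg and sg <= 2 c k q M, with k = 32 e c, multiply to 1024 e^2 c^3
   q M. *)
have h3 : #|G| <= 512 * e ^ 2 * c ^ 3 * (2 * q * M).
  have sg0 : 0 < sg.
    by apply: leq_trans M0 _; apply: leq_div.
  have x1 : a <= sg * (16 * e).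
    have : a < (sg + 1) * (8 * e) by rewrite addn1 ltn_ceil.
    by move: sg0; clear; nia.
  have x2 : sg <= M * (2 * (c * (k * q))).
    have : sg < (M + 1) * (c * (k * q)) by rewrite addn1 ltn_ceil.
    by move: M0; clear; move: (c * (k * q)); nia.
  apply: leq_trans hca _.
  apply: leq_trans (leq_mul (leqnn c) x1) _.
  have := leq_mul x2 (leqnn (16 * e * c)); rewrite /k !expnS expn0; clear; nia.
move: hL h3 h2; clear; move: (512 * _ * _) (2 * q * M) => K m; gen_atoms; nia.
Qed.

(** After one round more than 512 e^2 c^3 the gains would exceed n, so the first alternative of
    [tiling_iter] must hold. *)
Theorem tiling_thm c e q : 0 < c -> 0 < e -> 0 < q -> exists n0, forall (G : sgraph) a V0,
  n0 <= #|G| -> rich G a -> #|G| <= c * a -> uniq V0 -> #|G| <= size V0 + a ->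
  exists (ts : seq (seq G * seq G)) L, tiling q V0 ts L /\ e * size L <= #|G|.
Proof.
move=> c0 e0 q0.
have [n0 h] := tiling_iter c0 e0 (512 * e ^ 2 * c ^ 3).+1 q0.
exists n0.+1 => G a V0 hn hr hca uV hV.
have [ts [L [h1 h2]]] := h G a V0 (ltnW hn) hr hca uV hV.
exists ts, L; split=> //; case: h2 => // h2.
by move: h2 hn; clear; rewrite mulSn; move: (512 * _ * _) => K; gen_atoms; nia.
Qed.

(** * Disjoint stars serving many requests *)

Lemma bernoulli x k : x ^ k.+1 + k.+1 * x ^ k <= x.+1 ^ k.+1.
Proof.
elim: k => [|k IH]; first by rewrite !expn1 expn0; lia.
have := leq_mul (leqnn x.+1) IH; rewrite -expnS; apply: leq_trans.
by rewrite ![x ^ _.+1]expnS; move: (x ^ k); clear; nia.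
Qed.

(** In other words (1 + 1/x)^(x+1) >= 2. For x = 2B - 1 this says that 2B steps of decay by the
    factor 1 - 1/(2B) at least halve a potential. *)
Lemma double_exp x : 2 * x ^ x.+1 <= x.+1 ^ x.+1.
Proof.
apply: leq_trans (bernoulli x x); rewrite mul2n -addnn leq_add2l.
by rewrite [x ^ x.+1]expnS leq_mul2r leqnSn orbT.
Qed.

Lemma poly_lt_exp C b : 0 < b -> exists n0, forall n, n0 <= n -> n ^ C < 2 ^ (n %/ b).
Proof.
move=> b0.
pose K := 4 * C.+1 * b.
have K0 : 0 < K by rewrite !muln_gt0 b0.
exists (2 * b * (C * (2 * K)).+1) => n hn.
have hn1 : 2 * b <= n by apply: leq_trans hn; rewrite leq_pmulr.
pose u := n %/ K; pose v := n %/ b.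
have hu : n < (u + 1) * K by rewrite addn1 ltn_ceil.
have hv : n < (v + 1) * b by rewrite addn1 ltn_ceil.
have huK : u * K <= n by apply: leq_trunc_div.
have h1 : n <= 2 * K * 2 ^ u.
  have : u < 2 ^ u by apply: ltn_expl.
  by move: hu K0; clear; move: (2 ^ u) => y; clearbody u K; nia.
have h3 : 2 * K * 2 ^ u <= 2 ^ (2 * K + u).
  by rewrite expnD leq_mul2r (ltnW (ltn_expl _ _)) ?orbT.
have h2 : n ^ C <= 2 ^ (2 * K * C + u * C).
  rewrite -mulnDl expnM; case: (C) => [|C']; first by rewrite !expn0.
  by rewrite leq_exp2r // (leq_trans h1 h3).
apply: leq_ltn_trans h2 _; rewrite ltn_exp2l //.
have h4 : 4 * C.+1 * u <= v.
  rewrite /v leq_divRL //; apply: leq_trans huK; rewrite /K eq_leq //; clear; lia.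
have h5 : 2 * (C * (2 * K)).+1 <= v.
  by rewrite /v leq_divRL //; apply: leq_trans hn; rewrite mulnAC.
rewrite -/v; move: h4 h5; clear; clearbody K u v; lia.
Qed.


(** Averaging over the candidates: if each of them served less than a 1/B share of the total weight,
    the sum over all candidates would contradict that every index is served by at least N / B of
    them. *)
Lemma weighted_pick (S I : finType) (ok : pred S) (good : I -> pred S) (W : I -> nat) B N :
  #|S| <= N -> 0 < N -> (exists s, ok s) ->
  (forall i, N <= B * #|[pred s | ok s && good i s]|) ->
  exists2 s, ok s & \sum_i W i <= B * \sum_(i | good i s) W i.
Proof.
move=> hS N0 [s0 ok0] h.
case: (boolP [exists s, ok s && (\sum_i W i <= B * \sum_(i | good i s) W i)]).
  by case/existsP => s /andP[h1 h2]; exists s.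
rewrite negb_exists => /forallP hc.
have hc' s : ok s -> B * \sum_(i | good i s) W i < \sum_i W i.
  by move=> oks; have := hc s; rewrite oks /= -ltnNge.
have e1 : \sum_(s | ok s) B * \sum_(i | good i s) W i = \sum_i B * #|[pred s | ok s && good i s]| * W i.
  rewrite -big_distrr /=.
  under eq_bigr do rewrite big_mkcond /=.
  rewrite exchange_big big_distrr /=; apply: eq_bigr => i _.
  rewrite -mulnA; congr (_ * _); rewrite -big_mkcondr /= sum_nat_const.
  by congr (_ * _); apply: eq_card.
have h1 : N * \sum_i W i <= \sum_(s | ok s) B * \sum_(i | good i s) W i.
  rewrite e1 big_distrr /=; apply: leq_sum => i _; by rewrite leq_mul2r h orbT.
have h2 : \sum_(s | ok s) (B * \sum_(i | good i s) W i).+1 <= \sum_(s | ok s) \sum_i W i.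
  by apply: leq_sum => s; apply: hc'.
have h3 : \sum_(s | ok s) \sum_i W i <= N * \sum_i W i.
  rewrite sum_nat_const leq_mul2r; apply/orP; right.
  by apply: leq_trans hS; apply: max_card.
have := leq_trans h2 (leq_trans h3 h1).
under eq_bigr do rewrite -addn1.
rewrite big_split /= -[X in _ <= X]addn0 leq_add2l (bigD1 s0) //=.
Qed.

Lemma ffact_lb m n d : m + d <= n -> m ^ d <= n ^_ d.
Proof.
elim: d n => [|d IH] n h; first by rewrite expn0 ffactn0.
by rewrite expnS ffactnS leq_mul ?IH //; lia.
Qed.

Lemma count_avoid (T : eqType) (b : pred T) (Q U : seq T) : uniq Q ->
  count b Q <= count (fun y => b y && (y \notin U)) Q + size U.
Proof.
move=> uQ; set b' := fun y => _.
have h1 : count b Q <= count (predU b' (mem U)) Q.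
  by apply: sub_count => y hy; rewrite /= /b' hy /=; case: (y \in U).
have h2 : count (mem U) Q <= size U.
  rewrite -size_filter; apply: uniq_leq_size; first exact: filter_uniq.
  by move=> y; rewrite mem_filter => /andP[].
by apply: leq_trans h1 _; have := count_predUI b' (mem U) Q; move: h2; clear; glia.
Qed.

Definition sverts (G : sgraph) (D : nat) (s : G * D.-tuple G) : seq G := s.1 :: s.2.

Definition is_star (G : sgraph) (D : nat) (s : G * D.-tuple G) : bool :=
  uniq (sverts s) && all (adj s.1) s.2.

Definition fits (G : sgraph) (D : nat) (P Q : seq G) (s : G * D.-tuple G) : bool :=
  (s.1 \in P) && all (mem Q) s.2.

Definition large_set (G : sgraph) (a : nat) (P : seq G) : Prop :=
  uniq P /\ #|G| <= 2 * size P + 20 * a.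

(** Vertices of [P] below the threshold carry at most 200 a n of the 400 a n pairs, and every other
    vertex carries at most n. *)
Lemma many_connectors (G : sgraph) a (P Q : seq G) : rich G a -> 0 < #|G| ->
  large_set a P -> large_set a Q -> 200 * a <= count (fun x => 200 * a <= count (adj x) Q) P.
Proof.
move=> [_ dense] n0 [uP hP] [uQ hQ]; set b := fun x => _.
have hall : all (fun x => count (adj x) Q <= #|G|) P.
  by apply/allP => x _; apply: leq_trans (count_size _ _) (uniq_size uQ).
have := sum_threshold (200 * a) hall; rewrite -/(edg P Q) -/b => h1.
have h2 := dense _ _ uP uQ hP hQ; have h3 := uniq_size uP.
apply: (@ltn_mulP _ _ #|G|) => //.
have h4 : size P * (200 * a) <= #|G| * (200 * a) by rewrite leq_mul2r h3 orbT.
by move: h1 h2 h4; clear; gen_atoms; nia.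
Qed.

(** A centre and then D distinct leaves can be chosen outside [U] with at least [a] options each
    time, so at least a^(D+1) stars fit. Among the n^(D+1) candidates this is a share of at least
    c^-(D+1), whatever the request. *)
Lemma card_stars (G : sgraph) D c a (U P Q : seq G) : rich G a -> #|G| <= c * a ->
  size U <= 2 * a -> large_set a P -> large_set a Q -> D <= a -> 0 < a -> 0 < #|G| ->
  #|G| ^ D.+1 <= c ^ D.+1 *
   #|[pred s : G * D.-tuple G | [&& is_star s, all (fun v => v \notin U) (sverts s) & fits P Q s]]|.
Proof.
move=> hr hca hU hP hQ hD a0 n0; have [uP _] := hP; have [uQ _] := hQ.
set X := [pred s | _].
have hX : #|X| = \sum_(x : G) #|[set t : D.-tuple G | X (x, t)]|.
  rewrite -sum1_card big_mkcond /=.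
  rewrite -(pair_bigA _ (fun x t => if (x, t) \in X then 1 else 0)) /=.
  apply: eq_bigr => x _; rewrite -big_mkcond sum1_card; apply: eq_card => t.
  by rewrite inE.
pose b x := 200 * a <= count (adj x) Q.
have hb : 200 * a <= count b P := many_connectors hr n0 hP hQ.
pose P' := [seq x <- P | b x && (x \notin U)].
have sP' : a <= size P'.
  have := count_avoid b U uP; rewrite -size_filter => h1.
  by rewrite size_filter; move: h1 hb hU; rewrite size_filter; clear; glia.
have uP' : uniq P' by apply: filter_uniq.
have h1 : size P' * a ^ D <= #|X|.
  rewrite hX; apply: (@leq_trans (\sum_(x <- P') #|[set t : D.-tuple G | X (x, t)]|)); last first.
    rewrite big_uniq //= [X in _ <= X](bigID (mem P')) /=; exact: leq_addr.
  apply: sum_lb; apply/allP => x; rewrite mem_filter => /andP[/andP[bx xU] xP].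
  pose A := [pred y | (y \in Q) && (adj x y && (y \notin U))].
  have hA : a + D <= #|A|.
    have e : #|A| = count (fun y => adj x y && (y \notin U)) Q.
      rewrite -size_filter; have /card_uniqP <- := filter_uniq (fun y => adj x y && (y \notin U)) uQ.
      by apply: eq_card => y; rewrite inE mem_filter andbC.
    have := count_avoid (adj x) U uQ; rewrite e; move: bx hU hD; rewrite /b; clear; glia.
  apply: leq_trans (ffact_lb hA) _; rewrite -card_uniq_tuples.
  apply: subset_leq_card; apply/subsetP => t; rewrite !inE => /andP[/allP ht ut].
  rewrite /X /= /is_star /sverts /fits /= ut xU xP /= !andbT.
  have h2 y : y \in t -> [&& y \in Q, adj x y & y \notin U] by move=> /ht.
  apply/and3P; split.
  - apply/andP; split; last by apply/allP => y /h2 /and3P[].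
    by apply/negP => /h2 /and3P[_]; rewrite adj_irr.
  - by apply/allP => y /h2 /and3P[].
  - by apply/allP => y /h2 /and3P[].
apply: leq_trans (leq_mul (leqnn _) (leq_trans _ h1)); last first.
  by apply: leq_mul sP' (leqnn _).
by rewrite -expnS -expnMn leq_exp2r.
Qed.

(* Derandomised choice: the potential \sum_i 2 ^ (m - number of stars serving i)
   shrinks by a factor 1 - 1/(2B) at every step, because an average star serves
   a 1/B fraction of any weighted family of requests. *)
Lemma star_iter (G : sgraph) D c a (Z : seq G) (I : finType) (P Q : I -> seq G) m :
  rich G a -> #|G| <= c * a -> size Z <= a -> D <= a -> 0 < a -> 0 < #|G| -> 0 < c ->
  (forall i, large_set a (P i) /\ large_set a (Q i)) -> m * D.+1 <= a -> 0 < #|I| ->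
  let B := c ^ D.+1 in
  forall j, j <= m -> exists cs : seq (G * D.-tuple G),
    [/\ uniq (flatten (map (@sverts G D) cs)), all (fun v => v \notin Z) (flatten (map (@sverts G D) cs)),
      all (@is_star G D) cs, size cs = j &
      (2 * B) ^ j * \sum_i 2 ^ (m - count (fits (P i) (Q i)) cs) <= (2 * B).-1 ^ j * (#|I| * 2 ^ m)].
Proof.
move=> hr hca hZ hD a0 n0 c0 hPQ hm I0 B.
have B0 : 0 < B by rewrite expn_gt0 c0.
elim=> [|j IH] hj.
  exists [::]; split=> //=; rewrite !mul1n.
  by rewrite (eq_bigr (fun=> 2 ^ m)) ?sum_nat_const // => i _; rewrite subn0.
have [cs [u1 u2 u3 u4 u5]] := IH (ltnW hj).
pose U := Z ++ flatten (map (@sverts G D) cs).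
have sU : size U <= 2 * a.
  rewrite size_cat (@size_flatten_map _ _ _ _ D.+1); last first.
    by apply/allP => s _; rewrite /sverts /= size_tuple.
  rewrite u4 mul2n -addnn leq_add //; apply: leq_trans hm; rewrite leq_mul2r (ltnW hj) orbT //.
pose ok (s : G * D.-tuple G) := is_star s && all (fun v => v \notin U) (sverts s).
pose W i := 2 ^ (m - count (fits (P i) (Q i)) cs).
have hcard i : #|G| ^ D.+1 <= B * #|[pred s | ok s && fits (P i) (Q i) s]|.
  have [h1 h2] := hPQ i.
  have := card_stars hr hca sU h1 h2 hD a0 n0; congr (_ <= _ * _).
  by apply: eq_card => s; rewrite !inE /ok andbA.
have [i0 _] := card_gt0P I0.
have hex : exists s, ok s.
  have : 0 < #|[pred s | ok s && fits (P i0) (Q i0) s]|.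
    rewrite lt0n; apply/eqP => e; have := hcard i0.
    by rewrite e muln0 leqNgt expn_gt0 n0.
  by move=> /card_gt0P [s]; rewrite inE => /andP[h _]; exists s.
have [||s oks hs] := @weighted_pick _ I ok (fun i s => fits (P i) (Q i) s) W B (#|G| ^ D.+1) _ _ hex hcard.
- by rewrite card_prod card_tuple -expnS.
- by rewrite expn_gt0 n0.
case/andP: oks => h1 h2.
have e : flatten (map (@sverts G D) (s :: cs)) = sverts s ++ flatten (map (@sverts G D) cs) by [].
exists (s :: cs); rewrite e; split; last 1 first.
- rewrite /=; have hstep : 2 * B * \sum_i 2 ^ (m - (fits (P i) (Q i) s + count (fits (P i) (Q i)) cs)) <=
   (2 * B).-1 * \sum_i W i.
  (* A served request halves its term and the others keep theirs. The chosen star serves at least a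
     1/B share of the weight, which gives the factor 1 - 1/(2B). *)
  have e1 : 2 * \sum_i 2 ^ (m - (fits (P i) (Q i) s + count (fits (P i) (Q i)) cs)) +
     \sum_(i | fits (P i) (Q i) s) W i = 2 * \sum_i W i.
    rewrite [X in _ + X]big_mkcond !big_distrr /= -big_split /=; apply: eq_bigr => i _.
    case: (fits (P i) (Q i) s); last by rewrite add0n addn0.
    (* Subtraction is truncated: only because fewer than m stars have been chosen does the exponent
       really drop by one. *)
    have hlt : count (fits (P i) (Q i)) cs < m.
      by apply: leq_ltn_trans (count_size _ _) _; rewrite u4.
    rewrite /W (_ : m - count _ cs = (m - (1 + count (fits (P i) (Q i)) cs)).+1); last by lia.
    by rewrite [2 ^ _.+1]expnS; clear; move: (expn _ _) => y; lia.
  move: e1 hs B0; clear; gen_atoms; nia.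
rewrite !expnS.
have := leq_mul (leqnn ((2 * B) ^ j)) hstep; have := leq_mul (leqnn (2 * B).-1) u5.
rewrite -/W; clear; move: (2 * B).-1 (2 * B) => x y; gen_atoms.
by move: (expn y j) (expn x j) => Y X; lia.
- rewrite cat_uniq u1 andbT; case/andP: (h1) => -> _ /=.
  apply/hasPn => v hv; apply/negP => hv'.
  by have := allP h2 _ hv'; rewrite mem_cat hv orbT.
- rewrite all_cat u2 andbT.
  by apply: sub_all h2 => v; rewrite mem_cat negb_or => /andP[].
- by rewrite /= h1.
- by rewrite /= u4.
Qed.

(** The share 1/b is fixed before the exponent C, because a polynomial number of requests costs only
    a factor below 2^K with K linear in n. The parameter [r] limits the vertices spent on stars to
    about n / r. *)
Theorem star_selection D c r : 0 < c -> c <= r -> exists2 b, 0 < b & forall C, exists n0,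
  forall (G : sgraph) a (Z : seq G) (I : finType) (P Q : I -> seq G),
  n0 <= #|G| -> rich G a -> #|G| <= c * a -> size Z <= a -> #|I| <= #|G| ^ C ->
  (forall i, large_set a (P i) /\ large_set a (Q i)) ->
  exists cs : seq (G * D.-tuple G),
    [/\ uniq (flatten (map (@sverts G D) cs)), all (fun v => v \notin Z) (flatten (map (@sverts G D) cs)),
      all (@is_star G D) cs, r * D.+1 * size cs <= #|G| &
      forall i, #|G| <= b * count (fits (P i) (Q i)) cs].
Proof.
move=> c0 hcr; pose B := c ^ D.+1; have B0 : 0 < B by rewrite expn_gt0 c0.
have r0 : 0 < r by apply: leq_trans hcr.
pose b1 := 4 * B * r * D.+1; have b10 : 0 < b1 by rewrite !muln_gt0 B0 r0.
exists (2 * b1); first by rewrite muln_gt0.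
move=> C; have [n0 hn0] := poly_lt_exp C b10.
exists (n0 + b1 + c * D.+1) => G a Z I P Q hn hr hca hZ hI hPQ.
(* The m steps form 2K blocks of 2B steps, each of which at least halves the potential. It ends at
   no more than |I| 2^(m - 2K) < 2^(m - K), a value that one request served fewer than K times would
   reach alone. *)
pose K := #|G| %/ b1; pose m := 4 * B * K.
have hK : K * b1 <= #|G| by apply: leq_trunc_div.
have hrm : r * D.+1 * m <= #|G|.
  by apply: leq_trans hK; rewrite /m /b1; clear; lia.
have nb : b1 <= #|G| by apply: leq_trans hn; rewrite addnAC leq_addl.
have n1 : 0 < #|G| by apply: leq_trans nb.
have hma : m * D.+1 <= a.
  apply: (@ltn_mulP _ _ c) => //; rewrite [a * c]mulnC; apply: leq_trans hca.
  apply: leq_trans hrm; have := leq_mul hcr (leqnn (D.+1 * m)).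
  by clear; clearbody m; rewrite !mulnA; lia.
have hDa : D.+1 <= a.
  rewrite -(leq_pmul2l c0); apply: leq_trans hca; apply: leq_trans hn; exact: leq_addl.
case: (posnP #|I|) => [I0|I0].
  exists [::]; split; rewrite //= ?muln0 // => i.
  by have := card0_eq I0 i; rewrite inE.
have a0 : 0 < a by apply: leq_trans hDa.
have [cs [u1 u2 u3 u4 u5]] := @star_iter G D c a Z I P Q m hr hca hZ (ltnW hDa) a0 n1 c0 hPQ hma I0 m (leqnn m).
exists cs; split=> //; first by rewrite u4.
move=> i; have hnK : #|G| <= 2 * b1 * K.
  have : #|G| < (K + 1) * b1 by rewrite addn1 ltn_ceil.
  have : 0 < K by rewrite divn_gt0.
  by clear; clearbody K b1; gen_atoms; nia.
apply: leq_trans hnK _; rewrite leq_mul2l; apply/orP; right.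
rewrite leqNgt; apply/negP => hlt.
have hKm : K <= m by rewrite /m leq_pmull // muln_gt0.
have h1 : 2 ^ (m - K) <= \sum_i 2 ^ (m - count (fits (P i) (Q i)) cs).
  rewrite (bigD1 i) //=; apply: leq_trans (leq_addr _ _); rewrite leq_exp2l //; lia.
have h2 : (2 * B) ^ m <= (2 * B).-1 ^ m * (#|I| * 2 ^ K).
  rewrite -(leq_pmul2r (m := 2 ^ (m - K))) ?expn_gt0 //.
  apply: leq_trans (leq_mul (leqnn _) h1) _; apply: leq_trans u5 _.
  by rewrite -!mulnA -expnD subnKC.
have h3 : 2 ^ (2 * K) * (2 * B).-1 ^ m <= (2 * B) ^ m.
  have -> : m = (2 * B) * (2 * K) by rewrite /m; clear; lia.
  rewrite ![_ ^ (2 * B * _)]expnM -expnMn leq_exp2r //; last by rewrite muln_gt0 divn_gt0.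
  by have := double_exp (2 * B).-1; rewrite prednK // muln_gt0.
have h4 : #|I| < 2 ^ K.
  apply: leq_ltn_trans hI _; apply: hn0; apply: leq_trans hn; rewrite -addnA leq_addr //.
have := leq_trans h3 h2; rewrite mulnC leq_pmul2l; last first.
  by rewrite expn_gt0; move: B0; clear; clearbody B; lia.
by rewrite mul2n -addnn expnD leq_pmul2r ?expn_gt0 // leqNgt h4.
Qed.

(** * Orders of a tree in which every vertex has one earlier neighbour *)

Inductive tree_order (T : sgraph) : seq T -> Prop :=
| tree_order1 x : tree_order [:: x]
| tree_order_rcons s x y : tree_order s -> x \notin s -> y \in s -> adj x y ->
    (forall z, z \in s -> adj x z -> z = y) -> tree_order (rcons s x).

Lemma tree_order_uniq (T : sgraph) (s : seq T) : tree_order s -> uniq s.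
Proof. by elim=> // {}s x y _ us xs _ _ _; rewrite rcons_uniq xs. Qed.

Lemma tree_order_gt0 (T : sgraph) (s : seq T) : tree_order s -> 0 < size s.
Proof. by elim=> // {}s x y *; rewrite size_rcons. Qed.

Definition inside (T : sgraph) (s : seq T) : rel T := fun u v => [&& adj u v, u \in s & v \in s].

Lemma tree_order_connect (T : sgraph) (s : seq T) : tree_order s ->
  forall y z, y \in s -> z \in s -> connect (inside s) y z.
Proof.
elim=> [x y z|{}s x y os IH xs ys axy _].
  by rewrite !inE => /eqP -> /eqP ->; exact: connect0.
have sub u v : connect (inside s) u v -> connect (inside (rcons s x)) u v.
  apply: connect_sub => {}u {}v /and3P[h1 h2 h3]; apply: connect1.
  by rewrite /inside h1 !mem_rcons !inE h2 h3 !orbT.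
have exy : inside (rcons s x) x y by rewrite /inside axy !mem_rcons !inE ys eqxx orbT.
have eyx : inside (rcons s x) y x by rewrite /inside adj_sym axy !mem_rcons !inE ys eqxx orbT.
move=> u v; rewrite !mem_rcons !inE => /orP[/eqP ->|us] /orP[/eqP ->|vs].
- exact: connect0.
- exact: connect_trans (connect1 exy) (sub _ _ (IH _ _ ys vs)).
- exact: connect_trans (sub _ _ (IH _ _ us ys)) (connect1 eyx).
- exact: sub (IH _ _ us vs).
Qed.

(** Two earlier neighbours of [x] are joined by a simple path inside [s], which closes through [x]
    to a cycle of length at least 3. *)
Lemma tree_order_neighbor (T : sgraph) (s : seq T) x y z : acyclic T -> tree_order s ->
  x \notin s -> y \in s -> z \in s -> adj x y -> adj x z -> z = y.
Proof.
move=> hT os xs ys zs axy axz; apply/eqP; apply/negPn/negP => zy.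
have /connectP[p hp ez] := tree_order_connect os ys zs.
case/shortenP: hp ez => q hq uq _ ez.
have hqs : all (mem s) q.
  elim: q (y) hq {uq ez ys axy zy} => //= v q IH w /andP[/and3P[_ _ vs] /IH ->].
  by rewrite andbT.
have hqa : path (@adj T) y q by apply: sub_path hq => u v /and3P[].
have := hT (x :: y :: q); rewrite /ucycle /= axy rcons_path hqa -ez adj_sym axz /=.
have xq : x \notin q by apply: contra xs => /(allP hqs).
move: uq; rewrite cons_uniq => /andP[yq uq].
rewrite inE (negbTE xq) orbF yq uq !andbT.
have -> : x != y by apply: contraNneq xs => ->.
move=> /(_ isT); case: q ez {hq hqs hqa xq yq uq} => //= ez.
by rewrite ez eqxx in zy.
Qed.

(** The start [s] is arbitrary because the order is built twice: from a single vertex in order to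
    find a subtree, then again with that subtree in front. *)
Lemma tree_order_extend (T : sgraph) (s : seq T) : tree T -> tree_order s ->
  exists t, tree_order (s ++ t) /\ forall x, x \in s ++ t.
Proof.
move=> [[_ hc] ha]; move: {2}(#|T| - size s) (erefl (#|T| - size s)) => d.
elim: d s => [|d IH] s hd os.
  exists [::]; rewrite cats0; split=> // x.
  have /card_uniqP e := tree_order_uniq os.
  have h : #|T| <= #|s| by rewrite e; lia.
  have e2 : #|s| = #|T| by apply/eqP; rewrite eqn_leq max_card h.
  by have /(_ x) := elimT (subset_cardP e2) (subset_predT _).
case: (boolP [forall x, x \in s]) => [/forallP h|].
  by exists [::]; rewrite cats0.
rewrite negb_forall => /existsP[w ws].
have [r rs] : exists r, r \in s.
  by case: (os) => [r|s' r y *]; exists r; rewrite ?mem_rcons inE eqxx.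
have /connectP[p hp ew] := hc r w.
have [x [y [xs ys axy]]] : exists x y, [/\ x \notin s, y \in s & adj x y].
  elim: p r rs hp ew => [|v p IHp] r rs /=; first by move=> _ ew; rewrite ew rs in ws.
  move=> /andP[arv hp] ew; case: (boolP (v \in s)) => vs; first exact: (IHp v).
  by exists v, r; rewrite adj_sym.
have os' : tree_order (rcons s x).
  apply: (tree_order_rcons os xs ys axy) => z zs axz.
  exact: (tree_order_neighbor ha os xs ys zs axy axz).
have [|t [h1 h2]] := IH (rcons s x) _ os'; first by rewrite size_rcons; lia.
by exists (x :: t); rewrite -cat_rcons.
Qed.

(* [parent r s 0] is a junk value. *)
Definition parent (T : sgraph) (r : T) (s : seq T) (i : nat) : nat :=
  find (@adj T (nth r s i)) s.

Lemma parentP (T : sgraph) (r : T) (s : seq T) : tree_order s ->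
  forall i, 0 < i < size s ->
  [/\ parent r s i < i, adj (nth r s i) (nth r s (parent r s i)) &
   forall k, k < i -> adj (nth r s i) (nth r s k) -> k = parent r s i].
Proof.
move=> os i /andP[i0 hi].
have [j [hj aj uj]] : exists j, [/\ j < i, adj (nth r s i) (nth r s j) &
   forall k, k < i -> adj (nth r s i) (nth r s k) -> k = j].
  have us := tree_order_uniq os.
  elim: os us i i0 hi => [x _ i i0|{}s x y os IH xs ys axy uxy us i i0]; first by case: i i0.
  rewrite size_rcons ltnS leq_eqVlt; case/orP => [/eqP ->|hi].
    rewrite nth_rcons ltnn eqxx; exists (index y s).
    rewrite nth_rcons index_mem ys nth_index //; split=> // k hk.
    rewrite nth_rcons hk => /(uxy _ (mem_nth _ hk)) <-.
    by rewrite index_uniq //; case: (us); rewrite rcons_uniq => /andP[].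
  have us' : uniq s by case: (us); rewrite rcons_uniq => /andP[].
  have [j [h1 h2 h3]] := IH us' i i0 hi.
  exists j; rewrite !nth_rcons hi (ltn_trans h1 hi); split=> // k hk.
  by rewrite nth_rcons (ltn_trans hk hi); apply: h3.
have hjs : j < size s by apply: ltn_trans hi.
have hp : parent r s i <= j.
  rewrite leqNgt; apply/negP => hlt; have := before_find r hlt.
  by rewrite aj.
have ha : adj (nth r s i) (nth r s (parent r s i)).
  by apply: nth_find; rewrite has_find; apply: leq_ltn_trans hjs.
have e : parent r s i = j by apply: uj => //; apply: leq_ltn_trans hj.
by rewrite e.
Qed.

Lemma parent_adj (T : sgraph) (r : T) (s : seq T) i j : tree_order s ->
  i < size s -> j < size s -> adj (nth r s i) (nth r s j) ->
  (0 < j /\ parent r s j = i) \/ (0 < i /\ parent r s i = j).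
Proof.
move=> os hi hj a; case: (ltngtP i j) => hij.
- left; have j0 : 0 < j by apply: leq_ltn_trans hij.
  have [|_ _ h] := @parentP T r s os j; first by rewrite j0.
  by split=> //; rewrite -(h i) // adj_sym.
- right; have i0 : 0 < i by apply: leq_ltn_trans hij.
  have [|_ _ h] := @parentP T r s os i; first by rewrite i0.
  by split=> //; rewrite -(h j).
- by rewrite hij adj_irr in a.
Qed.

(** * Subtrees, and the coding of a tree by parent indices *)

Definition children (par : nat -> nat) (n i : nat) : seq nat :=
  [seq j <- iota 0 n | (0 < j) && (par j == i)].

Lemma size_children (T : sgraph) (r : T) (s : seq T) D i : tree_order s -> max_degree T <= D ->
  size (children (parent r s) (size s) i) <= D.
Proof.
move=> os hD; apply: leq_trans hD.
set ch := children _ _ _.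
case: (posnP (size ch)) => [->//|hc].
have hch j : j \in ch -> [/\ j < size s, 0 < j & parent r s j = i].
  by rewrite mem_filter mem_iota add0n => /andP[/andP[h1 /eqP h2] h3].
apply: leq_trans (@leq_bigmax _ (@degree T) (nth r s i)); rewrite /degree cardE.
have us := tree_order_uniq os.
have -> : size ch = size [seq nth r s j | j <- ch] by rewrite size_map.
apply: uniq_leq_size.
  rewrite map_inj_in_uniq ?filter_uniq ?iota_uniq // => j k /hch[h1 _ _] /hch[h2 _ _] /eqP.
  by rewrite nth_uniq // => /eqP.
move=> _ /mapP[j /hch[h1 h2 h3] ->]; rewrite mem_enum inE.
have [|_ + _] := @parentP T r s os j; first by rewrite h2.
by rewrite h3 adj_sym.
Qed.

Lemma mem_iota0 n j : (j \in iota 0 n) = (j < n).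
Proof. by rewrite mem_iota. Qed.

(** [par] is an arbitrary function, so the recursion needs a bound; the index itself suffices when
    parents precede their children. *)
Fixpoint ancestor_fuel (par : nat -> nat) (f i j : nat) : bool :=
  (i == j) || (if f is f'.+1 then (0 < j) && ancestor_fuel par f' i (par j) else false).

Definition ancestor (par : nat -> nat) (i j : nat) : bool := ancestor_fuel par j i j.

Lemma ancestor_fuelE par n i : (forall j, 0 < j < n -> par j < j) ->
  forall f f' j, j < n -> j <= f -> j <= f' -> ancestor_fuel par f i j = ancestor_fuel par f' i j.
Proof.
move=> hp; elim=> [|f IH] [|f'] j hj; rewrite ?leqn0 => h1 h2.
- by [].
- by move: h1 => /eqP ->.
- by move: h2 => /eqP ->.
- rewrite /=; case: (posnP j) => // j0; congr (_ || _).
  have hpj := hp j; rewrite j0 hj in hpj; have {}hpj := hpj isT.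
  by apply: IH; lia.
Qed.

Lemma ancestorE par n i j : (forall j, 0 < j < n -> par j < j) -> j < n ->
  ancestor par i j = (i == j) || ((0 < j) && ancestor par i (par j)).
Proof.
move=> hp; rewrite /ancestor; case: j => [|j] hj //=.
congr (_ || _); have hpj := hp j.+1 hj.
by apply: (ancestor_fuelE _ hp); lia.
Qed.

Lemma ancestor_le par n i j : (forall j, 0 < j < n -> par j < j) -> j < n ->
  ancestor par i j -> i <= j.
Proof.
move=> hp; elim/ltn_ind: j => j IH hj; rewrite (ancestorE i hp hj) => /orP[/eqP -> //|].
move=> /andP[j0 h]; have hpj : par j < j by apply: hp; rewrite j0.
by have := IH _ hpj (ltn_trans hpj hj) h; lia.
Qed.

Lemma ancestor0 par n j : (forall j, 0 < j < n -> par j < j) -> j < n -> ancestor par 0 j.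
Proof.
move=> hp; elim/ltn_ind: j => j IH hj; rewrite (ancestorE 0 hp hj); case: (posnP j) => [->//|j0].
have hpj : par j < j by apply: hp; rewrite j0.
by rewrite IH ?orbT //; apply: ltn_trans hj.
Qed.

Lemma ancestor_child par n i j : (forall j, 0 < j < n -> par j < j) -> j < n ->
  ancestor par i j -> i = j \/ has (fun c => ancestor par c j) (children par n i).
Proof.
move=> hp; elim/ltn_ind: j => j IH hj; rewrite (ancestorE i hp hj) => /orP[/eqP -> |]; first by left.
move=> /andP[j0 h]; right; have hpj : par j < j by apply: hp; rewrite j0.
have hpn := ltn_trans hpj hj.
case: (IH _ hpj hpn h) => [e|/hasP[c hc hc2]].
  apply/hasP; exists j; first by rewrite mem_filter mem_iota0 j0 e eqxx hj.
  by rewrite (ancestorE j hp hj) eqxx.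
by apply/hasP; exists c => //; rewrite (ancestorE c hp hj) j0 hc2 orbT.
Qed.

Lemma count_has_le (I J : Type) (a : I -> pred J) (cs : seq I) (s : seq J) :
  count (fun j => has (fun c => a c j) cs) s <= \sum_(c <- cs) count (a c) s.
Proof.
elim: cs => [|c cs IH]; first by rewrite big_nil count_pred0.
rewrite big_cons; apply: (@leq_trans (count (a c) s + count (fun j => has (fun c => a c j) cs) s)).
  by rewrite -count_predUI leq_addr.
by rewrite leq_add2l.
Qed.

(* The last index whose subtree has at least [mu] vertices: its children have
   smaller subtrees. *)
Lemma big_subtree par n D mu : (forall j, 0 < j < n -> par j < j) ->
  (forall i, size (children par n i) <= D) -> 0 < mu -> mu <= n ->
  exists2 i, i < n & mu <= count (ancestor par i) (iota 0 n) <= (D * mu).+1.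
Proof.
move=> hp hD mu0 hmu.
pose P i := (i < n) && (mu <= count (ancestor par i) (iota 0 n)).
have n0 : 0 < n by apply: leq_trans hmu.
have hP : exists i, P i.
  exists 0; rewrite /P n0 /= (@eq_in_count _ _ predT) ?count_predT ?size_iota //.
  by move=> j; rewrite mem_iota0 => /(ancestor0 hp).
have hB i : P i -> i <= n by case/andP => /ltnW.
case: (ex_maxnP hP hB) => i /andP[hi h1] hmax; exists i => //; rewrite h1 /=.
have h2 : count (ancestor par i) (iota 0 n) <=
    count (pred1 i) (iota 0 n) + count (fun j => has (fun c => ancestor par c j) (children par n i)) (iota 0 n).
  rewrite -count_predUI; apply: leq_trans (leq_addr _ _).
  rewrite -!size_filter; apply: uniq_leq_size; first by rewrite filter_uniq ?iota_uniq.
  move=> j; rewrite !mem_filter mem_iota0 => /andP[h hj]; rewrite hj andbT /=.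
  by case: (ancestor_child hp hj h) => [->|->]; rewrite ?eqxx ?orbT.
apply: leq_trans h2 _; rewrite count_uniq_mem ?iota_uniq // -add1n leq_add ?leq_b1 //.
apply: leq_trans (count_has_le _ _ _) _.
apply: leq_trans (_ : size (children par n i) * mu <= _); last by rewrite leq_mul2r hD orbT.
have : all (fun c => count (ancestor par c) (iota 0 n) <= mu) (children par n i).
  apply/allP => c; rewrite mem_filter mem_iota0 => /andP[/andP[c0 /eqP e] hc].
  have := hp c; rewrite c0 hc e => /(_ isT) hic.
  rewrite leqNgt; apply/negP => hlt.
  by have := hmax c; rewrite /P hc ltnW // => /(_ isT); lia.
elim: (children par n i) => [|c cs IH] /=; first by rewrite big_nil.
by move=> /andP[h /IH {}IH]; rewrite big_cons mulSn leq_add.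
Qed.

(** A subtree [S] of controlled size comes first. As [S] hangs on one edge, at most one outside
    vertex is adjacent to it, and that vertex gets the index m1; this is the fourth clause. An
    embedding of the first m1 vertices thus constrains the others only through the parent of m1. *)
Lemma tree_coding (T : sgraph) D mu : tree T -> max_degree T <= D -> 0 < mu -> mu <= #|T| ->
  exists (v : nat -> T) (par : nat -> nat) (m1 : nat),
  [/\ mu <= m1 <= (D * mu).+1 /\ m1 <= #|T|,
      forall x, exists2 i, i < #|T| & v i = x,
      (forall j, 0 < j < #|T| -> par j < j) /\ (forall i, size (children par #|T| i) <= D),
      forall j, j < #|T| -> m1 < j -> m1 <= par j &
      forall i j, i < #|T| -> j < #|T| -> adj (v i) (v j) ->
        (0 < j /\ par j = i) \/ (0 < i /\ par i = j)].
Proof.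
move=> tT hD mu0 hmu.
have [r _] : exists x : T, x \in T by apply/card_gt0P; apply: leq_trans hmu.
have [t0 [oo ho]] := tree_order_extend tT (tree_order1 r).
set o0 := [:: r] ++ t0 in oo ho.
have size_o (o : seq T) : tree_order o -> (forall x, x \in o) -> size o = #|T|.
  move=> h1 h2; have /card_uniqP <- := tree_order_uniq h1.
  by apply: eq_card => x; rewrite h2.
have so := size_o _ oo ho.
pose p0 := parent r o0; pose v0 := nth r o0.
have hp0 j : 0 < j < #|T| -> p0 j < j by rewrite -so => /(parentP r oo) [].
have hD0 i : size (children p0 #|T| i) <= D by rewrite -so; apply: size_children.
have [i hi /andP[h1 h2]] := big_subtree hp0 hD0 mu0 hmu.
pose S := [seq v0 j | j <- iota 0 #|T| & ancestor p0 i j].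
have v0_inj j k : j < #|T| -> k < #|T| -> v0 j = v0 k -> j = k.
  move=> hj hk /eqP; rewrite nth_uniq ?so ?(tree_order_uniq oo) //.
  by move/eqP.
have memS k : k < #|T| -> (v0 k \in S) = ancestor p0 i k.
  move=> hk; apply/mapP/idP => [[j]|h].
    by rewrite mem_filter mem_iota0 => /andP[h hj] /(v0_inj _ _ hk hj) ->.
  by exists k => //; rewrite mem_filter h mem_iota.
have hS m : i < m -> m <= #|T| -> tree_order [seq v0 j | j <- iota 0 m & ancestor p0 i j].
  elim: m => // m IH; rewrite ltnS leq_eqVlt => /orP[/eqP <-|him] hm.
    have -> : [seq j <- iota 0 i.+1 | ancestor p0 i j] = [:: i].
      rewrite -addn1 iotaD filter_cat /= (ancestorE i hp0 hi) eqxx /=.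
      rewrite (@eq_in_filter _ _ pred0) ?filter_pred0 // => j; rewrite mem_iota0 => hj.
      by apply/negP => /(ancestor_le hp0 (ltn_trans hj hi)); rewrite leqNgt hj.
    exact: tree_order1.
  rewrite -addn1 iotaD filter_cat map_cat /= add0n.
  case: ifP => ham; last by rewrite cats0; apply: IH (ltnW hm).
  have m0 : 0 < m by apply: leq_ltn_trans him.
  have hpm : p0 m < m by apply: hp0; rewrite m0.
  have [|_ am um] := @parentP T r o0 oo m; first by rewrite m0 so.
  rewrite cats1; apply: (@tree_order_rcons _ _ _ (v0 (p0 m))) => //.
  - exact: IH (ltnW hm).
  - apply/negP => /mapP[j]; rewrite mem_filter mem_iota0 => /andP[_ hj].
    by move=> /(v0_inj _ _ hm (ltn_trans hj hm)) e; rewrite e ltnn in hj.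
  - apply/mapP; exists (p0 m) => //; rewrite mem_filter mem_iota0 hpm andbT.
    move: ham; rewrite (ancestorE i hp0 hm) m0 /= => /orP[/eqP e|//].
    by rewrite e ltnn in him.
  - move=> z /mapP[j]; rewrite mem_filter mem_iota0 => /andP[_ hj] -> az.
    by rewrite (um j hj az).
have oS : tree_order S := hS _ hi (leqnn _).
have sS : size S = count (ancestor p0 i) (iota 0 #|T|) by rewrite size_map size_filter.
(* The only edge that leaves [S] joins its root [i] to the parent of [i]; a child of a vertex of [S]
   belongs to [S]. *)
have hout x y : x \notin S -> y \in S -> adj x y -> x = v0 (p0 i).
  have hx : x \in o0 := ho x.
  rewrite -(nth_index r hx) -/(v0 _); have hk : index x o0 < #|T| by rewrite -so index_mem.
  move: (index x o0) hk => k hk; rewrite (memS _ hk) => hak /mapP[j].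
  rewrite mem_filter mem_iota0 => /andP[haj hj] -> akj.
  case: (parent_adj oo _ _ akj); rewrite ?so // -/p0; last first.
    by move=> [k0 e]; case/negP: hak; rewrite (ancestorE i hp0 hk) k0 e haj orbT.
  move=> [j0 e]; move: haj; rewrite (ancestorE i hp0 hj) j0 e (negbTE hak) orbF.
  by move=> /eqP ij; rewrite -e -ij.
have [t [oo1 ho1]] := tree_order_extend tT oS.
have so1 := size_o _ oo1 ho1.
exists (nth r (S ++ t)), (parent r (S ++ t)), (size S); split.
- by rewrite sS h1 h2 -sS -so1 size_cat leq_addr.
- by move=> x; exists (index x (S ++ t)); rewrite ?nth_index // -so1 index_mem.
- by split=> [j|i']; rewrite -so1; [move=> /(parentP r oo1) []|apply: size_children].
(* The vertex at position [size S] has its parent in [S], so it is the unique outside neighbour of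
   [S]. A later j with its parent in [S] would be the same vertex. *)
- move=> j hj hmj; rewrite leqNgt; apply/negP => hlt.
  have out k : size S <= k -> k < #|T| -> parent r (S ++ t) k < size S -> nth r (S ++ t) k = v0 (p0 i).
    move=> hk hkT hpk; have k0 : 0 < k by apply: leq_trans hk; exact: tree_order_gt0.
    have [|_ ak _] := @parentP T r (S ++ t) oo1 k; first by rewrite k0 so1.
    apply: (hout _ (nth r (S ++ t) (parent r (S ++ t) k))) => //.
      have := tree_order_uniq oo1; rewrite cat_uniq => /and3P[_ /hasPn h _].
      by apply: h; rewrite nth_cat ltnNge hk /= mem_nth // ltn_subLR // -size_cat so1.
    by rewrite nth_cat hpk mem_nth.
  have hS1 : size S < #|T| by apply: ltn_trans hj.
  have S0 : 0 < size S by exact: tree_order_gt0.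
  have [|hpS _ _] := @parentP T r (S ++ t) oo1 (size S); first by rewrite S0 so1.
  have e := etrans (out _ (leqnn _) hS1 hpS) (esym (out _ (ltnW hmj) hj hlt)).
  move/eqP: e; rewrite nth_uniq ?so1 ?(tree_order_uniq oo1) // => /eqP e.
  by rewrite e ltnn in hmj.
- by move=> a b ha hb; apply: parent_adj; rewrite ?so1.
Qed.

(** * Embedding the small subtree on the absorbers *)

(** [cut] marks the roots of pieces. [level] is the distance up to the nearest mark, the vertex
    itself included, and [top] is the marked vertex reached; for the marks [pred1 0] the level is
    the depth in the tree. *)
Fixpoint level_fuel (par : nat -> nat) (cut : pred nat) (f j : nat) : nat :=
  if cut j then 0 else if f is f'.+1 then (level_fuel par cut f' (par j)).+1 else 0.

Definition level (par : nat -> nat) (cut : pred nat) (j : nat) : nat := level_fuel par cut j j.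

Definition top (par : nat -> nat) (cut : pred nat) (j : nat) : nat := iter (level par cut j) par j.

Definition down_par (par : nat -> nat) (n : nat) : Prop := forall j, 0 < j < n -> par j < j.

Lemma level_fuelE par (cut : pred nat) n : down_par par n -> cut 0 ->
  forall f f' j, j < n -> j <= f -> j <= f' -> level_fuel par cut f j = level_fuel par cut f' j.
Proof.
move=> hp c0; elim=> [|f IH] [|f'] j hj; rewrite ?leqn0 => h1 h2.
- by [].
- by move: h1 => /eqP ->; rewrite /= c0.
- by move: h2 => /eqP ->; rewrite /= c0.
- rewrite /=; case: ifP => // cj; congr _.+1.
  have j0 : 0 < j by case: j cj {hj h1 h2} => //; rewrite c0.
  have hpj : par j < j by apply: hp; rewrite j0.
  by apply: IH; lia.
Qed.

Lemma cut_gt0 (cut : pred nat) j : cut 0 -> ~~ cut j -> 0 < j.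
Proof. by case: j => // ->. Qed.

Lemma levelE par (cut : pred nat) n j : down_par par n -> cut 0 -> j < n ->
  level par cut j = if cut j then 0 else (level par cut (par j)).+1.
Proof.
move=> hp c0 hj; rewrite {1}/level; case: j hj => [|j] hj /=; first by rewrite c0.
case: ifP => // cj; congr _.+1; have hpj := hp j.+1 hj.
by apply: (level_fuelE hp c0); lia.
Qed.

Lemma topE par (cut : pred nat) n j : down_par par n -> cut 0 -> j < n ->
  top par cut j = if cut j then j else top par cut (par j).
Proof.
move=> hp c0 hj; rewrite {1}/top (levelE hp c0 hj); case: ifP => // _.
by rewrite iterSr.
Qed.

Lemma top_cut par (cut : pred nat) n j : down_par par n -> cut 0 -> j < n ->
  cut (top par cut j) /\ top par cut j <= j.
Proof.
move=> hp c0; elim/ltn_ind: j => j IH hj; rewrite (topE hp c0 hj); case: (boolP (cut j)) => // cj.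
have hpj : par j < j by apply: hp; rewrite (cut_gt0 c0 cj).
have [h1 h2] := IH _ hpj (ltn_trans hpj hj); split=> //.
exact: leq_trans h2 (ltnW hpj).
Qed.

Lemma children_bound par n D (S : seq nat) : (forall i, size (children par n i) <= D) ->
  size (flatten [seq children par n i | i <- S]) <= D * size S.
Proof.
move=> hD; elim: S => [|i S IH] //=; rewrite size_cat mulnS leq_add //.
Qed.

Lemma mem_children par n i j : (j \in children par n i) = [&& j < n, 0 < j & par j == i].
Proof. by rewrite mem_filter mem_iota0 andbC. Qed.

(** Every vertex of the piece except its root is a child of a vertex one level up in the same piece,
    and 1 + D x <= (D + 1) x for x = (D + 1)^l. *)
Lemma level_count par (cut : pred nat) n D (t l : nat) : down_par par n -> cut 0 ->
  (forall i, size (children par n i) <= D) ->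
  count (fun j => (top par cut j == t) && (level par cut j < l)) (iota 0 n) <= D.+1 ^ l.
Proof.
move=> hp c0 hD; elim: l => [|l IH].
  by rewrite (@eq_count _ _ pred0) ?count_pred0 // => j /=; rewrite ltn0 andbF.
rewrite -size_filter; set A := filter _ _; set B := filter (fun j => (top par cut j == t) && (level par cut j < l)) (iota 0 n).
have sB : size B <= D.+1 ^ l by rewrite size_filter.
have hsub : {subset A <= t :: flatten [seq children par n i | i <- B]}.
  move=> j; rewrite mem_filter mem_iota0 => /andP[/andP[/eqP h1 h2] hj].
  move: h1 h2; rewrite (topE hp c0 hj) (levelE hp c0 hj); case: (boolP (cut j)) => cj.
    by move=> -> _; rewrite inE eqxx.
  move=> h1 h2; rewrite inE; apply/orP; right.
  have hpj : par j < j by apply: hp; rewrite (cut_gt0 c0 cj).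
  apply/flattenP; exists (children par n (par j)); last by rewrite mem_children hj eqxx (cut_gt0 c0 cj).
  apply/mapP; exists (par j) => //.
  by rewrite mem_filter h1 eqxx mem_iota0 (ltn_trans hpj hj) andbT.
have uA : uniq A by rewrite filter_uniq ?iota_uniq.
apply: leq_trans (uniq_leq_size uA hsub) _; rewrite /= expnS mulSn.
have := children_bound B hD; have : 0 < D.+1 ^ l by rewrite expn_gt0.
have : D * size B <= D * D.+1 ^ l by rewrite leq_mul2l sB orbT.
by clear; move: (expn _ _) (D * size B) (size _); lia.
Qed.

Lemma sum_residues (f : nat -> nat) (s : seq nat) h : 0 < h ->
  \sum_(r < h) count (fun j => f j %% h == r) s = size s.
Proof.
move=> h0; under eq_bigr do rewrite count_sum.
rewrite exchange_big /= -sum1_size; apply: eq_bigr => j _.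
rewrite (bigD1 (Ordinal (ltn_pmod (f j) h0))) //= eqxx big1 ?addn0 // => r.
by rewrite -val_eqE /= eq_sym => /negbTE ->.
Qed.

Lemma rare_residue (f : nat -> nat) (s : seq nat) h : 0 < h ->
  exists2 r, r < h & h * count (fun j => f j %% h == r) s <= size s.
Proof.
move=> h0; case: (boolP [exists r : 'I_h, h * count (fun j => f j %% h == r) s <= size s]).
  by move=> /existsP[r hr]; exists r.
rewrite negb_exists => /forallP hc.
have : \sum_(r < h) (size s).+1 <= \sum_(r < h) h * count (fun j => f j %% h == r) s.
  by apply: leq_sum => r _; rewrite ltnNge.
rewrite -big_distrr /= sum_residues // sum_nat_const card_ord leq_pmul2l //; lia.
Qed.

Lemma frequent_residue (f : nat -> nat) (s : seq nat) h : 0 < h ->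
  exists2 r, r < h & size s <= h * count (fun j => f j %% h == r) s.
Proof.
move=> h0; case: (boolP [exists r : 'I_h, size s <= h * count (fun j => f j %% h == r) s]).
  by move=> /existsP[r hr]; exists r.
rewrite negb_exists => /forallP hc.
have : \sum_(r < h) (h * count (fun j => f j %% h == r) s).+1 <= \sum_(r < h) size s.
  by apply: leq_sum => r _; have := hc r; rewrite -ltnNge.
under eq_bigr do rewrite -addn1.
rewrite big_split /= -big_distrr /= sum_residues // !sum_nat_const card_ord; lia.
Qed.

Lemma injective_subseq (f : nat -> nat) (s : seq nat) c :
  (forall y, count (fun x => f x == y) s <= c) ->
  exists t, [/\ {subset t <= s}, uniq (map f t) & size s <= c * size t].
Proof.
move: {2}(size s) (leqnn (size s)) => d; elim: d s => [|d IH] s hd hc.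
  by exists [::]; split=> //; move: hd; rewrite leqn0 => /eqP ->.
case: s hd hc => [|x s] hd hc; first by exists [::].
pose s' := [seq y <- s | f y != f x].
have [||t [t1 t2 t3]] := IH s'.
- by rewrite size_filter; apply: leq_trans (count_size _ _) _.
- move=> y; apply: leq_trans (hc y); rewrite count_filter /=; apply: leq_trans (leq_addl _ _).
  by apply: sub_count => z /andP[].
exists (x :: t); split.
- move=> y; rewrite !inE => /orP[-> //|/t1]; rewrite mem_filter => /andP[_ ->].
  by rewrite orbT.
- rewrite /= t2 andbT; apply/mapP => -[y /t1]; rewrite mem_filter => /andP[h _] e.
  by rewrite e eqxx in h.
rewrite /= mulnS; have := hc (f x); have := count_predC (fun y => f y == f x) (x :: s).
rewrite /= eqxx /= => e1 e2.
have : size s' = count (predC (fun y => f y == f x)) s by rewrite size_filter.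
by move: e1 e2 t3 => /=; clear; gen_atoms; lia.
Qed.

(** Depth modulo 5 separates the roles: for w at residue rho, its children, parent, grandparent and
    great-grandparent have the four other residues, so no vertex plays two roles. Great-grandparents
    are distinct so that each has only one star to prepare for; at most D^3 candidates share one.
    Depth at least 4 keeps the great-grandparent off the root, and w <> par m1 keeps the children of
    w in the subtree. *)
Lemma absorber_spots par n D m1 mA : 0 < D -> down_par par n -> (forall i, size (children par n i) <= D) ->
  m1 <= n -> (forall j, j < n -> m1 < j -> m1 <= par j) ->
  5 * (D ^ 3 * mA + D.+1 ^ 4 + 1) <= m1 ->
  exists (ws : seq nat) rho, [/\ size ws = mA, uniq (map (fun w => par (par (par w))) ws),
    forall w, w \in ws -> [&& w < m1, 0 < w, 0 < par w, 0 < par (par w) & 0 < par (par (par w))],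
    forall w, w \in ws -> level par (pred1 0) w %% 5 = rho &
    forall w c, w \in ws -> c \in children par n w -> c < m1].
Proof.
move=> D0 hp hD hm hlast hbig.
pose dep := level par (pred1 0).
have depE j : j < n -> dep j = if j == 0 then 0 else (dep (par j)).+1 by apply: levelE.
have [rho hrho hcnt] := frequent_residue dep (iota 0 m1) (isT : 0 < 5).
rewrite size_iota in hcnt.
pose cand := [seq w <- iota 0 m1 | [&& dep w %% 5 == rho, 4 <= dep w & w != par m1]].
have hdeep : count (fun w => dep w < 4) (iota 0 m1) <= D.+1 ^ 4.
  apply: leq_trans (level_count 0 4 hp (isT : pred1 0 0) hD).
  rewrite -!size_filter; apply: uniq_leq_size; first by rewrite filter_uniq ?iota_uniq.
  move=> j; rewrite !mem_filter !mem_iota0 => /andP[h hj].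
  have hjn := leq_trans hj hm; rewrite hjn -/dep h !andbT.
  by case: (top_cut hp (isT : pred1 0 0) hjn).
have hcand : D ^ 3 * mA <= size cand.
  have h1 : count (fun w => dep w %% 5 == rho) (iota 0 m1) <=
     size cand + (count (fun w => dep w < 4) (iota 0 m1) + count (pred1 (par m1)) (iota 0 m1)).
    rewrite size_filter -[X in _ + X](count_predUI) addnA.
    apply: leq_trans (leq_addr _ _); rewrite -[X in _ <= X]count_predUI.
    apply: leq_trans (leq_addr _ _); apply: sub_count => w /= ->.
    by case: (ltnP (dep w) 4) => //=; case: eqP.
  have h2 : count (pred1 (par m1)) (iota 0 m1) <= 1 by rewrite count_uniq_mem ?iota_uniq ?leq_b1.
  by move: hcnt h1 hdeep h2 hbig; clear; move: (expn _ _) (expn _ _) => x y; gen_atoms; lia.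
have fib y : count (fun w => par (par (par w)) == y) cand <= D ^ 3.
  pose chs S := flatten [seq children par n i | i <- S].
  have hchs S : size (chs S) <= D * size S := children_bound S hD.
  apply: (@leq_trans (size (chs (chs (chs [:: y]))))); last first.
    rewrite !expnS expn0; apply: leq_trans (hchs _) _; rewrite leq_mul2l; apply/orP; right.
    apply: leq_trans (hchs _) _; rewrite leq_mul2l; apply/orP; right; exact: hchs.
  rewrite -size_filter; apply: uniq_leq_size; first by rewrite !filter_uniq ?iota_uniq.
  move=> w; rewrite !mem_filter mem_iota0 => /andP[/eqP hy /andP[/and3P[_ h4 _] hw]].
  have hwn := leq_trans hw hm.
  move: h4; rewrite (depE _ hwn); case: (posnP w) => // w0 h4.
  have w1 := hp w; rewrite w0 hwn in w1; have {}w1 := ltn_trans (w1 isT) hwn.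
  move: h4; rewrite (depE _ w1); case: (posnP (par w)) => // pw0 h4.
  have w2 := hp (par w); rewrite pw0 w1 in w2; have {}w2 := ltn_trans (w2 isT) w1.
  move: h4; rewrite (depE _ w2); case: (posnP (par (par w))) => // ppw0 h4.
  have step S i : i < n -> 0 < i -> par i \in S -> i \in chs S.
    move=> h1 h2 h3; apply/flattenP; exists (children par n (par i)).
      by apply/mapP; exists (par i).
    by rewrite mem_children h1 h2 eqxx.
  apply: (step _ w) => //; apply: (step _ (par w)) => //; apply: (step _ (par (par w))) => //.
  by rewrite hy inE.
have [t [t1 t2 t3]] := injective_subseq fib.
have st : mA <= size t.
  have e : 0 < D ^ 3 by rewrite expn_gt0 D0.
  by rewrite -(leq_pmul2l e); apply: leq_trans hcand t3.
exists (take mA t), rho; split.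
- by rewrite size_takel.
- by rewrite map_take take_uniq.
- move=> w /mem_take /t1; rewrite mem_filter mem_iota0 => /andP[/and3P[_ h4 _] hw].
  have hwn := leq_trans hw hm; rewrite hw /=.
  move: h4; rewrite (depE _ hwn); case: (posnP w) => // w0 h4.
  have w1 := hp w; rewrite w0 hwn in w1; have {}w1 := ltn_trans (w1 isT) hwn.
  move: h4; rewrite (depE _ w1); case: (posnP (par w)) => // pw0 h4.
  have w2 := hp (par w); rewrite pw0 w1 in w2; have {}w2 := ltn_trans (w2 isT) w1.
  move: h4; rewrite (depE _ w2); case: (posnP (par (par w))) => // ppw0 h4.
  have w3 := hp (par (par w)); rewrite ppw0 w2 in w3; have {}w3 := ltn_trans (w3 isT) w2.
  by move: h4; rewrite (depE _ w3); case: (posnP (par (par (par w)))).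
- by move=> w /mem_take /t1; rewrite mem_filter => /andP[/and3P[/eqP -> _ _]].
- move=> w c /mem_take /t1; rewrite mem_filter mem_iota0 => /andP[/and3P[_ _ hw] hwm].
  rewrite mem_children => /and3P[hc c0 /eqP e]; rewrite ltnNge leq_eqVlt; apply/negP => /orP[/eqP e2|h].
    by rewrite e2 e eqxx in hw.
  by have := hlast c hc h; rewrite e leqNgt hwm.
Qed.

Definition upd (T : Type) (f : nat -> T) (m : nat) (y : T) : nat -> T :=
  fun i => if i == m then y else f i.

Lemma uniq_flatten_nth (T : eqType) (ss : seq (seq T)) i j x : uniq (flatten ss) ->
  i < size ss -> j < size ss -> x \in nth [::] ss i -> x \in nth [::] ss j -> i = j.
Proof.
elim: ss i j => // s ss IH [|i] [|j] //=; rewrite cat_uniq => /and3P[_ /hasPn h u] hi hj.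
- move=> xs xj; have := h x; rewrite xs => hh; suff: ~~ true by []; apply: hh.
  by apply/flattenP; exists (nth [::] ss j) => //; rewrite mem_nth.
- move=> xj xs; have := h x; rewrite xs => hh; suff: ~~ true by []; apply: hh.
  by apply/flattenP; exists (nth [::] ss i) => //; rewrite mem_nth.
- by move=> xi xj; congr _.+1; apply: IH u hi hj xi xj.
Qed.

Lemma pick_avoid (T : eqType) (b : pred T) (s U : seq T) : uniq s -> size U < count b s ->
  exists2 y, y \in s & b y && (y \notin U).
Proof.
move=> us hU; have h := count_avoid b U us.
have : 0 < count (fun y => b y && (y \notin U)) s by move: hU h; clear; glia.
by rewrite -has_count => /hasP[y ys hy]; exists y.
Qed.

Definition nbrs (G : sgraph) (x : G) : seq G := [seq y <- enum G | adj x y].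

Lemma nbrs_large (G : sgraph) a (x : G) : rich G a -> large_set a (nbrs x).
Proof.
move=> hr; split; first by rewrite filter_uniq ?enum_uniq.
by rewrite size_filter; have := hr.1 x; clear; glia.
Qed.

Lemma mem_nbrs (G : sgraph) (x y : G) : (y \in nbrs x) = adj x y.
Proof. by rewrite mem_filter mem_enum andbT. Qed.

Section AbsorberEmbedding.

Variables (G : sgraph) (a n D m1 rho : nat) (par : nat -> nat) (x0 : G).
Variables (cs : seq (G * D.+1.-tuple G)) (ws : seq nat).
Hypothesis hr : rich G a.
Hypothesis hp : down_par par n.
Hypothesis hD : forall i, size (children par n i) <= D.
Hypothesis hm : m1 <= n.
Hypothesis sw : size ws = size cs.
Hypothesis uG : uniq (map (fun w => par (par (par w))) ws).
Hypothesis hw : forall w, w \in ws -> [&& w < m1, 0 < w, 0 < par w, 0 < par (par w) & 0 < par (par (par w))].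
Hypothesis hrho : forall w, w \in ws -> level par (pred1 0) w %% 5 = rho.
Hypothesis hch : forall w c, w \in ws -> c \in children par n w -> c < m1.
Hypothesis ucs : uniq (flatten (map (@sverts G D.+1) cs)).
Hypothesis hst : all (@is_star G D.+1) cs.
Hypothesis hsize : m1 + size (flatten (map (@sverts G D.+1) cs)) <= a.
Hypothesis n0 : 0 < #|G|.
Hypothesis a0 : 0 < a.

Let V := flatten (map (@sverts G D.+1) cs).
Let st w := nth (x0, [tuple of nseq D.+1 x0]) cs (index w ws).
Let slot w k := nth x0 (sverts (st w)) k.
Let dep := level par (pred1 0).

(* The star vertex reserved for the tree vertex [i]: a chosen absorber goes to the
   centre, its parent to the first leaf, its children to the other leaves. *)
Let pre i : option G :=
  if i \in ws then Some (slot i 0)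
  else if (0 < i) && (par i \in ws) then Some (slot (par i) (2 + index i (children par n (par i))))
  else if has (fun w => par w == i) ws then Some (slot (nth 0 ws (find (fun w => par w == i) ws)) 1)
  else None.

Let depE j : j < n -> dep j = if j == 0 then 0 else (dep (par j)).+1.
Proof. exact: levelE. Qed.

Let sverts_size w : size (sverts (st w)) = D.+2.
Proof. by rewrite /sverts /= size_tuple. Qed.

Let st_mem w : w \in ws -> st w \in cs.
Proof. by move=> h; rewrite mem_nth // -sw index_mem. Qed.

Let wfacts w : w \in ws -> [/\ dep w = dep (par (par (par w))) + 3,
  dep (par w) = dep (par (par (par w))) + 2, dep (par (par w)) = dep (par (par (par w))) + 1 &
  [/\ par w < w, par (par w) < par w & par (par (par w)) < par (par w)]].
Proof.
move=> h; have /and5P[h1 h2 h3 h4 h5] := hw h; have hn := leq_trans h1 hm.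
have w1 : par w < w by apply: hp; rewrite h2.
have w2 : par (par w) < par w by apply: hp; rewrite h3 (ltn_trans w1).
have w3 : par (par (par w)) < par (par w) by apply: hp; rewrite h4 (ltn_trans w2 (ltn_trans w1 _)).
have d1 := depE hn; rewrite gtn_eqF // in d1.
have d2 := depE (ltn_trans w1 hn); rewrite gtn_eqF // in d2.
have d3 := depE (ltn_trans w2 (ltn_trans w1 hn)); rewrite gtn_eqF // in d3.
by split; rewrite ?d1 ?d2 ?d3 ?addn3 ?addn2 ?addn1.
Qed.

Let g2_inj w w' : w \in ws -> w' \in ws -> par (par (par w)) = par (par (par w')) -> w = w'.
Proof.
move=> h h' e; have := uG; move=> /(uniqP 0) u.
have hi := h; rewrite -index_mem in hi; have hi' := h'; rewrite -index_mem in hi'.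
have := u (index w ws) (index w' ws); rewrite !inE !size_map => /(_ hi hi').
rewrite !(nth_map 0) // !nth_index // => /(_ e) e2.
by rewrite -(nth_index 0 h) -(nth_index 0 h') e2.
Qed.

Let slot_mem w k : w \in ws -> k < D.+2 -> slot w k \in V.
Proof.
move=> h hk; apply/flattenP; exists (sverts (st w)); first by apply: map_f; apply: st_mem.
by rewrite mem_nth // sverts_size.
Qed.

Let slot_inj w w' k k' : w \in ws -> w' \in ws -> k < D.+2 -> k' < D.+2 ->
  slot w k = slot w' k' -> w = w' /\ k = k'.
Proof.
move=> h h' hk hk' e.
have hi := h; rewrite -index_mem sw in hi; have hi' := h'; rewrite -index_mem sw in hi'.
have ei : index w ws = index w' ws.
  apply: (@uniq_flatten_nth _ _ _ _ (slot w k) ucs); rewrite ?size_map //.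
    by rewrite (nth_map (x0, [tuple of nseq D.+1 x0])) // mem_nth // sverts_size.
  by rewrite e (nth_map (x0, [tuple of nseq D.+1 x0])) // mem_nth // sverts_size.
have ew : w = w' by rewrite -(nth_index 0 h) -(nth_index 0 h') ei.
split=> //; move: e; rewrite -ew /slot => /eqP; rewrite nth_uniq ?sverts_size //.
  by move/eqP.
by have := allP hst _ (st_mem h) => /andP[].
Qed.

Let pre_owner i v : i < n -> pre i = Some v -> exists w k,
  [/\ w \in ws, k < D.+2, v = slot w k & i = nth 0 (w :: par w :: children par n w) k].
Proof.
move=> hi; rewrite /pre; case: ifP => [iw [<-]|iw]; first by exists i, 0.
case: ifP => [/andP[i0 piw] [<-]|_].
  have ic : i \in children par n (par i) by rewrite mem_children hi i0 eqxx.
  exists (par i), (2 + index i (children par n (par i))); split=> //.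
    by rewrite add2n !ltnS; apply: leq_trans (hD (par i)); rewrite index_mem.
  by rewrite add2n /= nth_index.
case: ifP => // h [<-]; exists (nth 0 ws (find (fun w => par w == i) ws)), 1; split=> //.
  by rewrite mem_nth // -has_find.
by rewrite /=; have /eqP := nth_find 0 h.
Qed.

Let pre_inj i j v : i < n -> j < n -> pre i = Some v -> pre j = Some v -> i = j.
Proof.
move=> hi hj /(pre_owner hi) [w [k [h1 h2 h3 h4]]] /(pre_owner hj) [w' [k' [h1' h2' h3' h4']]].
have [ew ek] := slot_inj h1 h1' h2 h2' (etrans (esym h3) h3').
by rewrite h4 h4' ew ek.
Qed.

Let pre_res i : i < n -> pre i <> None ->
  [\/ dep i %% 5 = rho, dep i %% 5 = (rho + 1) %% 5 | (dep i + 1) %% 5 = rho].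
Proof.
move=> hi; rewrite /pre; case: ifP => [/hrho iw _|_]; first by apply: Or31.
case: ifP => [/andP[i0 piw] _|_].
  apply: Or32; rewrite (depE hi) gtn_eqF //; have := hrho piw; rewrite -/dep; lia.
case: ifP => // /hasP[w ww /eqP e] _; apply: Or33; have [d1 d2 _ _] := wfacts ww.
by have := hrho ww; rewrite -/dep -e; lia.
Qed.

Let pre_w w : w \in ws -> pre w = Some (slot w 0).
Proof. by rewrite /pre => ->. Qed.

Let pre_child w c : w \in ws -> c \in children par n w ->
  exists2 k, 1 < k < D.+2 & pre c = Some (slot w k).
Proof.
move=> h hc; have := hc; rewrite mem_children => /and3P[hcn c0 /eqP e].
exists (2 + index c (children par n w)).
  by rewrite add2n /= !ltnS; apply: leq_trans (hD w); rewrite index_mem.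
rewrite /pre c0 e h; case: ifP => // cw; have := hrho cw; have := hrho h.
by rewrite -/dep (depE hcn) gtn_eqF // e; lia.
Qed.

Let pre_par w : w \in ws -> pre (par w) = Some (slot w 1).
Proof.
move=> h; have [d1 d2 d3 [l1 l2 l3]] := wfacts h; have hwr := hrho h.
have hwn : w < n by have /and5P[hh _ _ _ _] := hw h; apply: leq_trans hh hm.
rewrite /pre; case: ifP => [pw|_].
  by have := hrho pw; move: hwr d1 d2; rewrite -/dep; lia.
case: ifP => [/andP[_ ppw]|_].
  by have := hrho ppw; move: hwr d1 d3; rewrite -/dep; lia.
have hh : has (fun w' => par w' == par w) ws by apply/hasP; exists w.
rewrite hh; set w' := nth 0 ws _.
have w'w : w' \in ws by rewrite mem_nth // -has_find.
have /eqP e : par w' == par w := nth_find 0 hh.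
by rewrite (g2_inj w'w h) // e.
Qed.

Let star_adj w k : w \in ws -> 0 < k < D.+2 -> adj (slot w 0) (slot w k).
Proof.
move=> h; case: k => // k /andP[_ hk]; have /andP[_ /allP hh] := allP hst _ (st_mem h).
by rewrite /slot /=; apply: hh; rewrite mem_nth // size_tuple.
Qed.

Let pre_g w : w \in ws -> pre (par (par w)) = None /\ pre (par (par (par w))) = None.
Proof.
move=> h; have [d1 d2 d3 [l1 l2 l3]] := wfacts h; have hwr := hrho h.
have hwn : w < n by have /and5P[hh _ _ _ _] := hw h; apply: leq_trans hh hm.
have h2n : par (par w) < n by apply: ltn_trans l2 (ltn_trans l1 hwn).
split.
  case E : (pre (par (par w))) => [v|] //.
  have nE : pre (par (par w)) <> None by rewrite E.
  have := pre_res h2n nE.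
  by move: d1 d3 hwr; rewrite -/dep => d1 d3 hwr []; lia.
case E : (pre (par (par (par w)))) => [v|] //.
have nE : pre (par (par (par w))) <> None by rewrite E.
have := pre_res (ltn_trans l3 h2n) nE.
by move: d1 d3 hwr; rewrite -/dep => d1 d3 hwr []; lia.
Qed.

(** The star of an absorber is fixed in advance, so the embedding must arrive at its first leaf. The
    last clause prepares this two steps ahead: the great-grandparent of w is placed where it has 200
    a neighbours in the neighbourhood of that leaf, and the grandparent then goes to one of
    these. *)
Let Inv m (f : nat -> G) : Prop :=
  [/\ forall i v, i < m -> pre i = Some v -> f i = v,
      forall i, i < m -> pre i = None -> f i \notin V,
      forall i j, i < m -> j < m -> f i = f j -> i = j,
      forall i, 0 < i < m -> adj (f (par i)) (f i) &
      forall w, w \in ws ->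
        (par (par (par w)) < m -> 200 * a <= count (adj (f (par (par (par w))))) (nbrs (slot w 1))) /\
        (par (par w) < m -> adj (f (par (par w))) (slot w 1))].

(** For the centre and the leaves of the children, adjacency to the image of the parent comes from
    the star; for the first leaf it comes from the last clause of [Inv]. *)
Lemma Inv_step_pre m f v : m < m1 -> Inv m f -> pre m = Some v -> Inv m.+1 (upd f m v).
Proof.
move=> hmm [i1 i2 i3 i4 i5] E; have hmn := leq_trans hmm hm.
have [w [k [ww hk ev em]]] := pre_owner hmn E.
have vV : v \in V by rewrite ev slot_mem.
have new i : i < m -> f i <> v.
  move=> him; case E' : (pre i) => [u|].
    rewrite (i1 _ _ him E') => euv; have := pre_inj (ltn_trans him hmn) hmn E'; rewrite euv => /(_ E).
    by move=> e; rewrite e ltnn in him.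
  by move=> e; have := i2 _ him E'; rewrite e vV.
split.
- move=> i u; rewrite ltnS leq_eqVlt /upd => /orP[/eqP ->|him]; first by rewrite E eqxx => -[].
  by rewrite ltn_eqF //; apply: i1.
- move=> i; rewrite ltnS leq_eqVlt /upd => /orP[/eqP ->|him]; first by rewrite E.
  by rewrite ltn_eqF //; apply: i2.
- move=> i j; rewrite !ltnS (leq_eqVlt i) (leq_eqVlt j) /upd.
  move=> /orP[/eqP ->|him] /orP[/eqP ->|hjm]; rewrite ?eqxx ?ltn_eqF //.
  + by move=> e; case: (new _ hjm).
  + by move=> e; case: (new _ him).
  + exact: i3.
- move=> i; rewrite ltnS (leq_eqVlt i) andb_orr /upd => /orP[/andP[i0 /eqP e]|/andP[i0 him]]; last first.
    have hpi : par i < i by apply: hp; rewrite i0 (ltn_trans him).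
    by rewrite !ltn_eqF // ?(ltn_trans hpi) //; apply: i4; rewrite i0.
  rewrite e eqxx; rewrite e in i0; have hpm : par m < m by apply: hp; rewrite i0.
  rewrite ltn_eqF //.
  case: k hk ev em => [|[|k]] hk ev em.
  + have em' : m = w := em; rewrite ev em' in hpm *.
    rewrite (i1 _ _ _ (pre_par ww)); last by rewrite -em' in hpm *.
    by rewrite adj_sym star_adj.
  + have em' : m = par w := em; have [_ h] := i5 _ ww.
    by rewrite ev em'; apply: h; rewrite -em'.
  + have hkc : k < size (children par n w).
      rewrite ltnNge; apply/negP => h; move: em; rewrite /= nth_default // => e0.
      by rewrite e0 in i0.
    have mc : m \in children par n w by rewrite em /= mem_nth.
    have := mc; rewrite mem_children => /and3P[_ _ /eqP epm].
    rewrite epm in hpm *.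
    by rewrite (i1 _ _ hpm (pre_w ww)) ev star_adj.
- move=> w' ww'; have [h1 h2] := i5 _ ww'; have [g1 g2] := pre_g ww'.
  rewrite /upd !ltnS (leq_eqVlt (par (par (par w')))) (leq_eqVlt (par (par w'))); split.
    by case: eqP => [e|_] //= ; rewrite e E in g2.
  by case: eqP => [e|_] //= ; rewrite e E in g1.
Qed.

Lemma Inv_step_free m f : m < m1 -> Inv m f -> pre m = None -> exists v, Inv m.+1 (upd f m v).
Proof.
move=> hmm [i1 i2 i3 i4 i5] E; have hmn := leq_trans hmm hm.
pose U := V ++ [seq f i | i <- iota 0 m].
have hn := rich_le hr n0.
have hU : size U < 198 * a.
  rewrite /U size_cat size_map size_iota; move: hsize hmm a0; rewrite -/V; clear; glia.
have deg x : 199 * a <= count (adj x) (enum G) by have := hr.1 x; move: hn; clear; glia.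
have [v [vU vadj vg2 vg1]] : exists v, [/\ v \notin U, 0 < m -> adj (f (par m)) v,
   forall w, w \in ws -> par (par (par w)) = m -> 200 * a <= count (adj v) (nbrs (slot w 1)) &
   forall w, w \in ws -> par (par w) = m -> adj v (slot w 1)].
  case: (boolP (has (fun w => par (par (par w)) == m) ws)) => [/hasP[w ww /eqP e]|hno].
    have /and5P[_ _ _ _ g0] := hw ww; rewrite e in g0.
    have := many_connectors hr n0 (nbrs_large (f (par m)) hr) (nbrs_large (slot w 1) hr).
    set b := fun x => _ => hb.
    have [||y ys /andP[by1 by2]] := @pick_avoid _ b (nbrs (f (par m))) U.
    - by rewrite filter_uniq ?enum_uniq.
    - by apply: leq_trans hb; move: hU; clear; glia.
    exists y; split=> // [_|w' ww' e'|w' ww' e'].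
    - by rewrite -mem_nbrs.
    - by rewrite (g2_inj ww' ww) // e e'.
    (* The residues modulo 5 forbid that m is also the grandparent of some absorber. *)
    - have [d1 d2 d3 _] := wfacts ww; have [d1' d2' d3' _] := wfacts ww'.
      have rw := hrho ww; have rw' := hrho ww'.
      by move: d1 d1' d3' rw rw'; rewrite -/dep e e'; clear; lia.
  case: (boolP (has (fun w => par (par w) == m) ws)) => [/hasP[w ww /eqP e]|hno'].
    have /and5P[_ _ _ g0 _] := hw ww; rewrite e in g0.
    have hpm : par m < m by apply: hp; rewrite g0.
    have [h _] := i5 _ ww; have hb := h; rewrite e in hb; have {}hb := hb hpm.
    have [||y ys /andP[by1 by2]] := @pick_avoid _ (adj (f (par m))) (nbrs (slot w 1)) U.
    - by rewrite filter_uniq ?enum_uniq.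
    - by apply: leq_trans hb; move: hU; clear; glia.
    exists y; split=> // [w' ww' e'|w' ww' e'].
    - by case/hasP: hno; exists w' => //; apply/eqP.
    - rewrite (g2_inj ww' ww) ?e ?e' //.
      by rewrite adj_sym -mem_nbrs.
  have [||y ys /andP[by1 by2]] := @pick_avoid _ (adj (f (par m))) (enum G) U.
  - exact: enum_uniq.
  - by apply: leq_trans (deg _); move: hU; clear; glia.
  exists y; split=> // w' ww' e'; first by case/hasP: hno; exists w' => //; apply/eqP.
  by case/hasP: hno'; exists w' => //; apply/eqP.
have vV : v \notin V by move: vU; rewrite mem_cat negb_or => /andP[].
have new i : i < m -> f i <> v.
  move=> him e; move: vU; rewrite mem_cat negb_or => /andP[_ /mapP h]; apply: h.
  by exists i; rewrite ?mem_iota0.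
exists v; split.
- move=> i u; rewrite ltnS leq_eqVlt /upd => /orP[/eqP ->|him]; first by rewrite E.
  by rewrite ltn_eqF //; apply: i1.
- move=> i; rewrite ltnS leq_eqVlt /upd => /orP[/eqP ->|him]; first by rewrite eqxx.
  by rewrite ltn_eqF //; apply: i2.
- move=> i j; rewrite !ltnS (leq_eqVlt i) (leq_eqVlt j) /upd.
  move=> /orP[/eqP ->|him] /orP[/eqP ->|hjm]; rewrite ?eqxx ?ltn_eqF //.
  + by move=> e; case: (new _ hjm).
  + by move=> e; case: (new _ him).
  + exact: i3.
- move=> i; rewrite ltnS (leq_eqVlt i) andb_orr /upd => /orP[/andP[i0 /eqP e]|/andP[i0 him]]; last first.
    have hpi : par i < i by apply: hp; rewrite i0 (ltn_trans him).
    by rewrite !ltn_eqF // ?(ltn_trans hpi) //; apply: i4; rewrite i0.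
  rewrite e eqxx; rewrite e in i0; have hpm : par m < m by apply: hp; rewrite i0.
  by rewrite ltn_eqF //; apply: vadj.
- move=> w ww; have [h1 h2] := i5 _ ww.
  rewrite /upd !ltnS (leq_eqVlt (par (par (par w)))) (leq_eqVlt (par (par w))); split.
    by case: eqP => [e|_] //= _; apply: vg2.
  by case: eqP => [e|_] //= _; apply: vg1.
Qed.

Lemma absorber_embedding : exists f : nat -> G,
  [/\ forall i j, i < m1 -> j < m1 -> f i = f j -> i = j,
      forall i, 0 < i < m1 -> adj (f (par i)) (f i) &
      forall k, k < size cs -> let w := nth 0 ws k in
        let s := nth (x0, [tuple of nseq D.+1 x0]) cs k in
        [/\ f w = s.1, f (par w) \in (s.2 : seq G) & forall c, c \in children par n w -> f c \in (s.2 : seq G)]].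
Proof.
have [f [i1 i2 i3 i4 i5]] : exists f, Inv m1 f.
  suff: forall m, m <= m1 -> exists f, Inv m f by apply.
  elim=> [|m IH] hmm.
    exists (fun=> x0); split=> // i; first by rewrite ltn0 andbF.
  have [f hf] := IH (ltnW hmm).
  case E : (pre m) => [v|]; first by exists (upd f m v); apply: Inv_step_pre.
  by have [v hv] := Inv_step_free hmm hf E; exists (upd f m v).
exists f; split=> // k hk w s.
have ww : w \in ws by rewrite mem_nth // sw.
have es : st w = s.
  rewrite /st /w index_uniq ?sw //.
  apply: (map_uniq (f := fun w => par (par (par w)))); exact: uG.
have /and5P[hwm _ _ _ _] := hw ww; have [_ _ _ [l1 _ _]] := wfacts ww.
have hs2 k' : 0 < k' < D.+2 -> slot w k' \in (s.2 : seq G).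
  by case: k' => // k' /andP[_ hk']; rewrite /slot es /= mem_nth // size_tuple.
split.
- by rewrite (i1 _ _ hwm (pre_w ww)) /slot es.
- by rewrite (i1 _ _ (ltn_trans l1 hwm) (pre_par ww)) hs2.
- move=> c hc; have [k' /andP[hk1 hk2] e] := pre_child ww hc.
  by rewrite (i1 _ _ (hch ww hc) e) hs2 // hk2 (ltn_trans _ hk1).
Qed.

End AbsorberEmbedding.

(** * Embedding the pieces into tiles *)

Definition in_piece (par : nat -> nat) (cut : pred nat) (N m j : nat) : bool :=
  (j < N) && (top par cut j == m).

Section PieceEmbedding.

Variables (G : sgraph) (n N D h m : nat) (par : nat -> nat) (cut : pred nat).
Variables (sg : G * D.-tuple G) (X Y : seq G).
Hypothesis hp : down_par par n.
Hypothesis c0 : cut 0.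
Hypothesis hD : forall i, size (children par n i) <= D.
Hypothesis hN : N <= n.
Hypothesis hmN : m < N.
Hypothesis hlev : forall j, j < N -> level par cut j < h.
Hypothesis hst : is_star sg.
Hypothesis hu : uniq (sverts sg ++ X ++ Y).
Hypothesis hXY : allrel (@adj G) X Y.
Hypothesis sX : D.+1 ^ h <= size X.
Hypothesis sY : D.+1 ^ h <= size Y.
Hypothesis hleaf : forall y, y \in (sg.2 : seq G) -> D.+1 ^ h <= count (adj y) X.

Local Notation lev := (level par cut).
Local Notation member := (in_piece par cut N m).

Definition region (l : nat) : seq G :=
  if l == 0 then [:: sg.1] else if l == 1 then tval sg.2 else if odd l then Y else X.

(** A label of the region that a level uses: root, star leaves, even or odd deeper levels. Regions
    with different labels are disjoint, by [region_disj]. *)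
Definition kind (l : nat) : nat := if l == 0 then 0 else if l == 1 then 1 else 2 + odd l.

Let members_lt i : i < N -> member i -> count member (iota 0 i) < D.+1 ^ h.
Proof.
move=> hi mi.
have h1 : count member (iota 0 i.+1) <= D.+1 ^ h.
  apply: leq_trans (level_count m h hp c0 hD); rewrite -!size_filter; apply: uniq_leq_size.
    by rewrite filter_uniq ?iota_uniq.
  move=> j; rewrite !mem_filter !mem_iota0 => /andP[/andP[hj /eqP ->] _].
  by rewrite eqxx hlev // (leq_trans hj hN).
by move: h1; rewrite -addn1 iotaD count_cat /= add0n mi addn0 addn1.
Qed.

Lemma region_disj l l' x : x \in region l -> x \in region l' ->
  kind l = kind l'.
Proof.
rewrite /region /kind; move: hu; rewrite /sverts /= => /andP[]; rewrite !mem_cat !negb_or.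
move=> /and3P[a1 a2 a3]; rewrite cat_uniq => /and3P[_ /hasPn a4].
rewrite cat_uniq => /and3P[_ /hasPn a5 _].
have b4 y : y \in (sg.2 : seq G) -> (y \notin X) && (y \notin Y).
  move=> hy; rewrite -negb_or -mem_cat; apply/negP => /a4.
  by rewrite /= hy.
have b5 y : y \in X -> y \in Y -> False by move=> hx /a5; rewrite /= hx.
have [e1 e2 e3] : [/\ forall y, y \in [:: sg.1] -> y \notin (sg.2 : seq G),
   forall y, y \in [:: sg.1] -> y \notin X & forall y, y \in [:: sg.1] -> y \notin Y].
  by split=> y; rewrite inE => /eqP ->.
case: (l == 0); case: (l' == 0) => //; case: (l == 1); case: (l' == 1) => //;
  case: (odd l); case: (odd l') => // h1 h2; exfalso;
  first [ by have := b5 _ h1 h2 | by have := b5 _ h2 h1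
        | by have := e1 _ h1; rewrite h2 | by have := e1 _ h2; rewrite h1
        | by have := e2 _ h1; rewrite h2 | by have := e2 _ h2; rewrite h1
        | by have := e3 _ h1; rewrite h2 | by have := e3 _ h2; rewrite h1
        | by have := b4 _ h1; rewrite h2 /= ?andbF | by have := b4 _ h2; rewrite h1 /= ?andbF ].
Qed.

Let PInv i (f : nat -> G) : Prop :=
  [/\ forall j, j < i -> member j -> f j \in region (lev j),
      forall j k, j < i -> k < i -> member j -> member k -> f j = f k -> j = k &
      forall j, j < i -> member j -> j != m -> adj (f (par j)) (f j)].

Lemma member_par j : member j -> j != m -> [/\ par j < j, member (par j), lev j = (lev (par j)).+1 & 0 < j].
Proof.
move=> /andP[hj /eqP e] jm; have hjn := leq_trans hj hN.
move: e; rewrite (topE hp c0 hjn); case: ifP => [_ e|cj e]; first by rewrite e eqxx in jm.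
have j0 := cut_gt0 c0 (negbT cj); have hpj : par j < j by apply: hp; rewrite j0.
by rewrite /in_piece (ltn_trans hpj hj) e eqxx (levelE hp c0 hjn) cj.
Qed.

Let member_m j : member j -> lev j = 0 -> j = m.
Proof.
move=> mj l0; apply/eqP; apply/negPn/negP => /(member_par mj) [_ _ e _].
by rewrite e in l0.
Qed.

(** Greedy in the order of indices. A piece has at most (D + 1)^h vertices, so a target set of that
    size always offers a free vertex. The star has only D leaves, but only the at most D children of
    the root compete for them. *)
Lemma piece_embedding : cut m -> exists f : nat -> G,
  [/\ forall j, member j -> f j \in region (lev j),
      forall j k, member j -> member k -> f j = f k -> j = k &
      forall j, member j -> j != m -> adj (f (par j)) (f j)].
Proof.
move=> cm; have hmn := leq_trans hmN hN.
have mm : member m by rewrite /in_piece hmN (topE hp c0 hmn) cm /=.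
have levm : lev m = 0 by rewrite (levelE hp c0 hmn) cm.
suff: forall i, i <= N -> exists f, PInv i f.
  move=> /(_ N (leqnn N)) [f [f1 f2 f3]]; exists f.
  split=> [j mj|j k mj mk|j mj]; have hj : j < N by case/andP: mj.
  - exact: f1.
  - by apply: f2 => //; case/andP: mk.
  - exact: f3.
elim=> [|i IH] hi; first by exists (fun=> sg.1); split.
have [f [f1 f2 f3]] := IH (ltnW hi).
have ext v : (forall j, j < i -> member j -> f j <> v) -> (member i -> v \in region (lev i)) ->
    (member i -> i != m -> adj (f (par i)) v) -> member i -> PInv i.+1 (upd f i v).
  move=> new hreg hadj mi; split.
  - move=> j; rewrite ltnS leq_eqVlt /upd => /orP[/eqP ->|hj mj]; first by rewrite eqxx.
    by rewrite ltn_eqF //; apply: f1.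
  - move=> j k; rewrite !ltnS (leq_eqVlt j) (leq_eqVlt k) /upd.
    move=> /orP[/eqP ->|hj] /orP[/eqP ->|hk] mj mk; rewrite ?eqxx ?ltn_eqF //.
    + by move=> e; case: (new _ hk mk).
    + by move=> e; case: (new _ hj mj).
    + exact: f2.
  - move=> j; rewrite ltnS (leq_eqVlt j) /upd => /orP[/eqP ->|hj] mj jm.
      by have [hpj _ _ _] := member_par mj jm; rewrite eqxx ltn_eqF //; apply: hadj.
    have [hpj _ _ _] := member_par mj jm.
    by rewrite !ltn_eqF // ?(ltn_trans hpj) //; apply: f3.
case: (boolP (member i)) => mi; last first.
  exists f; split.
  - move=> j; rewrite ltnS leq_eqVlt => /orP[/eqP ->|hj mj]; first by rewrite (negbTE mi).
    exact: f1.
  - move=> j k; rewrite !ltnS (leq_eqVlt j) (leq_eqVlt k).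
    move=> /orP[/eqP ->|hj] /orP[/eqP ->|hk] mj mk; rewrite ?(negbTE mi) // in mj mk *.
    exact: f2.
  - move=> j; rewrite ltnS leq_eqVlt => /orP[/eqP ->|hj mj]; first by rewrite (negbTE mi).
    exact: f3.
case: (eqVneq i m) => [im|im].
  exists (upd f i sg.1); apply: ext => // [j hj mj e|_|_]; last by rewrite im eqxx.
    case/andP: mj => hjN /eqP tj; have := (top_cut hp c0 (leq_trans hjN hN)).2.
    by rewrite tj -im leqNgt hj.
  by rewrite im levm inE.
have [hpi mpi li i0] := member_par mi im.
have hreg := f1 _ hpi mpi.
have used : size [seq f j | j <- iota 0 i & member j] < D.+1 ^ h.
  by rewrite size_map size_filter; apply: members_lt.
have new_of v : v \notin [seq f j | j <- iota 0 i & member j] -> forall j, j < i -> member j -> f j <> v.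
  move=> /mapP hv j hj mj e; apply: hv; exists j => //.
  by rewrite mem_filter mj mem_iota0.
case: (posnP (lev (par i))) => [lp|lp].
  have pm : par i = m := member_m mpi lp.
  have l1 : lev i = 1 by rewrite li lp.
  pose U := [seq f j | j <- iota 0 i & member j && (lev j == 1)].
  have sU : size U < D.
    rewrite size_map; apply: leq_trans (hD m).
    rewrite -[(size _).+1]/(size (i :: [seq j <- iota 0 i | member j && (lev j == 1)])).
    apply: uniq_leq_size.
      by rewrite /= filter_uniq ?iota_uniq // andbT mem_filter mem_iota0 ltnn andbF.
    move=> j; rewrite inE => /orP[/eqP ->|].
      by rewrite mem_children (leq_trans hi hN) i0 pm eqxx.
    rewrite mem_filter mem_iota0 => /andP[/andP[mj /eqP lj] hj].
    have jm : j != m by apply/eqP => jm; rewrite jm levm in lj.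
    have [hpj mpj lpj j0] := member_par mj jm.
    rewrite mem_children (ltn_trans hj (leq_trans hi hN)) j0 /=.
    by apply/eqP; apply: member_m mpj _; move: lpj; rewrite lj => -[].
  have [||v vs /andP[_ vU]] := @pick_avoid _ predT (tval sg.2) U.
  - by move: hu; rewrite cat_uniq => /andP[/= /andP[_ ->]].
  - by rewrite count_predT size_tuple.
  have hv : v \in region 1 by [].
  exists (upd f i v); apply: ext => //; last 2 first.
  - by rewrite l1.
  - move=> _ _; have := hreg; rewrite lp inE => /eqP ->.
    by case/andP: hst => _ /allP; apply.
  move=> j hj mj e; have h1 := f1 _ hj mj; rewrite e in h1.
  have hk := region_disj h1 hv.
  case/negP: vU; apply/mapP; exists j => //; rewrite mem_filter mem_iota0 hj mj /=.
  by move: hk; rewrite andbT /kind /=; case: (lev j) => [|[|l]].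
have [v [vr va vn]] : exists v, [/\ v \in region (lev i), adj (f (par i)) v & v \notin [seq f j | j <- iota 0 i & member j]].
  have [uX uY] : uniq X /\ uniq Y.
    by move: hu; rewrite cat_uniq => /and3P[_ _]; rewrite cat_uniq => /and3P[].
  rewrite li; move: hreg; case: (lev (par i)) lp => // l _; rewrite /region /=.
  case: (posnP l) => [->|l0] /= hreg.
    have [v vX /andP[v1 v2]] := @pick_avoid _ (adj (f (par i))) X _ uX (leq_trans used (hleaf hreg)).
    by exists v.
  rewrite gtn_eqF //= in hreg *; case: (odd l) hreg => /= hreg.
    have [|v vX /andP[_ v2]] := @pick_avoid _ predT Y [seq f j | j <- iota 0 i & member j] uY.
      by rewrite count_predT; apply: leq_trans used sY.
    by exists v; split=> //; apply: (allrelP hXY).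
  have [|v vX /andP[_ v2]] := @pick_avoid _ predT X [seq f j | j <- iota 0 i & member j] uX.
    by rewrite count_predT; apply: leq_trans used sX.
  by exists v; split=> //; rewrite adj_sym; apply: (allrelP hXY).
by exists (upd f i v); apply: ext => //; apply: new_of.
Qed.

End PieceEmbedding.

(* The children of the root of a piece are placed on hubs of a set [A] of free
   vertices of a tile, so that their own children can be placed in [A]. *)
Definition hubs (G : sgraph) (s : nat) (A : seq G) : seq G :=
  [seq y <- enum G | s <= count (adj y) A].

Lemma size_keep (T : eqType) (X I : seq T) : uniq X ->  uniq I ->
  size [seq x <- X | x \notin I] + count (mem X) I = size X.
Proof.
move=> uX uI; rewrite -(count_predC (mem I) X) addnC size_filter; congr (_ + _).
rewrite -!size_filter; apply/eqP; rewrite eqn_leq; apply/andP; split; apply: uniq_leq_size;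
  rewrite ?filter_uniq // => x; rewrite !mem_filter /= => /andP[-> ->] //.
Qed.

Lemma count_sub_disj (T : Type) (a b c : pred T) (s : seq T) :
  (forall x, a x -> ~~ b x) -> (forall x, a x -> c x) -> (forall x, b x -> c x) ->
  count a s + count b s <= count c s.
Proof.
move=> h1 h2 h3; rewrite -count_predUI (@eq_count _ (predI a b) pred0) ?count_pred0 ?addn0.
  by apply: sub_count => x /= /orP[/h2|/h3].
by move=> x /=; case: (boolP (a x)) => // /h1 /negbTE ->.
Qed.

(** * Placing the pieces one after another *)

Section Stages.

Variables (G : sgraph) (n N D h m1 t' K q : nat) (par : nat -> nat) (cut : pred nat).
Variables (f0 : nat -> G) (ts0 : seq (seq G * seq G)) (cs0 : seq (G * D.-tuple G)).
Hypothesis hp : down_par par n.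
Hypothesis hD : forall i, size (children par n i) <= D.
Hypothesis hN : N <= n.
Hypothesis m1N : m1 <= N.
Hypothesis m10 : 0 < m1.
Hypothesis hcut : forall j, j <= m1 -> cut j.
Hypothesis hlast : forall j, j < n -> m1 < j -> m1 <= par j.
Hypothesis hlev : forall j, j < N -> level par cut j < h.
Hypothesis f0_inj : forall i j, i < m1 -> j < m1 -> f0 i = f0 j -> i = j.
Hypothesis f0_adj : forall i, 0 < i < m1 -> adj (f0 (par i)) (f0 i).
Hypothesis u0 : uniq (flat ts0 ++ flatten (map (@sverts G D) cs0)).
Hypothesis f0_out : forall i, i < m1 -> f0 i \notin flat ts0 ++ flatten (map (@sverts G D) cs0).
Hypothesis hts0 : all (tile q) ts0.
Hypothesis hcs0 : all (@is_star G D) cs0.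
Hypothesis hreq : forall (p : G) (A : seq G), size A = t' ->
  K <= count (fits (nbrs p) (hubs (D.+1 ^ h) A)) cs0.
Hypothesis hK : count cut (iota m1 (N - m1)) < K.
Hypothesis hF : size ts0 * (2 * (t' + D.+1 ^ h) + D.+1 ^ h) + (N - m1) <= size (flat ts0).

Let s := D.+1 ^ h.
Let c0 : cut 0. Proof. exact: hcut. Qed.
Let tp := top par cut.
(** Pieces are placed in the order of their roots: before stage m, the initial subtree and the
    pieces with root below m are in place. A root never exceeds a member of its piece, so the parent
    of m is already placed. *)
Let dom m j := (j < N) && ((j < m1) || (tp j < m)).
Let allv ts (cs : seq (G * D.-tuple G)) := flat ts ++ flatten (map (@sverts G D) cs).

(** Three budgets are carried along: the sides of a tile differ by at most s, the tiles lose no more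
    vertices than have been placed beyond the initial subtree, and a request loses at most one star
    per root passed. *)
Let SInv m (f : nat -> G) (ts : seq (seq G * seq G)) (cs : seq (G * D.-tuple G)) : Prop :=
  [/\ [/\ forall i j, dom m i -> dom m j -> f i = f j -> i = j,
       forall j, dom m j -> 0 < j -> adj (f (par j)) (f j),
       forall j, j < m1 -> f j = f0 j & forall j, dom m j -> f j \notin allv ts cs],
     uniq (allv ts cs),
     all (fun p => [&& allrel (@adj G) p.1 p.2, size p.1 <= size p.2 + s & size p.2 <= size p.1 + s]) ts,
     [/\ size ts = size ts0,
       size (flat ts0) <= size (flat ts) + count (fun j => (m1 <= j) && (tp j < m)) (iota 0 N) &
       all (@is_star G D) cs] &
     forall (p : G) (A : seq G), size A = t' ->
       K <= count (fits (nbrs p) (hubs s A)) cs + count cut (iota m1 (m - m1))].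

Let topE' j : j < N -> tp j = if cut j then j else tp (par j).
Proof. by move=> hj; apply: topE hp c0 (leq_trans hj hN). Qed.

Let top_le j : j < N -> tp j <= j.
Proof. by move=> hj; have [] := top_cut hp c0 (leq_trans hj hN). Qed.

Let top_ge j : j < N -> m1 <= j -> m1 <= tp j.
Proof.
elim/ltn_ind: j => j IH hj hmj; rewrite topE' //; case: (boolP (cut j)) => // cj.
have hpj : par j < j by apply: hp; rewrite (cut_gt0 c0 cj) (leq_trans hj hN).
apply: IH => //; first exact: ltn_trans hj.
apply: hlast; first exact: leq_trans hN.
by rewrite ltn_neqAle hmj andbT; apply: contra cj => /eqP <-; exact: hcut.
Qed.

Let dom_par m j : m1 <= m -> dom m j -> 0 < j -> dom m (par j).
Proof.
move=> hm /andP[hj hd] j0; have hpj : par j < j by apply: hp; rewrite j0 (leq_trans hj hN).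
rewrite /dom (ltn_trans hpj hj) /=; case/orP: hd => [h1|]; first by rewrite (ltn_trans hpj h1).
rewrite topE' //; case: ifP => _ ht; last by rewrite ht orbT.
by rewrite (leq_ltn_trans (top_le (ltn_trans hpj hj)) (ltn_trans hpj ht)) orbT.
Qed.

Lemma stage_start : SInv m1 f0 ts0 cs0.
Proof.
have hd j : dom m1 j -> j < m1.
  by case/andP=> hj /orP[//|]; apply: contraTT; rewrite -!leqNgt; apply: top_ge.
split=> //.
- split=> [i j /hd hi /hd hj|j /hd hj j0|//|j /hd hj].
  + exact: f0_inj.
  + by apply: f0_adj; rewrite j0.
  + exact: f0_out.
- apply: sub_all hts0 => p /and3P[/eqP h1 /eqP h2 ->].
  by rewrite h1 h2 leq_addr.
- by split=> //; rewrite leq_addr.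
- by move=> p A hA; apply: leq_trans (hreq p hA) (leq_addr _ _).
Qed.

Lemma stage_uncut m f ts cs : m1 <= m -> ~~ cut m -> SInv m f ts cs -> SInv m.+1 f ts cs.
Proof.
move=> hm cm [[i1 i2 i3 i4] i5 i6 [i7 i8 i9] i10].
have ht j : j < N -> (tp j < m.+1) = (tp j < m).
  move=> hj; rewrite ltnS leq_eqVlt; case: eqP => // e.
  by have [hc _] := top_cut hp c0 (leq_trans hj hN); rewrite -/(tp j) e (negbTE cm) in hc.
have hd j : dom m.+1 j = dom m j.
  by rewrite /dom; case: (boolP (j < N)) => // hj; rewrite ht.
split=> //.
- by split=> [i j|j|//|j]; rewrite !hd; [apply: i1|apply: i2|apply: i4].
- split=> //; rewrite (@eq_in_count _ _ (fun j => (m1 <= j) && (tp j < m))) // => j.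
  by rewrite mem_iota0 => /ht ->.
- move=> p A hA; rewrite subSn // -addn1 iotaD count_cat /= subnKC // (negbTE cm) !addn0.
  exact: i10.
Qed.

Local Notation member := (in_piece par cut N).

(** Otherwise each tile has a side shorter than t' + s, and by balance at most 2 (t' + s) + s
    vertices left. This contradicts [hF], because fewer than N - m1 vertices have been placed in
    stages while m is still waiting. *)
Lemma free_tile m f ts cs : m1 <= m -> m < N -> cut m -> SInv m f ts cs ->
  exists p, p \in ts /\ (t' + s <= size p.1 /\ t' + s <= size p.2).
Proof.
move=> hm hmN cm [_ _ i6 [i7 i8 _] _].
case: (boolP (has (fun p => (t' + s <= size p.1) && (t' + s <= size p.2)) ts)) => [/hasP[p pt /andP[h1 h2]]|hno].
  by exists p.
have h1 : size (flat ts) <= size ts * (2 * (t' + s) + s).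
  rewrite /flat; elim: (ts) i6 hno => //= p ts1 IH /andP[/and3P[_ h1 h2] /IH {}IH].
  rewrite negb_or => /andP[hp1 /IH {}IH]; rewrite !size_cat mulSn; apply: leq_add IH.
  move: hp1 h1 h2; rewrite negb_and -!ltnNge; clear; gen_atoms; move: s => s'; case/orP; lia.
have h2 : count (fun j => (m1 <= j) && (tp j < m)) (iota 0 N) < N - m1.
  have h3 : count (fun j => (m1 <= j) && (tp j < m)) (iota 0 N) + count (pred1 m) (iota 0 N) <=
     count (fun j => m1 <= j) (iota 0 N).
    apply: count_sub_disj.
    - move=> j /andP[_ ht]; apply/eqP => jm; move: ht; rewrite jm topE' // cm ltnn //.
    - by move=> j /andP[].
    - by move=> j /eqP ->.
  have h4 : count (fun j => m1 <= j) (iota 0 N) <= N - m1.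
    rewrite -{1}(subnKC m1N) iotaD count_cat add0n (@eq_in_count _ _ pred0) ?count_pred0 ?add0n.
      by apply: leq_trans (count_size _ _) _; rewrite size_iota.
    by move=> j; rewrite mem_iota0 => hj; rewrite leqNgt hj.
  have h5 : count (pred1 m) (iota 0 N) = 1 by rewrite count_uniq_mem ?iota_uniq // mem_iota0 hmN.
  by move: h3 h4; rewrite h5; clear; glia.
exfalso; move: hF i8 h1 h2; rewrite i7 -/s; clear; gen_atoms; move: s => s'; lia.
Qed.

(** The set [A] whose hubs are requested is part of the side that receives the even levels, so the
    leaves of the star have s neighbours there, as level 2 requires. The star is given up with all
    its leaves, used or not. *)
Lemma stage_cut m f ts cs : m1 <= m -> m < N -> cut m -> SInv m f ts cs ->
  exists f' ts' cs', SInv m.+1 f' ts' cs'.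
Proof.
move=> hm hmN cm hinv.
have [p [pts [sp1 sp2]]] := free_tile hm hmN cm hinv.
case: hinv => [[i1 i2 i3 i4] i5 i6 [i7 i8 i9] i10].
pose lv := level par cut.
pose ev := count (fun j => member m j && ((1 < lv j) && ~~ odd (lv j))) (iota 0 N).
pose od := count (fun j => member m j && ((1 < lv j) && odd (lv j))) (iota 0 N).
have hmem : count (member m) (iota 0 N) <= s.
  apply: leq_trans (level_count m h hp c0 hD); rewrite -!size_filter; apply: uniq_leq_size.
    by rewrite filter_uniq ?iota_uniq.
  move=> j; rewrite !mem_filter !mem_iota0 => /andP[/andP[hj /eqP e] _].
  by rewrite -e eqxx hlev // (leq_trans hj hN).
have hevod : ev + od <= count (member m) (iota 0 N).
  apply: count_sub_disj => j /andP[-> ] // /andP[_ ho]; first by rewrite (negbTE ho) andbF.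
(* The orientation is chosen so that the larger of the two level classes of the
   piece goes to the larger side, which keeps every tile nearly balanced. *)
have [X [Y [hpXY sX sY hXY hbal]]] : exists X Y,
   [/\ perm_eq (p.1 ++ p.2) (X ++ Y), t' + s <= size X, t' + s <= size Y, allrel (@adj G) X Y &
     size X - ev <= size Y - od + s /\ size Y - od <= size X - ev + s].
  have /and3P[h1 h2 h3] := allP i6 _ pts.
  have h1' : allrel (@adj G) p.2 p.1 by apply/allrelP => x y hx hy; rewrite adj_sym; apply: (allrelP h1).
  case: (leqP (size p.1) (size p.2)) => hs; case: (leqP ev od) => heo.
  - exists p.1, p.2; split=> //.
    move: hevod hmem h2 h3 hs heo sp1 sp2; clear; rewrite -/s; clearbody s ev od; gen_atoms; lia.
  - exists p.2, p.1; split=> //; first by rewrite perm_catC.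
    move: hevod hmem h2 h3 hs heo sp1 sp2; clear; rewrite -/s; clearbody s ev od; gen_atoms; lia.
  - exists p.2, p.1; split=> //; first by rewrite perm_catC.
    move: hevod hmem h2 h3 hs heo sp1 sp2; clear; rewrite -/s; clearbody s ev od; gen_atoms; lia.
  - exists p.1, p.2; split=> //.
    move: hevod hmem h2 h3 hs heo sp1 sp2; clear; rewrite -/s; clearbody s ev od; gen_atoms; lia.
have m0 : 0 < m by apply: leq_trans hm.
have hpm : par m < m by apply: hp; rewrite m0 (leq_trans hmN hN).
pose A := take t' X.
have sA : size A = t' by rewrite size_takel // (leq_trans _ sX) // leq_addr.
have [sg sgcs hfit] : exists2 sg, sg \in cs & fits (nbrs (f (par m))) (hubs s A) sg.
  apply/hasP; rewrite has_count; have := i10 (f (par m)) A sA.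
  have : count cut (iota m1 (m - m1)) <= count cut (iota m1 (N - m1)).
    rewrite -(subnKC (leq_sub2r m1 (ltnW hmN))) iotaD count_cat; exact: leq_addr.
  by move: hK; clear; glia.
have hst : is_star sg := allP i9 _ sgcs.
pose R := flat (rem p ts) ++ flatten (map (@sverts G D) (rem sg cs)).
have hperm : perm_eq (allv ts cs) ((sverts sg ++ X ++ Y) ++ R).
  have e1 := perm_to_rem pts; have e2 := perm_to_rem sgcs.
  apply/permP => b; move: (permP hpXY b); rewrite /R /allv !count_cat !count_flat.
  rewrite (perm_big _ e1) big_cons /= !count_flatten_map (perm_big _ e2) big_cons /=.
  clear; glia.
have uall : uniq ((sverts sg ++ X ++ Y) ++ R) by rewrite -(perm_uniq hperm).
have [uSXY uR] : uniq (sverts sg ++ X ++ Y) /\ uniq R.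
  by move: uall; rewrite cat_uniq => /and3P[].
have [uX uY] : uniq X /\ uniq Y.
  by move: uSXY; rewrite cat_uniq => /and3P[_ _]; rewrite cat_uniq => /and3P[].
have hleaf y : y \in (sg.2 : seq G) -> D.+1 ^ h <= count (adj y) X.
  move=> hy; case/andP: hfit => _ /allP /(_ y hy) /=; rewrite mem_filter => /andP[+ _].
  by move=> hc; apply: leq_trans hc _; rewrite -[X in _ <= count _ X](cat_take_drop t' X) count_cat leq_addr.
have sX' : D.+1 ^ h <= size X by apply: leq_trans sX; rewrite leq_addl.
have sY' : D.+1 ^ h <= size Y by apply: leq_trans sY; rewrite leq_addl.
have [g [g1 g2 g3]] := piece_embedding hp c0 hD hN hmN hlev hst uSXY hXY sX' sY' hleaf cm.
pose im := [seq g j | j <- iota 0 N & member m j].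
have uim : uniq im.
  rewrite map_inj_in_uniq ?filter_uniq ?iota_uniq // => i j.
  by rewrite !mem_filter => /andP[hi _] /andP[hj _]; apply: g2.
have him j : member m j -> g j \in im.
  by move=> mj; apply/mapP; exists j => //; rewrite mem_filter mj mem_iota0; case/andP: mj.
pose X' := [seq x <- X | x \notin im]; pose Y' := [seq x <- Y | x \notin im].
have disj l l' := @region_disj G D sg X Y uSXY l l'.
(* Exactly the members at even levels from 2 on occupy [X], so the balance arranged above is the
   balance of the new tile. *)
have sX1 : size X' + ev = size X.
  rewrite -(size_keep uX uim); congr (_ + _); rewrite /im count_map count_filter /ev.
  apply: eq_in_count => j; rewrite mem_iota0 => hj /=.
  case: (boolP (member m j)) => mj; rewrite ?andbF // !andbT.
  have := g1 _ mj; rewrite -/(lv j) => hg'; apply/andP/idP => [[l1 lo]|hx].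
    move: hg'; rewrite /region; move: l1 lo; case: (lv j) => [|[|l]] //= _.
    by case: (odd l).
  have := disj _ 2 _ hg' hx; rewrite /kind /=; case: (lv j) => [|[|l]] //=.
  by case: (odd l).
have sY1 : size Y' + od = size Y.
  rewrite -(size_keep uY uim); congr (_ + _); rewrite /im count_map count_filter /od.
  apply: eq_in_count => j; rewrite mem_iota0 => hj /=.
  case: (boolP (member m j)) => mj; rewrite ?andbF // !andbT.
  have := g1 _ mj; rewrite -/(lv j) => hg'; apply/andP/idP => [[l1 lo]|hx].
    move: hg'; rewrite /region; move: l1 lo; case: (lv j) => [|[|l]] //= _.
    by case: (odd l).
  have := disj _ 3 _ hg' hx; rewrite /kind /=; case: (lv j) => [|[|l]] //=.
  by case: (odd l).
pose f' j := if member m j then g j else f j.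
have memdom j : member m j -> ~~ dom m j.
  move=> /andP[hj /eqP e]; rewrite -/(tp j) in e; rewrite /dom hj e ltnn orbF /= -leqNgt.
  by apply: leq_trans hm _; rewrite -e top_le.
have domS j : dom m.+1 j -> member m j \/ (dom m j /\ ~~ member m j).
  move=> /andP[hj hd]; case: (boolP (member m j)) => mj; first by left.
  right; split=> //; rewrite /dom hj /=; move: hd mj; rewrite /in_piece hj -/(tp j) /= ltnS (leq_eqVlt (tp j)).
  by case: (tp j == m).
have regsub l x : x \in region sg X Y l -> x \in sverts sg ++ X ++ Y.
  rewrite /region /sverts mem_cat inE !mem_cat.
  case: (l == 0); first by rewrite inE => ->.
  case: (l == 1); first by move=> ->; rewrite orbT.
  by case: (odd l) => ->; rewrite !orbT.
have notin_new x : x \notin allv ts cs -> x \notin allv ((X', Y') :: rem p ts) (rem sg cs).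
  rewrite (perm_mem hperm); apply: contra; rewrite /allv /flat /= -/(flat _) -!catA !mem_cat !mem_filter.
  rewrite inE !mem_cat => /or3P[/andP[_ ->]|/andP[_ ->]|]; rewrite ?orbT //.
  by move=> ->; rewrite !orbT.
exists f', ((X', Y') :: rem p ts), (rem sg cs).
have hsz : size (flat ts) = size X + size Y + size (flat (rem p ts)).
  have := perm_size hpXY; rewrite !size_cat.
  rewrite -!(count_predT (flat _)) !count_flat (perm_big _ (perm_to_rem pts)) big_cons /= !count_predT.
  by move=> ->.
split.
- split.
  + move=> i j /domS [mi|[di mi]] /domS [mj|[dj mj]]; rewrite /f' ?mi ?mj ?(negbTE mi) ?(negbTE mj).
    * exact: g2.
    * move=> e; have := i4 _ dj; rewrite -e (perm_mem hperm) mem_cat negb_or => /andP[+ _].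
      by rewrite (regsub _ _ (g1 _ mi)).
    * move=> e; have := i4 _ di; rewrite e (perm_mem hperm) mem_cat negb_or => /andP[+ _].
      by rewrite (regsub _ _ (g1 _ mj)).
    * exact: i1.
  + move=> j /domS [mj|[dj mj]] j0; rewrite /f' ?mj ?(negbTE mj).
      case: (eqVneq j m) => [->|jm].
        have -> : member m (par m) = false.
          apply/negP => /andP[h1 /eqP e]; rewrite -/(tp _) in e; have := top_le h1; rewrite e leqNgt hpm //.
        have mm : member m m by rewrite /in_piece hmN -/(tp m) topE' // cm /=.
        have := g1 _ mm; rewrite (levelE hp c0 (leq_trans hmN hN)) cm /region /= inE => /eqP ->.
        by case/andP: hfit; rewrite mem_nbrs.
      have [_ -> _ _] : [/\ par j < j, member m (par j), lv j = (lv (par j)).+1 & 0 < j].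
        exact: (member_par hp c0 hN mj jm).
      exact: g3.
    have dpj := dom_par hm dj j0.
    have -> : member m (par j) = false by apply/negP => /memdom; rewrite dpj.
    exact: i2.
  + move=> j hj; rewrite /f' ifF ?i3 //; apply/negP => /memdom.
    by rewrite /dom hj (leq_trans hj m1N).
  + move=> j /domS [mj|[dj mj]]; rewrite /f' ?mj ?(negbTE mj); last by apply/notin_new/i4.
    rewrite /allv /flat /= -/(flat _) -catA mem_cat negb_or; apply/andP; split.
      by rewrite mem_cat !mem_filter him.
    move: uall; rewrite cat_uniq => /and3P[_ /hasPn hh _].
    by apply/negP => /hh; rewrite /= (regsub _ _ (g1 _ mj)).
- rewrite /allv /flat /= -/(flat _) -catA -/R cat_uniq uR andbT -filter_cat.
  have uXY : uniq (X ++ Y) by case/and3P: (etrans (esym (cat_uniq _ _)) uSXY).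
  rewrite (filter_uniq _ uXY) /=.
  apply/hasPn => x xR; rewrite mem_filter; apply/negP => /andP[_ h1].
  move: uall; rewrite cat_uniq => /and3P[_ /hasPn hh _].
  by have := hh _ xR; rewrite mem_cat /= h1 orbT.
- rewrite /=; apply/andP; split.
    apply/and3P; split.
    + by apply/allrelP => x y; rewrite !mem_filter => /andP[_ hx] /andP[_ hy]; apply: (allrelP hXY).
    + by move: hbal; rewrite -sX1 -sY1 !addnK => -[].
    + by move: hbal; rewrite -sX1 -sY1 !addnK => -[].
  by apply/allP => p' /mem_rem; apply: (allP i6).
- split.
  + by rewrite /= size_rem // -i7 prednK //; case: (ts) pts.
  + have hc : count (fun j => (m1 <= j) && (tp j < m)) (iota 0 N) + count (member m) (iota 0 N) <=
        count (fun j => (m1 <= j) && (tp j < m.+1)) (iota 0 N).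
      apply: count_sub_disj.
      * by move=> j /andP[_ h1]; apply/negP => /andP[_ /eqP e]; rewrite -/(tp j) in e; rewrite e ltnn in h1.
      * by move=> j /andP[-> h1]; rewrite ltnS ltnW.
      * by move=> j /andP[hj /eqP e]; rewrite -/(tp j) in e; rewrite e ltnSn andbT (leq_trans hm) // -e top_le.
    move: i8 hc hevod hsz; rewrite -sX1 -sY1 {2}/flat /= -/(flat _) !size_cat.
    clear; clearbody ev od; glia.
  + by apply/allP => c /mem_rem; apply: (allP i9).
- move=> p' A' hA'; have := i10 p' A' hA'; rewrite subSn // -addn1 iotaD count_cat /= subnKC // cm.
  rewrite (permP (perm_to_rem sgcs)) /= addn0; have := leq_b1 (fits (nbrs p') (hubs s A') sg).
  clear; move: (nat_of_bool _) => b; glia.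
Qed.

Lemma stages : exists f : nat -> G,
  [/\ forall i j, i < N -> j < N -> f i = f j -> i = j,
      forall i, 0 < i < N -> adj (f (par i)) (f i) &
      forall i, i < m1 -> f i = f0 i].
Proof.
have [f [ts [cs [[i1 i2 i3 _] _ _ _ _]]]] : exists f ts cs, SInv N f ts cs.
  rewrite -(subnKC m1N); have : m1 + (N - m1) <= N by rewrite subnKC.
  elim: (N - m1) => [|d IH] hd; first by rewrite addn0; exists f0, ts0, cs0; exact: stage_start.
  rewrite addnS in hd *; have [f [ts [cs hf]]] := IH (ltnW hd).
  case: (boolP (cut (m1 + d))) => hc.
    by apply: stage_cut hf => //; exact: leq_addr.
  by exists f, ts, cs; apply: stage_uncut => //; exact: leq_addr.
have hd j : j < N -> dom N j.
  by move=> hj; rewrite /dom hj (leq_ltn_trans (top_le hj) hj) orbT.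
exists f; split=> // [i j hi hj|i /andP[i0 hi]]; first by apply: i1; exact: hd.
by apply: i2 => //; exact: hd.
Qed.

End Stages.

(** * Absorption *)

(** The last two clauses protect the family. No parent of an absorber is an absorber, so moving one
    does not disturb the others; and all children are placed before N, so no vertex added later
    hangs on an absorber. *)
Definition absorbers (G : sgraph) (d n N : nat) (par : nat -> nat) (ab : seq (nat * (G * d.-tuple G)))
    (f : nat -> G) : Prop :=
  forall t, t \in ab -> [/\ 0 < t.1 < N, f t.1 = t.2.1, f (par t.1) \in (t.2.2 : seq G),
    par t.1 \notin map fst ab &
    forall c, c \in children par n t.1 -> c < N /\ f c \in (t.2.2 : seq G)].

(** The other absorbers survive the move of w: it is the parent of none of them, and if it were a
    child of one, its own parent would be an absorber. *)
Lemma absorb_one (G : sgraph) d n N i (par : nat -> nat) (f : nat -> G)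
    (ab : seq (nat * (G * d.-tuple G))) :
  down_par par n -> N <= i -> i < n -> 0 < i -> i < #|G| ->
  (forall j k, j < i -> k < i -> f j = f k -> j = k) ->
  (forall j, 0 < j < i -> adj (f (par j)) (f j)) ->
  uniq (map fst ab) -> absorbers n N par ab f ->
  (forall x y : G, 0 < count (fun t => fits (nbrs y) (nbrs x) t.2) ab) ->
  exists t f', [/\ t \in ab, absorbers n N par (rem t ab) f',
    forall j k, j < i.+1 -> k < i.+1 -> f' j = f' k -> j = k &
    forall j, 0 < j < i.+1 -> adj (f' (par j)) (f' j)].
Proof.
move=> hp hN hi i0 hiG hinj hadj uab hab hfit.
have [x hx] : exists x, x \notin [seq f j | j <- iota 0 i].
  case: (boolP [exists x, x \notin [seq f j | j <- iota 0 i]]) => [/existsP //|].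
  rewrite negb_exists => /forallP h; exfalso.
  have : #|G| <= size [seq f j | j <- iota 0 i].
    have -> : #|G| = size (enum G) by rewrite cardE.
    apply: uniq_leq_size; first exact: enum_uniq.
    by move=> z _; have := h z; rewrite negbK.
  by rewrite size_map size_iota leqNgt hiG.
have xnew j : j < i -> f j <> x.
  by move=> hj e; case/mapP: hx; exists j; rewrite ?mem_iota0.
have := hfit x (f (par i)); rewrite -has_count => /hasP[t tab /andP[h1 /allP h2]].
have [/andP[w0 wN] fw fpw pw hch] := hab _ tab.
set w := t.1 in w0 wN fw fpw pw hch; set s := t.2 in h1 h2 fw fpw hch.
have wi : w < i := leq_trans wN hN.
have hpi : par i < i by apply: hp; rewrite i0.
have hpw : par w < w by apply: hp; rewrite w0 (ltn_trans wi).
have piw : par i != w.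
  apply/eqP => e; have [|h _] := hch i; first by rewrite mem_children hi i0 e eqxx.
  by rewrite ltnNge hN in h.
rewrite mem_nbrs in h1; have {}h2 z : z \in (s.2 : seq G) -> adj x z by move=> /h2; rewrite /= mem_nbrs.
pose f' := upd (upd f i (f w)) w x.
have f'w : f' w = x by rewrite /f' /upd eqxx.
have f'i : f' i = f w by rewrite /f' /upd gtn_eqF // eqxx.
have f'E j : j != w -> j != i -> f' j = f j by rewrite /f' /upd => /negbTE -> /negbTE ->.
exists t, f'; split=> //.
- move=> t' ht'; have t'ab := mem_rem ht'; have [/andP[w0' wN'] fw' fpw' pw' hch'] := hab _ t'ab.
  have nw : t'.1 != w.
    apply/eqP => e; have uab' : uniq ab by apply: map_uniq uab.
    have : t' = t.
      have ei : index t' ab = index t ab.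
        apply/eqP; rewrite -(nth_uniq 0 _ _ uab) ?size_map ?index_mem //.
        by rewrite !(nth_map t) ?index_mem // !nth_index //; apply/eqP.
      by rewrite -(nth_index t t'ab) ei nth_index.
    by move=> e2; move: ht'; rewrite e2 mem_rem_uniqF.
  have hpw' : par t'.1 < t'.1 by apply: hp; rewrite w0' (ltn_trans (leq_trans wN' hN)).
  have ti : t'.1 < i := leq_trans wN' hN.
  split=> //.
  + by rewrite w0'.
  + by rewrite f'E // ltn_eqF.
  + rewrite f'E //; last by rewrite ltn_eqF // (ltn_trans hpw').
    by apply: contraNneq pw' => ->; apply: map_f.
  + by apply: contra pw' => /mapP[z /mem_rem hz ->]; apply: map_f.
  + move=> c hc; have [cN fc] := hch' _ hc; split=> //; rewrite f'E //.
      apply: contraNneq pw => e; move: hc; rewrite e mem_children => /and3P[_ _ /eqP ->].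
      exact: map_f.
    by rewrite ltn_eqF // (leq_trans cN).
- have val j : j < i.+1 -> [\/ j = w, j = i | [/\ j != w, j != i & j < i]].
    rewrite ltnS leq_eqVlt => /orP[/eqP ->|hj]; first by apply: Or32.
    case: (eqVneq j w) => [->|hjw]; first by apply: Or31.
    by apply: Or33; rewrite ltn_eqF.
  move=> j k /val [->|->|[j1 j2 j3]] /val [->|->|[k1 k2 k3]] //; rewrite ?f'w ?f'i ?f'E //.
  + by move=> e; case: (xnew w).
  + by move=> e; case: (xnew k).
  + by move=> e; case: (xnew w).
  + by move=> e; have ewk := hinj _ _ wi k3 e; rewrite ewk eqxx in k1.
  + by move=> e; case: (xnew j).
  + by move=> e; have ewj := hinj _ _ j3 wi e; rewrite ewj eqxx in j1.
  + exact: hinj.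
move=> j /andP[j0]; rewrite ltnS leq_eqVlt => /orP[/eqP ->|hj].
  have pii : par i != i by rewrite ltn_eqF.
  by rewrite f'i (f'E _ piw pii) fw.
have hpj : par j < j by apply: hp; rewrite j0 (ltn_trans hj).
have pji : par j != i by rewrite ltn_eqF // (ltn_trans hpj).
have ji : j != i by rewrite ltn_eqF.
case: (eqVneq j w) => [->|jw].
  by rewrite f'w f'E ?ltn_eqF // ?(ltn_trans hpw) // adj_sym h2.
case: (eqVneq (par j) w) => [e|pjw].
  rewrite e f'w f'E //; apply: h2.
  by have [|_ ->] := hch j; rewrite // mem_children j0 (ltn_trans hj hi) e eqxx.
by rewrite !f'E //; apply: hadj; rewrite j0.
Qed.

Theorem absorption (G : sgraph) d n N (par : nat -> nat) (f : nat -> G)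
    (ab : seq (nat * (G * d.-tuple G))) :
  down_par par n -> N <= n -> 0 < N -> #|G| = n ->
  (forall j k, j < N -> k < N -> f j = f k -> j = k) ->
  (forall j, 0 < j < N -> adj (f (par j)) (f j)) ->
  uniq (map fst ab) -> absorbers n N par ab f ->
  (forall x y : G, n - N <= count (fun t => fits (nbrs y) (nbrs x) t.2) ab) ->
  exists f' : nat -> G,
   (forall j k, j < n -> k < n -> f' j = f' k -> j = k) /\
   (forall j, 0 < j < n -> adj (f' (par j)) (f' j)).
Proof.
move=> hp hN N0 hG hinj hadj uab hab hfit.
have : exists (f' : nat -> G) (ab' : seq (nat * (G * d.-tuple G))), [/\ forall j k, j < N + (n - N) -> k < N + (n - N) -> f' j = f' k -> j = k,
    forall j, 0 < j < N + (n - N) -> adj (f' (par j)) (f' j),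
    uniq (map fst ab'), absorbers n N par ab' f' &
    forall x y : G, n - N <= count (fun t => fits (nbrs y) (nbrs x) t.2) ab' + (n - N)].
  have : N + (n - N) <= n by rewrite subnKC.
  move: {1 2 3 4 6}(n - N) => e; elim: e => [|e IH] he.
    by rewrite addn0; exists f, ab; split=> // x y; rewrite addn0.
  rewrite addnS in he.
  have [f1 [ab1 [i1 i2 i3 i4 i5]]] := IH (ltnW he).
  have hpos x y : 0 < count (fun t => fits (nbrs y) (nbrs x) t.2) ab1.
    by have := i5 x y; move: he; clear; glia.
  have [|||t [f2 [j1 j2 j3 j4]]] := absorb_one hp _ he _ _ i1 i2 i3 i4 hpos.
  - exact: leq_addr.
  - by rewrite addn_gt0 N0.
  - by rewrite hG.
  exists f2, (rem t ab1); split; rewrite ?addnS //.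
    by apply: subseq_uniq i3; apply: map_subseq; apply: rem_subseq.
  move=> x y; have := i5 x y; rewrite (permP (perm_to_rem j1)) /=.
  by have := leq_b1 (fits (nbrs y) (nbrs x) t.2); move: (nat_of_bool _); clear; gen_atoms; lia.
by move=> [f' [ab' [h1 h2 _ _ _]]]; rewrite subnKC // in h1 h2; exists f'.
Qed.

(** * Choice of the constants *)

(** Depth falls by one on each step upwards, so residue r occurs within h steps; the bound by (depth
    + h - r) mod h turns this into an induction. The additional marks up to m1 only shorten
    levels. *)
Lemma level_periodic par n m1 h r : down_par par n -> r < h ->
  let cut := fun j => (j <= m1) || (level par (pred1 0) j %% h == r) in
  forall j, j < n -> level par cut j < h.
Proof.
move=> hp hr cut j hj; have h0 : 0 < h by apply: leq_ltn_trans hr.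
suff: level par cut j <= (level par (pred1 0) j + (h - r)) %% h.
  by move=> /leq_ltn_trans; apply; rewrite ltn_pmod.
elim/ltn_ind: j hj => j IH hj.
have c0 : cut 0 by [].
rewrite (levelE hp c0 hj); case: ifP => // cj.
have j0 := cut_gt0 c0 (negbT cj).
have hpj : par j < j by apply: hp; rewrite j0.
have := IH _ hpj (ltn_trans hpj hj).
have := levelE hp (isT : pred1 0 0) hj; rewrite /= gtn_eqF // => e.
move: cj; rewrite /cut e => /norP[_ cj].
rewrite addSn modnS; case: ifP => [hd|_]; last by rewrite ltnS.
case/eqP: cj; rewrite -(modn_small hr) -[X in _ = X %% h]add0n.
apply/eqP; rewrite -(eqn_modDr (h - r)) -addnA subnKC ?(ltnW hr) // add0n modnn addSn.
by rewrite -/(dvdn _ _).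
Qed.

(** Besides m1 itself, only vertices of residue r are roots in this range. *)
Lemma count_cut par n N m1 h r : N <= n -> m1 <= N ->
  h * count (fun j => level par (pred1 0) j %% h == r) (iota 0 n) <= n ->
  h * count (fun j => (j <= m1) || (level par (pred1 0) j %% h == r)) (iota m1 (N - m1)) <= h + n.
Proof.
move=> hN hm hc; set b := fun j => _ == r in hc *.
have h1 : count (fun j => (j <= m1) || b j) (iota m1 (N - m1)) <= 1 + count b (iota 0 n).
  case: (N - m1) (subnKC hm) => // d e; rewrite /= leqnn /= leq_add2l.
  rewrite (@eq_in_count _ _ b); last by move=> j; rewrite mem_iota => /andP[hj _]; rewrite [j <= m1]leqNgt hj.
  rewrite -(subnKC hN) -e addnS -addSn iotaD count_cat; apply: leq_trans (leq_addr _ _).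
  by rewrite iotaD count_cat add0n leq_addl.
by apply: leq_trans (leq_mul (leqnn h) h1) _; rewrite mulnDr muln1 leq_add2l.
Qed.

(** Double counting: [A] sends at least |A| (n/2 - a) edges, and the vertices with fewer than s
    neighbours in [A] take at most n s <= a |A| of them, because |A| = s c and n <= c a. So at least
    n/2 - 2a vertices are hubs. *)
Lemma hubs_large (G : sgraph) a c s (A : seq G) : rich G a -> #|G| <= c * a -> 0 < c -> 0 < s ->
  size A = s * c -> large_set a (hubs s A).
Proof.
move=> hr hca c0 s0 sA; split; first by rewrite filter_uniq ?enum_uniq.
rewrite size_filter; set b := fun y => _.
have h1 : all (fun y => count (adj y) A <= size A) (enum G) by apply/allP => y _; exact: count_size.
have := sum_threshold s h1; rewrite -/(edg (enum G) A) edg_sym -/b.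
have h2 : size A * #|G| <= 2 * edg A (enum G) + 2 * a * size A.
  rewrite /edg; elim: (A) => [|x A' IH]; first by rewrite mul0n.
  rewrite big_cons /= mulSn mulnDr mulnS; move: (hr.1 x) IH; clear; glia.
have h3 : size (enum G) = #|G| by rewrite cardE.
rewrite h3 => h4; have sc0 : 0 < s * c by rewrite muln_gt0 s0.
rewrite -(leq_pmul2r sc0); move: h2 h4; rewrite sA.
have := leq_mul hca (leqnn s); clear; gen_atoms; nia.
Qed.

Section Assembly.

Variables (G T : sgraph) (D c a : nat).
Hypothesis D0 : 0 < D.
Hypothesis c0 : 0 < c.
Hypothesis hr : rich G a.
Hypothesis hca : #|G| <= c * a.
Hypothesis hTG : #|T| = #|G|.
Hypothesis hT : tree T.
Hypothesis hD : max_degree T <= D.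
Hypothesis a0 : 0 < a.
Hypothesis n0 : 0 < #|G|.

Lemma copy_of_embedding (v : nat -> T) (par : nat -> nat) (f : nat -> G) :
  (forall x, exists2 i, i < #|T| & v i = x) ->
  (forall i j, i < #|T| -> j < #|T| -> adj (v i) (v j) ->
        (0 < j /\ par j = i) \/ (0 < i /\ par i = j)) ->
  (forall j k, j < #|G| -> k < #|G| -> f j = f k -> j = k) ->
  (forall j, 0 < j < #|G| -> adj (f (par j)) (f j)) -> contains_copy G T.
Proof.
move=> hv hpar hinj hadj.
pose idx x : nat := odflt 0 (omap (@nat_of_ord _) [pick i : 'I_#|T| | v i == x]).
have hidx x : idx x < #|T| /\ v (idx x) = x.
  rewrite /idx; case: pickP => [i /eqP ei|h]; first by split=> /=; [exact: ltn_ord|].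
  by have [j hj ej] := hv x; have := h (Ordinal hj); rewrite /= ej eqxx.
exists (fun x => f (idx x)); split=> [x y e|x y axy].
  have [hx ex] := hidx x; have [hy ey] := hidx y.
  by rewrite -ex -ey; congr v; apply: hinj e; rewrite -hTG.
have [hx ex] := hidx x; have [hy ey] := hidx y.
rewrite -ex -ey in axy; case: (hpar _ _ hx hy axy) => -[i0 e].
  by rewrite -e; apply: hadj; rewrite i0 -hTG.
by rewrite adj_sym -e; apply: hadj; rewrite i0 -hTG.
Qed.

Variables (csA : seq (G * D.+1.-tuple G)) (bA bR h q e : nat).
Hypothesis uA : uniq (flatten (map (@sverts G D.+1) csA)).
Hypothesis stA : all (@is_star G D.+1) csA.
Hypothesis hA : 4 * (5 * D ^ 4 + D.+2) * size csA <= a.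
Hypothesis fitA : forall x y : G, #|G| <= bA * count (fits (nbrs y) (nbrs x)) csA.
Hypothesis bA0 : 0 < bA.
Hypothesis bR0 : 0 < bR.

Let s := D.+1 ^ h.
Let t' := s * c.

Hypothesis hconn : forall Z : seq G, size Z <= a -> exists cs : seq (G * D.-tuple G),
    [/\ uniq (flatten (map (@sverts G D) cs)), all (fun v => v \notin Z) (flatten (map (@sverts G D) cs)),
      all (@is_star G D) cs, 32 * bA * c * D.+1 * size cs <= #|G| &
      forall (p : G) (A : seq G), size A = t' -> #|G| <= bR * count (fits (nbrs p) (hubs s A)) cs].
Hypothesis htile : forall V0 : seq G, uniq V0 -> #|G| <= size V0 + a ->
  exists (ts : seq (seq G * seq G)) L, tiling q V0 ts L /\ e * size L <= #|G|.
Hypothesis hh : h = 4 * bR.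
Hypothesis he : e = 16 * bA.
Hypothesis hq : q = 16 * bA * (2 * t' + 3 * s).
Hypothesis big1 : 4 * (5 * D * (D.+1 ^ 4 + 1) + 1) <= a.
Hypothesis big2 : 8 * bA <= #|G|.
Hypothesis big3 : 8 * bR <= #|G|.

(** About n / (2 bA) vertices, k in number, are left to absorption. The vertices missed by the
    tiling, the star vertices and the ends of tiles too short for another piece are at most k / 4
    each; hence e = 16 bA, the factor 32 bA in [hconn] and the value of q. With h = 4 bR there are
    fewer piece roots than connecting stars per request. *)
Lemma assembly : contains_copy G T.
Proof.
have [x0 _] := card_gt0P n0.
(* The size that [absorber_spots] needs in order to find one spot per absorbing star. *)
pose mu := 5 * (D ^ 3 * size csA + D.+1 ^ 4 + 1).
have hn := rich_le hr n0.
have hmuD : (D * mu).+1 + D.+2 * size csA + (D * mu).+1 <= a.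
  move: hA big1; rewrite /mu ![D ^ _.+1]expnS; clear; move: (expn D.+1 4) (expn D 0) => x y; gen_atoms; nia.
have mu0 : 0 < mu by rewrite muln_gt0 addn1.
have hmu : mu <= #|T|.
  rewrite hTG; have : mu <= D * mu by rewrite leq_pmull.
  by move: hmuD hn; clear; clearbody mu; gen_atoms; lia.
have [v [par [m1 [[/andP[m1l m1u] m1T] hv [hp hch] hlast hadjT]]]] := tree_coding hT hD mu0 hmu.
rewrite hTG in m1T hp hch hlast.
have [ws [rho [sw uG hw hrho hchw]]] := absorber_spots D0 hp hch m1T hlast m1l.
have sflA : size (flatten [seq sverts i | i <- csA]) = D.+2 * size csA.
  rewrite (@size_flatten_map _ _ _ _ D.+2) 1?mulnC //.
  by apply/allP => z _; rewrite /sverts /= size_tuple.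
have hsize : m1 + size (flatten [seq sverts i | i <- csA]) <= a.
  by rewrite sflA; move: m1u hmuD; clear; gen_atoms; lia.
have [f0 [f0inj f0adj f0st]] :=
  @absorber_embedding G a #|G| D m1 rho par x0 csA ws hr hp hch m1T sw uG hw hrho hchw uA stA hsize n0 a0.
pose Z := [seq f0 i | i <- iota 0 m1].
have sZ : size Z = m1 by rewrite size_map size_iota.
have sZa : size Z <= a by rewrite sZ; apply: leq_trans hsize; exact: leq_addr.
have [cs [uR outR stR szR fitR]] := hconn sZa.
pose R := flatten [seq sverts i | i <- cs].
have sR : size R = D.+1 * size cs.
  rewrite /R (@size_flatten_map _ _ _ _ D.+1) 1?mulnC //.
  by apply/allP => z _; rewrite /sverts /= size_tuple.
have hRn : 32 * bA * size R <= #|G| /\ 2 * size R <= a.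
  have h1 : 32 * bA * c * size R <= #|G| by rewrite sR mulnA.
  split.
    by apply: leq_trans h1; rewrite [_ * c]mulnC -[c * _ * _]mulnA leq_pmull.
  apply: (@ltn_mulP _ _ c) => //; rewrite [a * c]mulnC; apply: leq_trans hca.
  apply: leq_trans h1; rewrite -[_ * c * _]mulnA -mulnA [size R * c]mulnC leq_mul2r.
  by apply/orP; right; move: bA0; clear; lia.
pose V0 := [seq x <- enum G | (x \notin Z) && (x \notin R)].
have uV0 : uniq V0 by rewrite filter_uniq ?enum_uniq.
have uZ : uniq Z.
  rewrite map_inj_in_uniq ?iota_uniq // => i j; rewrite !mem_iota0; exact: f0inj.
have sV0 : size V0 + m1 + size R = #|G|.
  have : perm_eq (enum G) (V0 ++ Z ++ R).
    apply: uniq_perm; first exact: enum_uniq.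
      rewrite !cat_uniq uV0 uZ uR andbT /=; apply/andP; split.
        by apply/hasPn => x; rewrite mem_cat /= mem_filter => /orP[] ->; rewrite ?andbF.
      by apply/hasPn => x /(allP outR).
    move=> x; apply/idP/idP => [_|_]; last by have := mem_enum G x.
    rewrite !mem_cat mem_filter; case: (x \in Z); case: (x \in R) => //=; rewrite ?orbT //.
    by rewrite orbF; have := mem_enum G x.
  by move=> /perm_size; rewrite !size_cat sZ -cardE => ->; rewrite addnA.
have hV0 : #|G| <= size V0 + a.
  by case: hRn => _; move: sV0 m1u hmuD; clear; gen_atoms; lia.
have [ts [L [/andP[hts hperm] hL]]] := htile uV0 hV0.
pose k := #|G| %/ (2 * bA); pose N := #|G| - k.
have d0 : 0 < 2 * bA by rewrite muln_gt0.
have hk1 : 2 * bA * k <= #|G| by rewrite mulnC leq_trunc_div.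
have hk2 : #|G| < (k + 1) * (2 * bA) by rewrite addn1 ltn_ceil.
have hk4 : #|G| <= 4 * bA * k by move: hk2 big2 bA0; clear; clearbody k; gen_atoms; nia.
have hkn : 2 * k <= #|G|.
  by apply: leq_trans hk1; rewrite leq_mul2r leq_pmulr ?orbT.
have hN : N <= #|G| by apply: leq_subr.
have m1N : m1 <= N.
  move: hkn hn m1u hmuD; rewrite /N; clear; clearbody k; gen_atoms; lia.
have m10 : 0 < m1 by apply: leq_trans m1l.
have h0 : 0 < h by rewrite hh muln_gt0.
have s0 : 0 < s by rewrite expn_gt0.
have [r rh hcr] := rare_residue (level par (pred1 0)) (iota 0 #|G|) h0.
rewrite size_iota in hcr.
pose cut j := (j <= m1) || (level par (pred1 0) j %% h == r).
have hlev j : j < N -> level par cut j < h.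
  by move=> hj; apply: (level_periodic _ hp rh) => //; apply: leq_trans hj hN.
have hcut j : j <= m1 -> cut j by rewrite /cut => ->.
pose K := #|G| %/ bR.
have hreq (p : G) (A : seq G) : size A = t' -> K <= count (fits (nbrs p) (hubs s A)) cs.
  move=> sA; rewrite /K -(mulKn (count _ cs) bR0); apply: leq_div2r; exact: fitR.
have hK : count cut (iota m1 (N - m1)) < K.
  have := count_cut hN m1N hcr; rewrite -/cut.
  have hK1 : #|G| < (K + 1) * bR by rewrite addn1 ltn_ceil.
  move: hK1 big3 bR0; rewrite hh; clear; clearbody K; gen_atoms; nia.
have hNt : size ts * q * 2 <= #|G|.
  apply: leq_trans (uniq_size uV0); rewrite -(perm_size hperm) size_cat (size_flat hts).
  by apply: leq_trans (leq_addr _ _); rewrite eq_leq //; clear; glia.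
have hF : size ts * (2 * (t' + s) + s) + (N - m1) <= size (flat ts).
  have e1 : size ts * (2 * (t' + s) + s) <= k %/ 4 + k %/ 4.
    apply: leq_trans (leq_addr _ _); rewrite leq_divRL // -(leq_pmul2l d0).
    have : size ts * q * 2 <= 4 * bA * k := leq_trans hNt hk4.
    by rewrite hq; clear; clearbody k t' s; gen_atoms; nia.
  have e2 : size R <= k %/ 4.
    rewrite leq_divRL // -(leq_pmul2l d0); have := leq_trans hRn.1 hk4.
    by clear; clearbody k; gen_atoms; nia.
  have e3 : size L <= k %/ 4.
    rewrite leq_divRL // -(leq_pmul2l d0); have := leq_trans hL hk4.
    by rewrite he; clear; clearbody k; gen_atoms; nia.
  have := perm_size hperm; rewrite size_cat; move: sV0 e1 e2 e3 m1N hkn; rewrite /N.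
  by clear; clearbody k; gen_atoms; lia.
have pV0 : perm_eq (flat ts ++ L) V0 := hperm.
have uts : uniq (flat ts) by move: uV0; rewrite -(perm_uniq pV0) cat_uniq => /and3P[].
have tsV0 x : x \in flat ts -> x \in V0 by move=> hx; rewrite -(perm_mem pV0) mem_cat hx.
have u0 : uniq (flat ts ++ R).
  rewrite cat_uniq uts uR andbT; apply/hasPn => x xR; apply/negP => /tsV0.
  by rewrite mem_filter xR andbF.
have f0out i : i < m1 -> f0 i \notin flat ts ++ R.
  move=> hi; have fZ : f0 i \in Z by apply: map_f; rewrite mem_iota0.
  rewrite mem_cat negb_or; apply/andP; split.
    by apply/negP => /tsV0; rewrite mem_filter fZ.
  by apply/negP => /(allP outR); rewrite fZ.
have [f [finj fadj ff0]] := stages hp hch hN m1N m10 hcut hlast hlev f0inj f0adj u0 f0out hts stR hreq hK hF.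
pose ab := zip ws csA.
have uab : uniq (map fst ab).
  by rewrite /ab -/unzip1 unzip1_zip ?sw //; apply: map_uniq uG.
have hab : absorbers #|G| N par ab f.
  move=> t /(nthP (0, (x0, [tuple of nseq D.+1 x0]))) [k0 hk0 <-].
  rewrite size_zip sw minnn in hk0; rewrite nth_zip //=.
  have [g1 g2 g3] := f0st k0 hk0; set w := nth 0 ws k0 in g1 g2 g3 *.
  have ww : w \in ws by rewrite mem_nth // sw.
  have /and5P[w1 w2 w3 _ _] := hw _ ww.
  have wG : w < #|G| := leq_trans w1 m1T.
  have hpw : par w < w by apply: hp; rewrite w2.
  split.
  - by rewrite w2 (leq_trans w1 m1N).
  - by rewrite ff0.
  - by rewrite ff0 // (ltn_trans hpw).
  - rewrite /ab -/unzip1 unzip1_zip ?sw //; apply/negP => pw.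
    have := hrho _ ww; have := hrho _ pw; have := levelE hp (isT : pred1 0 0) wG.
    by rewrite /= gtn_eqF // => ->; clear; lia.
  - move=> z hz; have zm := hchw _ _ ww hz; split; first exact: leq_trans zm m1N.
    by rewrite ff0 // g3.
have hfit x y : #|G| - N <= count (fun t => fits (nbrs y) (nbrs x) t.2) ab.
  have -> : count (fun t => fits (nbrs y) (nbrs x) t.2) ab = count (fits (nbrs y) (nbrs x)) csA.
    by rewrite -[in RHS](@unzip2_zip _ _ ws csA) ?sw // count_map.
  rewrite /N subKn; last by apply: leq_trans hkn; rewrite leq_pmull.
  rewrite -(leq_pmul2l bA0); apply: leq_trans (fitA x y).
  by apply: leq_trans hk1; rewrite -mulnA leq_pmull.
have N0 : 0 < N by apply: leq_trans m1N.
have [f1 [f1inj f1adj]] := absorption hp hN N0 erefl finj fadj uab hab hfit.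
exact: copy_of_embedding hv hadjT f1inj f1adj.
Qed.

End Assembly.

(** Absorber requests are the n^2 pairs of vertices. Connection requests are pairs of a vertex and a
    t'-tuple, n^(t' + 1) in number. Hence the exponents 2 and t' + 1 in the two uses of
    [star_selection]. *)
Theorem rich_contains_trees (D c : nat) : 0 < D -> 0 < c -> exists n0, forall (G T : sgraph) a,
  n0 <= #|G| -> rich G a -> #|G| <= c * a -> #|T| = #|G| -> tree T -> max_degree T <= D ->
  contains_copy G T.
Proof.
move=> D0 c0.
pose rA := c * (4 * (5 * D ^ 4 + D.+2)).
have hrA : c <= rA by rewrite leq_pmulr // muln_gt0 addn_gt0 orbT.
have [bA bA0 /(_ 2) [nA hA]] := star_selection D.+1 c0 hrA.
pose rR := 32 * bA * c.
have hrR : c <= rR by rewrite leq_pmull // muln_gt0.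
have [bR bR0 hR] := star_selection D c0 hrR.
pose h := 4 * bR; pose s := D.+1 ^ h; pose t' := s * c.
have s0 : 0 < s by rewrite expn_gt0.
have [nR {}hR] := hR t'.+1.
pose e := 16 * bA; pose q := 16 * bA * (2 * t' + 3 * s).
have e0 : 0 < e by rewrite muln_gt0.
have q0 : 0 < q by rewrite muln_gt0 -/e e0 addn_gt0 [X in _ || X]muln_gt0 s0 !orbT.
have [nT hT] := tiling_thm c0 e0 q0.
pose big := 4 * (5 * D * (D.+1 ^ 4 + 1) + 1).
exists (nA + nR + nT + c * big + 8 * bA + 8 * bR + 1) => G T a hn hr hca hTG tT hD.
have [h1 h2 h3 h4] : [/\ nA <= #|G|, nR <= #|G|, nT <= #|G| & c * big <= #|G|].
  by split; apply: leq_trans hn; clear; clearbody big; lia.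
have [h5 h6 h7] : [/\ 8 * bA <= #|G|, 8 * bR <= #|G| & 0 < #|G|].
  by split; apply: leq_trans hn; clear; clearbody big; lia.
have a0 : 0 < a by case: a hca {hr} => //; rewrite muln0 leqNgt h7.
have hbig : big <= a by rewrite -(leq_pmul2l c0); apply: leq_trans h4 hca.
have [||csA [uA _ stA szA fitA]] :=
  @hA G a [::] (G * G)%type (fun p => nbrs p.2) (fun p => nbrs p.1) h1 hr hca isT.
- by rewrite card_prod mulnn.
- by move=> p; split; apply: nbrs_large.
apply: (@assembly G T D c a D0 c0 hr hca hTG tT hD a0 h7 csA bA bR h q e) => //.
- rewrite -(leq_pmul2l c0); apply: leq_trans hca; apply: leq_trans szA.
  rewrite mulnA -/rA leq_mul2r; apply/orP; right; exact: leq_pmulr.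
- by move=> x y; apply: (fitA (x, y)).
- move=> Z hZ.
  have [||cs [u1 u2 u3 u4 u5]] := @hR G a Z (G * t'.-tuple G)%type (fun p => nbrs p.1)
     (fun p => hubs s p.2) h2 hr hca hZ.
  + by rewrite card_prod card_tuple -expnS.
  + move=> p; split; first exact: nbrs_large.
    by apply: (hubs_large hr hca c0 s0); rewrite size_tuple.
  exists cs; split=> // p A sA.
  have hA' : size A == t' by apply/eqP.
  exact: (u5 (p, Tuple hA')).
- by move=> V0 uV hV; apply: hT h3 hr hca uV hV.
Qed.

(** * From non-extremality and minimum degree to richness *)

Lemma min_degree_le (G : sgraph) (x : G) : min_degree G <= degree x.
Proof.
rewrite /min_degree; have : x \in index_enum G by rewrite mem_index_enum.
elim: (index_enum G) => // y s IH; rewrite inE big_cons => /orP[/eqP <-|/IH].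
  exact: geq_minl.
exact: leq_trans (geq_minr _ _).
Qed.

Lemma degreeE (G : sgraph) (x : G) : degree x = count (adj x) (enum G).
Proof.
rewrite -size_filter; have /card_uniqP <- := filter_uniq (adj x) (enum_uniq G).
by apply: eq_card => y; rewrite inE mem_filter; have -> := mem_enum G y; rewrite andbT.
Qed.

(** Each unordered edge comes from at least one ordered pair, so lower bounds on edges pass to
    [edg]. *)
Lemma edges_between_le (G : sgraph) (A B : seq G) : uniq A -> uniq B ->
  #|edges_between [set x in A] [set y in B]| <= edg A B.
Proof.
move=> uA uB; pose ps := [seq [set x; y] | x <- A, y <- [seq z <- B | adj x z]].
have -> : edg A B = size ps.
  rewrite size_allpairs_dep sumnE big_map; apply: eq_bigr => x _.
  by rewrite size_filter.
apply: leq_trans (card_size ps); apply: subset_leq_card; apply/subsetP => _ /imset2P[x y xA yB ->].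
apply/allpairsPdep; exists x, y; move: xA yB; rewrite !inE => -> /andP[yB axy].
by rewrite mem_filter axy yB.
Qed.

(** Non-extremality concerns sets of one exact size, richness all sets of at least roughly that
    size. Truncating only lowers the count, and padding by at most d vertices adds at most d |Y|
    pairs. *)
Lemma resize (G : sgraph) (A : seq G) m d : uniq A -> m <= #|G| -> m <= size A + d ->
  exists A', [/\ uniq A', size A' = m & forall Y : seq G, edg A' Y <= edg A Y + d * size Y].
Proof.
move=> uA hm hd; pose C := [seq x <- enum G | x \notin A].
have uC : uniq (A ++ C).
  rewrite cat_uniq uA filter_uniq ?enum_uniq // andbT /=.
  by apply/hasPn => x; rewrite mem_filter => /andP[].
have sC : size (A ++ C) = #|G|.
  have /card_uniqP <- := uC; apply: eq_card => x; rewrite mem_cat mem_filter.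
  by have := mem_enum G x; case: (x \in A) => //= ->.
exists (take m (A ++ C)); split.
- exact: take_uniq.
- by rewrite size_takel // sC.
move=> Y; rewrite take_cat; case: ltnP => h.
  apply: leq_trans (leq_addr _ _); rewrite -[X in _ <= edg X _](cat_take_drop m A) edg_catl.
  exact: leq_addr.
rewrite edg_catl leq_add2l; apply: leq_trans (edg_le _ _) _; rewrite leq_mul2r.
apply/orP; right; apply: leq_trans (_ : m - size A <= _); last by rewrite leq_subLR.
by rewrite size_take_min geq_minl.
Qed.

Import Order.TTheory GRing.Theory Num.Theory.
Local Open Scope ring_scope.

(** Since gamma g >= 1, gamma n^2 is at least 1000 a n. Padding both sets by at most 10 a vertices
    costs at most 20 a n, well within the distance to 400 a n. Rounding gives n <= 2000 g a, hence
    nu n <= a. *)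
Lemma non_extremal_rich (R : realType) (gamma nu : R) (g : nat) (G : sgraph) :
  0 < gamma -> 1 / gamma <= g%:R -> nu <= 1 / (2000 * g%:R) -> (1000 * g <= #|G|)%N -> (0 < g)%N ->
  non_extremal gamma G -> (1 / 2 - nu) * #|G|%:R <= (min_degree G)%:R ->
  rich G (#|G| %/ (1000 * g)) /\ (#|G| <= 2000 * g * (#|G| %/ (1000 * g)))%N.
Proof.
move=> gam0 hg hnu hn g0 hext hmin.
set n := #|G| in hn hext hmin *; set a := (n %/ (1000 * g))%N.
have d0 : (0 < 1000 * g)%N by rewrite muln_gt0.
have ha1 : (a * (1000 * g) <= n)%N by apply: leq_trunc_div.
have ha2 : (n < (a + 1) * (1000 * g))%N by rewrite addn1 ltn_ceil.
have a0 : (0 < a)%N by rewrite divn_gt0.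
have ha3 : (n <= 2000 * g * a)%N by move: ha2 a0; clear; clearbody a n; nia.
have gR : 0 < g%:R :> R by rewrite ltr0n.
split=> //; split.
  move=> x; have hx : (min_degree G <= count (adj x) (enum G))%N.
    by rewrite -degreeE; exact: min_degree_le.
  have nun : nu * n%:R <= a%:R.
    have h1 : nu * n%:R <= 1 / (2000 * g%:R) * n%:R by rewrite ler_wpM2r.
    apply: le_trans h1 _; rewrite mulrAC ler_pdivrMr ?mulr_gt0 // mul1r.
    by rewrite mulrC -!natrM ler_nat.
  have h2 : (min_degree G)%:R <= (count (adj x) (enum G))%:R :> R by rewrite ler_nat.
  rewrite -(ler_nat R) natrD !natrM.
  rewrite -/n; move: nun h2 hmin; clear; lra.
move=> A B uA uB hA hB.
have half (X : seq G) : (#|G| <= 2 * size X + 20 * a)%N -> (n./2 <= size X + 10 * a)%N.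
  by rewrite -/n; clear; move: (size X); clearbody a n; lia.
have hn2 : (n./2 <= #|G|)%N by rewrite -/n; clear; lia.
have [A' [uA' sA' eA]] := resize uA hn2 (half _ hA).
have [B' [uB' sB' eB]] := resize uB hn2 (half _ hB).
have cA : #|[set x in A']| = #|G|./2.
  by rewrite cardsE; have /card_uniqP -> := uA'.
have cB : #|[set x in B']| = #|G|./2.
  by rewrite cardsE; have /card_uniqP -> := uB'.
have h1 := hext _ _ cA cB; rewrite -/n in h1.
have h2 := edges_between_le uA' uB'.
have h3 : (1000 * a * n <= edg A' B')%N.
  rewrite -(ler_nat R) (le_trans _ (_ : gamma * n%:R ^+ 2 <= _)) //; last first.
    by apply: le_trans (ltW h1) _; rewrite ler_nat.
  have hgg : 1 <= gamma * g%:R by move: hg; rewrite ler_pdivrMr // mulrC.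
  have h4 : (1000 * a)%:R <= gamma * n%:R.
    have h5 : (a * (1000 * g))%:R <= n%:R :> R by rewrite ler_nat.
    have h6 : gamma * (a * (1000 * g))%:R <= gamma * n%:R by rewrite ler_pM2l.
    apply: le_trans h6; rewrite !natrM.
    have : 0 <= 1000 * a%:R :> R by rewrite mulr_ge0.
    move: hgg; clear; nra.
  by rewrite natrM expr2 mulrA ler_wpM2r.
have h4 := eA B'; have h5 := eB A.
rewrite edg_sym in h5; rewrite [edg B A]edg_sym in h5.
have sA2 := uniq_size uA; rewrite -/n in sA2; rewrite sB' in h4.
have h6 : (10 * a * size A <= 10 * a * n)%N by rewrite leq_mul2l sA2 orbT.
have h7 : (10 * a * n./2 <= 10 * a * n)%N by rewrite leq_mul2l -{2}/n hn2 orbT.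
rewrite -/n; move: h3 h4 h5 h6 h7; clear; gen_atoms; clearbody n a; lia.
Qed.

Theorem theorem2 (R : realType) :
  exists (gamma0 : R) (c : nat),
    [/\ 0 < gamma0, gamma0 < 1 / 4, (0 < c)%N &
      forall (D : nat) (gamma nu : R),
        (2 <= D)%N ->
        0 < gamma -> gamma <= gamma0 ->
        0 < nu -> nu <= gamma ^+ c ->
        exists n0 : nat, forall (n : nat) (G T : sgraph),
          (n0 <= n)%N ->
          #|G| = n ->
          non_extremal gamma G ->
          (1 / 2 - nu) * n%:R <= (min_degree G)%:R ->
          #|T| = n ->
          tree T ->
          (max_degree T <= D)%N ->
          contains_copy G T].
Proof.
(* As g is at most 1/gamma + 1, gamma g <= 2; so nu <= gamma^2 and gamma <= 1/4000 give 2000 g nu <=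
   2000 gamma (gamma g) <= 1. *)
exists (1 / 4000), 2; split=> //; try lra.
move=> D gamma nu D2 gam0 hgam nu0 hnu.
have ig0 : 0 <= 1 / gamma by rewrite divr_ge0 // ltW.
pose g := (Num.truncn (1 / gamma)).+1.
have /andP[t1 t2] := truncn_itv ig0.
have hg : 1 / gamma <= g%:R by rewrite ltW.
have g0 : (0 < g)%N by [].
have gR : 0 < g%:R :> R by rewrite ltr0n.
have hg2 : gamma * g%:R <= 2.
  have : gamma * (Num.truncn (1 / gamma))%:R <= 1.
    by apply: le_trans (_ : gamma * (1 / gamma) <= _); [rewrite ler_pM2l|rewrite mulrC divfK ?gt_eqF].
  by rewrite /g -addn1 natrD mulrDr mulr1; move: hgam; lra.
have hnu2 : nu <= 1 / (2000 * g%:R).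
  apply: le_trans hnu _; rewrite ler_pdivlMr ?mulr_gt0 // expr2.
  have : gamma * (gamma * g%:R) <= 1 / 4000 * 2 by apply: ler_pM => //; rewrite ?mulr_ge0 // ltW.
  by lra.
have [|n1 hn1] := @rich_contains_trees D (2000 * g) (ltnW D2) _; first by rewrite muln_gt0.
exists (n1 + 1000 * g)%N => n G T hn hG hext hmin hT tT hD.
rewrite -hG in hn hmin hT.
have [|hr hca] := non_extremal_rich gam0 hg hnu2 _ g0 hext hmin.
  exact: leq_trans (leq_addl _ _) hn.
apply: hn1 hr hca hT tT hD.
exact: leq_trans (leq_addr _ _) hn.
Qed.
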